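(* For $(t,x,\xi)\in\mathbb R\times\mathbb R^m\times\mathbb R^m$ and $b=(b_0,\dots,b_m)\in\mathbb C^{m+1}$ put $$h^+(t,x,\xi)=(1+4t^2+|x|^2+|\xi|^2)^{-\frac{m+1}2},$$ $$h_b^-(t,x,\xi)=(1+4t^2+|x|^2+|\xi|^2)^{-\frac{m+2}2}\Big(b_0(1-2it)+\sum_{j=1}^mb_j(x_j-i\xi_j)\Big),$$ and for $(\rho,x,\eta)\in\mathbb R\times\mathbb R^m\times\mathbb R^m$ put $$\psi(\rho,x,\eta)=(1+|x|^2)^{\frac12}\Big(\frac{\rho^2}4+|\eta|^2\Big)^{\frac12},$$ $$\varphi_b(\rho,x,\eta)=\omega\left(\begin{pmatrix}(1+|x|^2)^{\frac12}\\ (\frac{\rho^2}4+|\eta|^2)^{\frac12}\end{pmatrix},\ b_0\begin{pmatrix}1\\ \frac\rho2\end{pmatrix}+\sum_{j=1}^mb_j\begin{pmatrix}x_j\\ \eta_j\end{pmatrix}\right),$$ where $\omega$ is the symplectic form on $\mathbb C^2$ given by $\omega\big(\binom{p}{q},\binom{p'}{q'}\big)=qp'-pq'$. Then 1) $\displaystyle(\mathcal F_t\mathcal F_\xi h^+)(\rho,x,\eta)=\frac{\pi^{\frac{m+2}2}}{\Gamma(\frac{m+1}2)}\,K_0\big(2\pi\psi(\rho,x,\eta)\big)$; 2) $\displaystyle(\mathcal F_t\mathcal F_\xi h_b^-)(\rho,x,\eta)=\frac{\pi^{\frac{m+2}2}}{2\,\Gamma(\frac{m+2}2)}\,\frac{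\varphi_b(\rho,x,\eta)}{\psi(\rho,x,\eta)}\,\exp\big(-2\pi\psi(\rho,x,\eta)\big)$.
   Context: $K_\nu$ is the modified Bessel function of the second kind. For functions $F(t,x,\xi)$ on $\mathbb R\times\mathbb R^m\times\mathbb R^m$, $\mathcal F_t$ and $\mathcal F_\xi$ are the partial Fourier transforms $(\mathcal F_tF)(\rho,x,\xi)=\int_{\mathbb R}F(t,x,\xi)e^{-2\pi it\rho}\,dt$ and $(\mathcal F_\xi F)(t,x,\eta)=\int_{\mathbb R^m}F(t,x,\xi)e^{-2\pi i\langle\xi,\eta\rangle}\,d\xi$, regarded as unitary operators on $L^2(\mathbb R^{2m+1})$.
   Formalization: In formula 1) the power of π is (m+1)/2 instead of the printed (m+2)/2, which is wrong by a factor √π (for m=0 the transform of (1+4t²)^(-1/2) is K_0(π|ρ|), with constant 1, not √π). *)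

(* Defs.v *)
From HB Require Import structures.
From mathcomp Require Import all_boot all_order all_algebra.
From mathcomp Require Import all_classical all_reals all_analysis.
From mathcomp Require Export complex.

Set Implicit Arguments.
Unset Strict Implicit.
Unset Printing Implicit Defensive.
Import Order.TTheory GRing.Theory Num.Theory numFieldNormedType.Exports.

Local Open Scope classical_set_scope.
Local Open Scope complex_scope.
Local Open Scope ring_scope.

Lemma sigma_finite_prod d1 d2 (T1 : measurableType d1) (T2 : measurableType d2)
    (R : realType) (m1 : {sigma_finite_measure set T1 -> \bar R})
    (m2 : {sigma_finite_measure set T2 -> \bar R}) :
  sigma_finite setT (m1 \x m2)%E.
Proof.
have /sigma_finiteP[F [TF ndF Foo]] := sigma_finiteT m1.
have /sigma_finiteP[G [TG ndG Goo]] := sigma_finiteT m2.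
exists (fun n => F n `*` G n).
 rewrite -setXTT TF TG predeqE => -[x y]; split.
    move=> [/= [n _ Fnx] [k _ Gky]]; exists (maxn n k) => //; split.
    - by move: x Fnx; exact/subsetPset/ndF/leq_maxl.
    - by move: y Gky; exact/subsetPset/ndG/leq_maxr.
  by move=> [n _ []/= ? ?]; split; exists n.
move=> k; have [? ?] := Foo k; have [? ?] := Goo k.
split; first exact: measurableX.
by rewrite product_measure1E// lte_mul_pinfty// ge0_fin_numE.
Qed.

Section lebesgue_measure_tuple.
Context {R : realType}.

Section cons.
Variables (n : nat) (mu : {sigma_finite_measure set (n.-tuple R) -> \bar R}).

Definition cons_pair (p : R * n.-tuple R) : n.+1.-tuple R :=
  [tuple of p.1 :: p.2].

Lemma measurable_cons_pair : measurable_fun [set: R * n.-tuple R] cons_pair.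
Proof. exact: measurable_cons. Qed.

Definition cons_measure (A : set (n.+1.-tuple R)) : \bar R :=
  pushforward (@lebesgue_measure R \x mu)%E cons_pair A.

Let cons_measure0 : cons_measure set0 = 0%E.
Proof. by rewrite /cons_measure /pushforward preimage_set0 measure0. Qed.

Let cons_measure_ge0 A : (0 <= cons_measure A)%E.
Proof. by rewrite /cons_measure /pushforward measure_ge0. Qed.

Let cons_measure_sigma_additive : semi_sigma_additive cons_measure.
Proof.
move=> F mF tF mUF; rewrite /cons_measure /pushforward preimage_bigcup.
apply: measure_semi_sigma_additive.
- by move=> i; rewrite -[X in measurable X]setTI; exact: measurable_cons_pair.
- apply/trivIsetP => /= i j _ _ ij; rewrite -preimage_setI.
  by move/trivIsetP : tF => /(_ _ _ _ _ ij) ->//; rewrite preimage_set0.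
- rewrite -preimage_bigcup -[X in measurable X]setTI.
  exact: measurable_cons_pair.
Qed.

HB.instance Definition _ := isMeasure.Build _ _ _ cons_measure
  cons_measure0 cons_measure_ge0 cons_measure_sigma_additive.

Let cons_measure_sigma_finite : sigma_finite setT cons_measure.
Proof.
have [F FT mF] := sigma_finite_prod (@lebesgue_measure R) mu.
pose uncons (t : n.+1.-tuple R) : R * n.-tuple R :=
  (thead t, [tuple of behead t]).
have consK : cancel cons_pair uncons.
  by case=> x t; rewrite /uncons theadE; congr pair; exact: val_inj.
have unconsK : cancel uncons cons_pair.
  by move=> t; rewrite /cons_pair/= [RHS]tuple_eta.
have muncons : measurable_fun setT uncons.
  apply/measurable_fun_pairP; split.
    exact: measurable_tnth.
  exact: measurable_behead.
exists (fun i => uncons @^-1` F i).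
  by rewrite -preimage_bigcup -FT.
move=> i; have [mFi Fioo] := mF i; split.
  by rewrite -[X in measurable X]setTI; exact: muncons.
rewrite /cons_measure /pushforward -comp_preimage.
rewrite (_ : uncons \o cons_pair = id)//.
by apply/funext => x /=; rewrite consK.
Qed.

HB.instance Definition _ := Measure_isSigmaFinite.Build _ _ _ cons_measure
  cons_measure_sigma_finite.

End cons.

Fixpoint lebesgue_measure_tuple (n : nat) :
    {sigma_finite_measure set (n.-tuple R) -> \bar R} :=
  match n with
  | 0 => \d_ [tuple]
  | n'.+1 => cons_measure (lebesgue_measure_tuple n')
  end.

End lebesgue_measure_tuple.

Section special_functions.
Context {R : realType}.

Definition Gamma (s : R) : R :=
  \int[@lebesgue_measure R]_(u in `]0, +oo[) (u `^ (s - 1) * expR (- u)).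

Definition cosh (u : R) : R := (expR u + expR (- u)) / 2.

(* Modified Bessel function of the second kind, by its classical integral
   representation, valid for z > 0 and every real order nu. *)
Definition BesselK (nu z : R) : R :=
  \int[@lebesgue_measure R]_(u in `]0, +oo[)
    (expR (- z * cosh u) * cosh (nu * u)).

End special_functions.

Section complex_functions.
Context d (T : measurableType d) (R : realType).
Variable mu : {measure set T -> \bar R}.
Implicit Types f g : T -> R[i].

Definition Cintegral f : R[i] :=
  (\int[mu]_z complex.Re (f z)) +i* (\int[mu]_z complex.Im (f z)).

(* f belongs to L^p(mu; C) *)
Definition CLfun (p : \bar R) f : Prop :=
  (fun z => complex.Re (f z)) \in Lfun mu p /\
  (fun z => complex.Im (f z)) \in Lfun mu p.

Definition CLdist (p : \bar R) f g : \bar R :=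
  'N[mu]_p[(fun z => (Normc.normc (f z - g z))%:E)]%E.

(* The graph of the continuous extension to L^2 of an operator A that is
   isometric for the L^2 norm on the dense subspace L^1 `&` L^2. *)
Definition L2_extension (A : (T -> R[i]) -> (T -> R[i])) f g : Prop :=
  [/\ CLfun 2 f, CLfun 2 g &
      exists u : (T -> R[i])^nat,
        [/\ forall n, CLfun 1 (u n) /\ CLfun 2 (u n),
            forall n, CLfun 2 (A (u n)),
            CLdist 2 (u n) f @[n --> \oo] --> 0%E &
            CLdist 2 (A (u n)) g @[n --> \oo] --> 0%E]].

End complex_functions.

Section fourier.
Context {R : realType} (m : nat).

Notation V := (m.-tuple R).
(* (t, x, xi) is ((t, x), xi). *)
Notation X := (measurableTypeR R * V * V)%type.

Definition dot (x y : V) : R := \sum_(j < m) tnth x j * tnth y j.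

Definition normsq (x : V) : R := dot x x.

Definition lebesgueX : {measure set X -> \bar R} :=
  ((@lebesgue_measure R \x lebesgue_measure_tuple m)
     \x lebesgue_measure_tuple m)%E.

(* e^(i theta) *)
Definition expi (theta : R) : R[i] := cos theta +i* sin theta.

Definition fourier_t_integral (F : X -> R[i]) (z : X) : R[i] :=
  let: (rho, x, xi) := z in
  Cintegral (@lebesgue_measure R)
    (fun t => F (t, x, xi) * expi (- (2 * pi * t * rho))).

Definition fourier_xi_integral (F : X -> R[i]) (z : X) : R[i] :=
  let: (t, x, eta) := z in
  Cintegral (lebesgue_measure_tuple m)
    (fun xi => F (t, x, xi) * expi (- (2 * pi * dot xi eta))).

(* The unitary operators F_t and F_xi of L^2(R^(2m+1)), as relations between
   representatives: [fourier_t F G] reads "F_t F = G almost everywhere".  By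
   Plancherel's theorem G exists for every F in L^2 and is unique a.e. *)
Definition fourier_t : (X -> R[i]) -> (X -> R[i]) -> Prop :=
  L2_extension lebesgueX fourier_t_integral.

Definition fourier_xi : (X -> R[i]) -> (X -> R[i]) -> Prop :=
  L2_extension lebesgueX fourier_xi_integral.

(* F_t F_xi F = G *)
Definition fourier_t_xi (F G : X -> R[i]) : Prop :=
  exists2 H, fourier_xi F H & fourier_t H G.

Definition quad (z : X) : R :=
  let: (t, x, xi) := z in 1 + 4 * t ^+ 2 + normsq x + normsq xi.

Definition hplus (z : X) : R[i] := (quad z `^ (- (m.+1%:R / 2)))%:C.

(* b_0 is [b ord0]; b_1, ..., b_m are the [b (lift ord0 j)] with j : 'I_m. *)
Definition hminus (b : 'I_m.+1 -> R[i]) (z : X) : R[i] :=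
  let: (t, x, xi) := z in
  (quad z `^ (- (m.+2%:R / 2)))%:C *
  (b ord0 * (1 -i* (2 * t)) +
   \sum_(j < m) b (lift ord0 j) * (tnth x j -i* tnth xi j)).

Definition freqnorm (rho : R) (eta : V) : R :=
  Num.sqrt (rho ^+ 2 / 4 + normsq eta).

Definition psi (z : X) : R :=
  let: (rho, x, eta) := z in Num.sqrt (1 + normsq x) * freqnorm rho eta.

Definition omega (v w : R[i] * R[i]) : R[i] := v.2 * w.1 - v.1 * w.2.

Definition phi (b : 'I_m.+1 -> R[i]) (z : X) : R[i] :=
  let: (rho, x, eta) := z in
  omega ((Num.sqrt (1 + normsq x))%:C, (freqnorm rho eta)%:C)
        (b ord0 * 1 + \sum_(j < m) b (lift ord0 j) * (tnth x j)%:C,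
         b ord0 * (rho / 2)%:C + \sum_(j < m) b (lift ord0 j) * (tnth eta j)%:C).

End fourier.

(* Main.v *)
From HB Require Import structures.
Require Import Defs.
From mathcomp Require Import all_boot all_order all_algebra.
From mathcomp Require Import all_classical all_reals all_analysis.
From mathcomp Require Import measurable_realfun complex ring lra.
Import Order.TTheory GRing.Theory Num.Theory numFieldNormedType.Exports.
Set Implicit Arguments.
Unset Strict Implicit.
Unset Printing Implicit Defensive.
Local Open Scope classical_set_scope.
Local Open Scope complex_scope.
Local Open Scope ring_scope.

(** Both functions are superpositions of Gaussians, and the Fourier transform
of a Gaussian is a Gaussian.  Euler's integral

  [Gamma (k/2) * q^(-k/2) = int_0^oo lambda^(k/2 - 1) e^(- lambda q) dlambda]

at [q = 1 + 4 t^2 + |x|^2 + |xi|^2], with [k = m + 1] and [k = m + 2], writes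
h+ and h- as integrals over [lambda] of [e^(- lambda q)], times an affine
factor in the case of h-.  The substitution [lambda = s^4] makes all the powers
of the scale [s] integral.  A Gaussian times an affine factor is transformed
into another one, in [xi] by [fourier_xi_kernel] and in [t] by
[fourier_t_kernel].  After both transforms, at a point where
[A = (1 + |x|^2)^(1/2)] and [B = (rho^2/4 + |eta|^2)^(1/2)], there remain the
integrals over [s > 0] of [s^p e^(- (A^2 s^4 + pi^2 B^2 / s^4))] for [p = -1]
in the case of h+ and for [p = 1], [p = -3] in the case of h-.  Substituting
[s = (pi B / A)^(1/4) e^(u/4)] turns the exponent into [- 2 pi A B cosh u] and
[s^p ds] into [e^((p + 1) u / 4) du] up to a constant.  So [p = -1] gives
[K_0 (2 pi A B)], while the other two give, up to constants,
[K_(1/2) (2 pi A B)], which is elementary because [y = sinh (u/2)] turns it into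
a Gaussian integral ([integral_expR_half_weight]).  These two carry the
coefficients [P] and [- pi Q], where [(P, Q)] is the second argument of the
symplectic form, and combine into [(B P - A Q) / (A B)], that is [phi / psi].

Neither function is integrable, so that its Fourier transform is not an
integral, but a limit in L2 of integrals.  The approximating functions are the
superpositions restricted to the scales in [[1/(n+1), n+1]]; these are
integrable, and Fubini's theorem computes their transforms
([Cintegral_superpose]).  For the convergence, write [g_s] for the kernels and
[phi] for the indicator function of a set of scales.  The weighted
Cauchy-Schwarz inequality

  [|int phi(s) g_s(z) ds|^2
     <= int phi(s) w(s) ds * int_0^oo |g_s(z)|^2 / w(s) ds]

has a first factor that tends to 0 for the discarded scales, and a second one
that depends on [z] only.  The latter is integrable because the L2 norm of
[g_s] is at most a constant times [w(s) = e^(- s^2)]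
([gauss_family_L2_controlled]): the power of [s] that comes from Euler's
integral compensates the volume of the Gaussian.  The same estimate holds before
and after each partial transform, as it should since these are unitary, and
this is all that is needed to identify the limits
([superpose_L2_extension]). *)

(** * The weighted Cauchy-Schwarz inequality *)

Section measurable_inverse.
Context {R : realType}.

Lemma measurable_sqrV : measurable_fun setT (fun s : R => (s ^+ 2)^-1).
Proof.
rewrite (_ : (fun _ => _) = (fun s : R => (s ^+ 2) `^ (-1))).
  by apply: (measurableT_comp (measurable_powR _)); exact: measurable_funX.
by apply/funext => s; rewrite powR_inv1// sqr_ge0.
Qed.

Lemma measurable_inv : measurable_fun setT (fun s : R => s^-1).
Proof.
rewrite (_ : (fun _ => _) = (fun s : R => s * (s ^+ 2)^-1)).
  by apply: measurable_funM => //; exact: measurable_sqrV.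
apply/funext => s; have [->|s0] := eqVneq s 0; first by rewrite invr0 mul0r.
by field.
Qed.

End measurable_inverse.

Section weighted_cauchy_schwarz.
Context d (T : measurableType d) (R : realType).
Variable tau : {measure set T -> \bar R}.
Variables (w phi phi0 f : T -> R).
Hypothesis mw : measurable_fun setT w.
Hypothesis w_gt0 : forall s, 0 < w s.
Hypothesis mphi : measurable_fun setT phi.
Hypothesis phi_ge0 : forall s, 0 <= phi s.
Hypothesis mphi0 : measurable_fun setT phi0.
Hypothesis phi_le : forall s, phi s <= phi0 s.
Hypothesis mf : measurable_fun setT f.

Let mwV : measurable_fun setT (fun s => (w s)^-1).
Proof. exact: (measurableT_comp measurable_inv mw). Qed.

Let energy := (\int[tau]_s (phi0 s * f s ^+ 2 / w s)%:E)%E.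

Lemma measurable_energy_density :
  measurable_fun setT (fun s => phi0 s * f s ^+ 2 / w s).
Proof. by do 2 apply: measurable_funM => //; exact: measurable_funX. Qed.

(** For every [c] this splits [|f|] between [w] and [f ^+ 2 / w]; choosing [c]
after integration yields the product of the two integrals. *)
Lemma weighted_amgm (c : R) s : 0 < c ->
  phi s * `|f s| <= c / 2 * (phi s * w s) + (2 * c)^-1 * (phi0 s * f s ^+ 2 / w s).
Proof.
move=> c0.
apply: (@le_trans _ _ (phi s * (c / 2 * w s + (2 * c)^-1 * (f s ^+ 2 / w s)))).
  apply: ler_wpM2l => //.
  have wn0 := lt0r_neq0 (w_gt0 s); have cn0 := lt0r_neq0 c0.
  rewrite -(real_normK (num_real (f s))).
  set a := `|f s|.
  have -> : c / 2 * w s + (2 * c)^-1 * (a ^+ 2 / w s) =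
     a + (c * w s - a) ^+ 2 / (2 * c * w s).
    by field; rewrite cn0 wn0.
  rewrite lerDl divr_ge0 ?sqr_ge0// !mulr_ge0// ltW//.
rewrite mulrDr; apply: lerD.
  by rewrite mulrCA.
rewrite mulrCA ler_wpM2l ?invr_ge0 ?mulr_ge0 ?(ltW c0)//.
rewrite -mulrA ler_wpM2r ?divr_ge0 ?sqr_ge0 ?(ltW (w_gt0 s))//.
Qed.

Lemma energy_integrable : (\int[tau]_s (phi s * w s)%:E < +oo)%E ->
  (energy < +oo)%E -> tau.-integrable setT (EFin \o (fun s => phi s * f s)).
Proof.
move=> W E.
have mpw : measurable_fun setT (fun s => phi s * w s) by exact: measurable_funM.
apply/integrableP; split.
  by apply/measurable_EFinP; exact: measurable_funM.
apply: (@le_lt_trans _ _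
  (\int[tau]_s ((1 / 2)%:E * (phi s * w s)%:E + ((2 * 1)^-1)%:E * (phi0 s * f s ^+ 2 / w s)%:E))%E).
  apply: ge0_le_integral => //.
  - by apply/measurableT_comp => //; apply/measurable_EFinP; exact: measurable_funM.
  - apply: emeasurable_funD; apply: measurable_funeM; apply/measurable_EFinP => //.
    exact: measurable_energy_density.
  - move=> s _ /=; rewrite -!EFinM -EFinD lee_fin normrM (ger0_norm (phi_ge0 s)).
    exact: weighted_amgm.
have pw0 s : 0 <= phi s * w s by rewrite mulr_ge0 ?(ltW (w_gt0 s)).
have e0 s : 0 <= phi0 s * f s ^+ 2 / w s.
  by rewrite divr_ge0 ?(ltW (w_gt0 s))// mulr_ge0 ?sqr_ge0// (le_trans (phi_ge0 s)).
rewrite ge0_integralD//=; last 4 first.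
- by move=> s _; rewrite -EFinM lee_fin mulr_ge0.
- by apply: measurable_funeM; apply/measurable_EFinP.
- by move=> s _; rewrite -EFinM lee_fin mulr_ge0.
- by apply: measurable_funeM; apply/measurable_EFinP; exact: measurable_energy_density.
have me : measurable_fun setT (fun s => (phi0 s * f s ^+ 2 / w s)%:E).
  by apply/measurable_EFinP; exact: measurable_energy_density.
have mpwE : measurable_fun setT (fun s => (phi s * w s)%:E) by apply/measurable_EFinP.
rewrite !ge0_integralZl_EFin//; try by move=> s _; rewrite lee_fin.
by rewrite lte_add_pinfty ?lte_mul_pinfty// ?lee_fin.
Qed.

(** Only the first factor depends on [phi]: truncation errors, for which it is
small, are thus bounded by one and the same energy integral. *)
Lemma weighted_cauchy_schwarz (e : R) : 0 < e ->
  (\int[tau]_s (phi s * w s)%:E <= e%:E)%E ->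
  (((\int[tau]_s (phi s * f s)) ^+ 2)%:E <= e%:E * energy)%E.
Proof.
move=> e0 We.
have e00 s : 0 <= phi0 s * f s ^+ 2 / w s.
  by rewrite divr_ge0 ?(ltW (w_gt0 s))// mulr_ge0 ?sqr_ge0// (le_trans (phi_ge0 s)).
have pw0 s : 0 <= phi s * w s by rewrite mulr_ge0 ?(ltW (w_gt0 s)).
have E0 : (0 <= energy)%E by apply: integral_ge0 => s _; rewrite lee_fin.
have [Ey|] := eqVneq energy +oo%E.
  by rewrite Ey gt0_muley ?lte_fin// leey.
rewrite -ltey => Efin.
have Wfin : (\int[tau]_s (phi s * w s)%:E < +oo)%E by rewrite (le_lt_trans We)// ltry.
have intf := energy_integrable Wfin Efin.
have mpw : measurable_fun setT (fun s => phi s * w s) by exact: measurable_funM.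
have ipw : tau.-integrable setT (EFin \o (fun s => phi s * w s)).
  apply/integrableP; split; first exact/measurable_EFinP.
  by under eq_integral do rewrite /= ger0_norm//.
have ie : tau.-integrable setT (EFin \o (fun s => phi0 s * f s ^+ 2 / w s)).
  apply/integrableP; split; first exact/measurable_EFinP/measurable_energy_density.
  by under eq_integral do rewrite /= ger0_norm//.
pose E := fine energy.
have EE : energy = E%:E by rewrite fineK// ge0_fin_numE.
have E0' : 0 <= E by rewrite fine_ge0.
rewrite EE -EFinM lee_fin.
pose I := \int[tau]_s (phi s * `|f s|).
have iabs : tau.-integrable setT (EFin \o (fun s => phi s * `|f s|)).
  have := integrable_norm intf; apply: eq_integrable => // s _ /=.
  by rewrite normrM (ger0_norm (phi_ge0 s)).
have II : `|\int[tau]_s (phi s * f s)| <= I.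
  apply: (le_trans (le_normr_Rintegral _ intf)) => //.
  by apply: le_Rintegral => // [|s _]; [exact: integrable_norm|
    rewrite /= normrM (ger0_norm (phi_ge0 s))].
have I0 : 0 <= I := le_trans (normr_ge0 _) II.
have key c : 0 < c -> I <= c / 2 * e + (2 * c)^-1 * E.
  move=> c0.
  apply: (@le_trans _ _ (\int[tau]_s (c / 2 * (phi s * w s) +
      (2 * c)^-1 * (phi0 s * f s ^+ 2 / w s)))).
    apply: le_Rintegral => //.
      rewrite (_ : EFin \o _ = (fun s => (c / 2)%:E * (phi s * w s)%:E +
        ((2 * c)^-1)%:E * (phi0 s * f s ^+ 2 / w s)%:E)%E)//.
      by apply: integrableD => //; exact: integrableZl.
    by move=> s _; exact: weighted_amgm.
  rewrite RintegralD//; last 2 first.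
    by rewrite /comp; under eq_fun do rewrite EFinM; exact: integrableZl.
    by rewrite /comp; under eq_fun do rewrite EFinM; exact: integrableZl.
  rewrite !RintegralZl// lerD//.
  rewrite ler_wpM2l ?divr_ge0 ?(ltW c0)//.
  rewrite -lee_fin fineK// ge0_fin_numE// integral_ge0// => s _.
  by rewrite lee_fin.
rewrite -(real_normK (num_real _)).
apply: (@le_trans _ _ (I ^+ 2)); first by rewrite ler_sqr ?nnegrE.
move: I0; rewrite le_eqVlt => /orP[/eqP <-|I0].
  by rewrite expr0n/= mulr_ge0// ltW.
(* With c = I / e the first term is I / 2; the optimal c would be a square root. *)
have := key (I / e) (divr_gt0 I0 e0).
have -> : I / e / 2 * e + (2 * (I / e))^-1 * E = I / 2 + (e * E) / (2 * I).
  by field; rewrite !lt0r_neq0.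
rewrite -lerBlDl (_ : I - I / 2 = I ^+ 2 / (2 * I)); last by field; rewrite lt0r_neq0.
by rewrite ler_pM2r// invr_gt0 mulr_gt0.
Qed.

End weighted_cauchy_schwarz.

(** * Complex-valued functions *)

Section complex_parts.
Context (R : realType).
Implicit Types (z c : R[i]) (a : R).

Definition sqnorm z : R := complex.Re z ^+ 2 + complex.Im z ^+ 2.

Lemma sqnorm_ge0 z : 0 <= sqnorm z.
Proof. by rewrite addr_ge0 ?sqr_ge0. Qed.

Lemma normc_sqr z : Normc.normc z ^+ 2 = sqnorm z.
Proof. by case: z => x y; rewrite /= sqr_sqrtr// addr_ge0 ?sqr_ge0. Qed.

Lemma ReD z c : complex.Re (z + c) = complex.Re z + complex.Re c.
Proof. by case: z c => ? ? []. Qed.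

Lemma ImD z c : complex.Im (z + c) = complex.Im z + complex.Im c.
Proof. by case: z c => ? ? []. Qed.

Lemma ReB z c : complex.Re (z - c) = complex.Re z - complex.Re c.
Proof. by case: z c => ? ? []. Qed.

Lemma ImB z c : complex.Im (z - c) = complex.Im z - complex.Im c.
Proof. by case: z c => ? ? []. Qed.

Lemma ReN z : complex.Re (- z) = - complex.Re z.
Proof. by case: z. Qed.

Lemma ImN z : complex.Im (- z) = - complex.Im z.
Proof. by case: z. Qed.

Lemma ReM z c : complex.Re (z * c) =
  complex.Re z * complex.Re c - complex.Im z * complex.Im c.
Proof. by case: z c => ? ? []. Qed.

Lemma ImM z c : complex.Im (z * c) =
  complex.Re z * complex.Im c + complex.Im z * complex.Re c.
Proof. by case: z c => ? ? []. Qed.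

Lemma Re_realM a z : complex.Re (a%:C * z) = a * complex.Re z.
Proof. by rewrite ReM /= mul0r subr0. Qed.

Lemma Im_realM a z : complex.Im (a%:C * z) = a * complex.Im z.
Proof. by rewrite ImM /= mul0r addr0. Qed.

Lemma Cext z c : complex.Re z = complex.Re c -> complex.Im z = complex.Im c -> z = c.
Proof. by case: z c => ? ? [] ? ? /= -> ->. Qed.

Lemma Re_le_sqnorm z (D : R) : 0 <= D -> sqnorm z <= D ^+ 2 ->
  `|complex.Re z| <= D.
Proof.
move=> D0 zD; rewrite -ler_sqr ?nnegrE// real_normK ?num_real//.
by apply: le_trans zD; rewrite lerDl sqr_ge0.
Qed.

Lemma Im_le_sqnorm z (D : R) : 0 <= D -> sqnorm z <= D ^+ 2 ->
  `|complex.Im z| <= D.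
Proof.
move=> D0 zD; rewrite -ler_sqr ?nnegrE// real_normK ?num_real//.
by apply: le_trans zD; rewrite lerDr sqr_ge0.
Qed.

End complex_parts.

Section complex_measurable.
Context d (T : measurableType d) (R : realType).
Implicit Types f g : T -> R[i].

Definition Cmeasurable f :=
  measurable_fun setT (fun z => complex.Re (f z)) /\
  measurable_fun setT (fun z => complex.Im (f z)).

Lemma Cmeasurable_cst c : Cmeasurable (fun=> c).
Proof. by split. Qed.

Lemma CmeasurableD f g : Cmeasurable f -> Cmeasurable g ->
  Cmeasurable (fun z => f z + g z).
Proof.
move=> [f1 f2] [g1 g2]; split.
- by under eq_fun do rewrite ReD; exact: measurable_funD.
- by under eq_fun do rewrite ImD; exact: measurable_funD.
Qed.

Lemma CmeasurableB f g : Cmeasurable f -> Cmeasurable g ->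
  Cmeasurable (fun z => f z - g z).
Proof.
move=> [f1 f2] [g1 g2]; split.
- by under eq_fun do rewrite ReB; exact: measurable_funB.
- by under eq_fun do rewrite ImB; exact: measurable_funB.
Qed.

Lemma CmeasurableM f g : Cmeasurable f -> Cmeasurable g ->
  Cmeasurable (fun z => f z * g z).
Proof.
move=> [f1 f2] [g1 g2]; split.
- by under eq_fun do rewrite ReM; apply: measurable_funB; exact: measurable_funM.
- by under eq_fun do rewrite ImM; apply: measurable_funD; exact: measurable_funM.
Qed.

Lemma Cmeasurable_real (h : T -> R) : measurable_fun setT h ->
  Cmeasurable (fun z => (h z)%:C).
Proof. by split. Qed.

Lemma Cmeasurable_sum (I : Type) (r : seq I) (F : I -> T -> R[i]) :
  (forall i, Cmeasurable (F i)) -> Cmeasurable (fun z => \sum_(i <- r) F i z).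
Proof.
move=> mF; elim: r => [|i r IH].
  by under eq_fun do rewrite big_nil; exact: Cmeasurable_cst.
by under eq_fun do rewrite big_cons; exact: CmeasurableD.
Qed.

Lemma measurable_sqnorm f : Cmeasurable f ->
  measurable_fun setT (fun z => sqnorm (f z)).
Proof. by move=> [? ?]; apply: measurable_funD; exact: measurable_funX. Qed.

End complex_measurable.

Lemma Cmeasurable_comp d1 d2 (T1 : measurableType d1) (T2 : measurableType d2)
    (R : realType) (f : T2 -> R[i]) (h : T1 -> T2) :
  Cmeasurable f -> measurable_fun setT h -> Cmeasurable (f \o h).
Proof.
move=> [f1 f2] mh; split; first exact: (measurableT_comp f1 mh).
exact: (measurableT_comp f2 mh).
Qed.

Section complex_integral.
Context d (T : measurableType d) (R : realType).
Variable mu : {measure set T -> \bar R}.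
Implicit Types f g : T -> R[i].

Definition Cintegrable f :=
  mu.-integrable setT (EFin \o (fun z => complex.Re (f z))) /\
  mu.-integrable setT (EFin \o (fun z => complex.Im (f z))).

Lemma Re_Cintegral f : complex.Re (Cintegral mu f) = \int[mu]_z complex.Re (f z).
Proof. by []. Qed.

Lemma Im_Cintegral f : complex.Im (Cintegral mu f) = \int[mu]_z complex.Im (f z).
Proof. by []. Qed.

Lemma CintegrableZ c f : Cintegrable f -> Cintegrable (fun z => f z * c).
Proof.
move=> [f1 f2]; split.
- rewrite (_ : _ \o _ = (fun z => (complex.Re c)%:E * (complex.Re (f z))%:E -
      (complex.Im c)%:E * (complex.Im (f z))%:E)%E).
    by apply: integrableB => //; exact: integrableZl.
  by apply/funext => z; rewrite /= ReM mulrC [X in _ - X]mulrC.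
- rewrite (_ : _ \o _ = (fun z => (complex.Im c)%:E * (complex.Re (f z))%:E +
      (complex.Re c)%:E * (complex.Im (f z))%:E)%E).
    by apply: integrableD => //; exact: integrableZl.
  by apply/funext => z; rewrite /= ImM mulrC [X in _ + X]mulrC.
Qed.

Lemma CintegralZ c f : Cintegrable f ->
  Cintegral mu (fun z => f z * c) = Cintegral mu f * c.
Proof.
move=> [f1 f2]; apply: Cext; rewrite /Cintegral/= ?ReM ?ImM/=.
- under eq_Rintegral do rewrite ReM mulrC [X in _ - X]mulrC.
  rewrite RintegralB//; last 2 first.
  + by rewrite /comp; under eq_fun do rewrite EFinM; exact: integrableZl.
  + by rewrite /comp; under eq_fun do rewrite EFinM; exact: integrableZl.
  by rewrite !RintegralZl// mulrC [X in _ - X]mulrC.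
- under eq_Rintegral do rewrite ImM mulrC [X in _ + X]mulrC.
  rewrite RintegralD//; last 2 first.
  + by rewrite /comp; under eq_fun do rewrite EFinM; exact: integrableZl.
  + by rewrite /comp; under eq_fun do rewrite EFinM; exact: integrableZl.
  by rewrite !RintegralZl// mulrC [X in _ + X]mulrC.
Qed.

Lemma CintegrableD f g : Cintegrable f -> Cintegrable g ->
  Cintegrable (fun z => f z + g z).
Proof.
move=> [f1 f2] [g1 g2]; split.
- rewrite (_ : _ \o _ = (fun z => (complex.Re (f z))%:E + (complex.Re (g z))%:E)%E).
    exact: integrableD.
  by apply/funext => z; rewrite /= ReD.
- rewrite (_ : _ \o _ = (fun z => (complex.Im (f z))%:E + (complex.Im (g z))%:E)%E).
    exact: integrableD.
  by apply/funext => z; rewrite /= ImD.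
Qed.

Lemma CintegralD f g : Cintegrable f -> Cintegrable g ->
  Cintegral mu (fun z => f z + g z) = Cintegral mu f + Cintegral mu g.
Proof.
move=> [f1 f2] [g1 g2]; apply: Cext; rewrite /Cintegral/=.
- by under eq_Rintegral do rewrite ReD; exact: RintegralD.
- by under eq_Rintegral do rewrite ImD; exact: RintegralD.
Qed.

Lemma Cintegrable0 : Cintegrable (fun=> 0).
Proof. by split; exact: integrable0. Qed.

Lemma Cintegral0 : Cintegral mu (fun=> 0) = 0.
Proof.
by apply: Cext; rewrite /Cintegral/= /Rintegral integral0.
Qed.

Lemma Cintegrable_sum (I : Type) (r : seq I) (F : I -> T -> R[i]) :
  (forall i, Cintegrable (F i)) -> Cintegrable (fun z => \sum_(i <- r) F i z).
Proof.
move=> iF; elim: r => [|i r IH].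
  by under eq_fun do rewrite big_nil; exact: Cintegrable0.
by under eq_fun do rewrite big_cons; exact: CintegrableD.
Qed.

Lemma Cintegral_sum (I : Type) (r : seq I) (F : I -> T -> R[i]) :
  (forall i, Cintegrable (F i)) ->
  Cintegral mu (fun z => \sum_(i <- r) F i z) = \sum_(i <- r) Cintegral mu (F i).
Proof.
move=> iF; elim: r => [|i r IH].
  by under eq_fun do rewrite big_nil; rewrite big_nil Cintegral0.
under eq_fun do rewrite big_cons.
by rewrite big_cons CintegralD// ?IH//; exact: Cintegrable_sum.
Qed.

Lemma eq_Cintegral f g : f =1 g -> Cintegral mu f = Cintegral mu g.
Proof. by move=> /funext ->. Qed.

Lemma Cintegrable_dominated f (D : T -> R) : Cmeasurable f ->
  mu.-integrable setT (EFin \o D) ->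
  (forall z, sqnorm (f z) <= D z ^+ 2) -> (forall z, 0 <= D z) -> Cintegrable f.
Proof.
move=> [m1 m2] iD fD D0; split; apply: (le_integrable _ _ _ iD) => //.
- exact/measurable_EFinP.
- by move=> z _ /=; rewrite lee_fin (ger0_norm (D0 z)) Re_le_sqnorm.
- exact/measurable_EFinP.
- by move=> z _ /=; rewrite lee_fin (ger0_norm (D0 z)) Im_le_sqnorm.
Qed.

End complex_integral.

(** * Square-integrability from an integrable majorant *)

Section L2_convergence.
Context d (X : measurableType d) (R : realType).
Variable mu : {measure set X -> \bar R}.
Variable M : X -> \bar R.
Hypothesis mM : measurable_fun setT M.
Hypothesis M_ge0 : forall z, (0 <= M z)%E.
Hypothesis M_fin : (\int[mu]_z M z < +oo)%E.

Lemma CLfun2_energy (f : X -> R[i]) (e : R) : Cmeasurable f -> 0 <= e ->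
  {ae mu, forall z, ((sqnorm (f z))%:E <= e%:E * M z)%E} -> CLfun mu 2 f.
Proof.
move=> [mf1 mf2] e0 fM.
have aux (h : X -> R) : measurable_fun setT h ->
    (forall z, h z ^+ 2 <= sqnorm (f z)) -> h \in Lfun mu 2.
  move=> mh hf; rewrite inE; apply/andP; split; rewrite inE//=.
  rewrite /finite_norm unlock /=.
  apply: poweR_lty.
  apply: (@le_lt_trans _ _ (e%:E * \int[mu]_z M z)%E).
    rewrite -ge0_integralZl_EFin//.
    apply: ae_ge0_le_integral => //.
    - apply/measurable_EFinP; apply: (measurableT_comp (measurable_powR _)).
      exact: measurableT_comp.
    - by move=> z _; rewrite mule_ge0// lee_fin.
    - exact: measurable_funeM.
    - apply: filterS fM => z /= fM _; apply: le_trans fM.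
      by rewrite lee_fin powR_mulrn// real_normK ?num_real.
  by rewrite lte_mul_pinfty// lee_fin.
by split; apply: aux => // z; rewrite /sqnorm ?lerDl ?lerDr sqr_ge0.
Qed.

(** The rate [e n] is uniform in [z], so that the distance is at most
[sqrt (e n * \int M)]. *)
Lemma CLdist2_cvg0 (f : X -> R[i]) (u : (X -> R[i])^nat) (e : R^nat) :
  Cmeasurable f -> (forall n, Cmeasurable (u n)) ->
  (forall n, 0 <= e n) -> e @ \oo --> 0 ->
  {ae mu, forall z, forall n, ((sqnorm (u n z - f z))%:E <= (e n)%:E * M z)%E} ->
  CLdist mu 2 (u n) f @[n --> \oo] --> 0%E.
Proof.
move=> mf mu_ e0 ecvg ub.
pose K := fine (\int[mu]_z M z)%E.
have K0 : 0 <= K by rewrite fine_ge0// integral_ge0.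
have KE : (\int[mu]_z M z = K%:E)%E.
  by rewrite fineK// ge0_fin_numE// integral_ge0.
have le n : (CLdist mu 2 (u n) f <= ((e n * K) `^ 2^-1)%:E)%E.
  rewrite /CLdist unlock /= -poweR_EFin.
  apply: gt0_ler_poweR; rewrite ?invr_ge0//.
  - by rewrite in_itv/= leey andbT; exact: integral_ge0.
  - by rewrite in_itv/= leey andbT lee_fin mulr_ge0.
  rewrite EFinM -KE -ge0_integralZl_EFin//.
  apply: ae_ge0_le_integral => //.
  - apply/measurable_EFinP; apply: (measurableT_comp (measurable_powR _)).
    apply: measurableT_comp => //.
    rewrite (_ : (fun _ => _) = (fun z => Num.sqrt (sqnorm (u n z - f z)))).
      apply: measurableT_comp => //; first by apply: continuous_measurable_fun; exact: sqrt_continuous.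
      by apply: measurable_sqnorm; exact: CmeasurableB.
    apply/funext => z; rewrite -normc_sqr sqrtr_sqr ger0_norm//.
    by case: (u n z - f z) => ? ?; rewrite sqrtr_ge0.
  - by move=> z _; rewrite mule_ge0// lee_fin.
  - exact: measurable_funeM.
  - apply: filterS ub => z /= /(_ n) + _; apply: le_trans.
    by rewrite lee_fin powR_mulrn// real_normK ?num_real// normc_sqr.
apply: (@squeeze_cvge _ _ _ _ (cst 0%E) _ (fun n => ((e n * K) `^ 2^-1)%:E)).
- by apply: nearW => n; rewrite le/= andbT Lnorm_ge0.
- exact: cvg_cst.
- apply: cvg_EFin; first exact: nearW.
  rewrite [X in X @ _ --> _](_ : _ = (fun n => Num.sqrt (e n * K))); last first.
    apply/funext => n /=; rewrite -powR12_sqrt ?mulr_ge0//.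
  rewrite [X in _ --> X](_ : _ = Num.sqrt (0 * K)); last by rewrite mul0r sqrtr0.
  apply: continuous_cvg; first exact: sqrt_continuous.
  exact: cvgMl.
Qed.

End L2_convergence.

(** * Superpositions of a family of functions *)

Section superposition.
Context d (T : measurableType d) d' (X : measurableType d') (R : realType).
Variable tau : {sigma_finite_measure set T -> \bar R}.
Variable mu : {sigma_finite_measure set X -> \bar R}.

Definition superpose (phi : T -> R) (g : T -> X -> R[i]) (z : X) : R[i] :=
  Cintegral tau (fun s => (phi s)%:C * g s z).

(** Measurability in a parameter of an integral that may diverge for some of its
values: the positive and the negative part are treated by Tonelli's theorem. *)
Lemma measurable_Rintegral_param (k : T * X -> R) : measurable_fun setT k ->
  measurable_fun setT (fun z => \int[tau]_s k (s, z)).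
Proof.
move=> mk; pose k' (p : X * T) := (k (p.2, p.1))%:E.
have mk' : measurable_fun setT k'.
  apply/measurable_EFinP; apply: (measurableT_comp mk).
  exact: measurable_fun_pair.
rewrite (_ : (fun z => _) = fine \o (fubini_F tau k'^\+ \- fubini_F tau k'^\-)%E).
  apply: measurableT_comp => //; apply: emeasurable_funB.
  - apply: measurable_fun_fubini_tonelli_F => //.
    exact: measurable_funepos.
  - apply: measurable_fun_fubini_tonelli_F => //.
    exact: measurable_funeneg.
apply/funext => z; rewrite [LHS]/Rintegral integralE [RHS]/=.
by congr (fine (_ - _)); apply: eq_integral => s _; rewrite ?funeposE ?funenegE.
Qed.

Variables (w phi0 : T -> R).
Hypothesis mw : measurable_fun setT w.
Hypothesis w_gt0 : forall s, 0 < w s.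
Hypothesis mphi0 : measurable_fun setT phi0.
Hypothesis phi0_ge0 : forall s, 0 <= phi0 s.
Hypothesis w_fin : (\int[tau]_s (phi0 s * w s)%:E < +oo)%E.

Variable g : T -> X -> R[i].
Hypothesis mg : Cmeasurable (fun p : T * X => g p.1 p.2).

(** The square leaves one factor [w s] after the division by [w s] in [energy]. *)
Definition L2_controlled := exists2 C : R, 0 <= C &
  forall s, phi0 s != 0 -> (\int[mu]_z (sqnorm (g s z))%:E <= (C * w s ^+ 2)%:E)%E.

(** The second factor of the weighted Cauchy-Schwarz inequality for the
superpositions of [g]. *)
Definition energy z := (\int[tau]_s (phi0 s * sqnorm (g s z) / w s)%:E)%E.

Lemma energy_ge0 z : (0 <= energy z)%E.
Proof.
apply: integral_ge0 => s _; rewrite lee_fin divr_ge0 ?(ltW (w_gt0 s))//.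
by rewrite mulr_ge0// sqnorm_ge0.
Qed.

Let density (p : X * T) := phi0 p.2 * sqnorm (g p.2 p.1) / w p.2.

Let mdensity : measurable_fun setT density.
Proof.
have mwV := measurableT_comp measurable_inv mw.
apply: measurable_funM; last exact: (measurableT_comp mwV).
apply: measurable_funM; first exact: measurableT_comp.
apply: measurable_sqnorm.
apply: (Cmeasurable_comp (f := fun p : T * X => g p.1 p.2)
  (h := fun p : X * T => (p.2, p.1)) mg).
exact: measurable_fun_pair.
Qed.

Lemma measurable_energy : measurable_fun setT energy.
Proof.
apply: (@measurable_fun_fubini_tonelli_F _ _ _ _ _ tau (EFin \o density)).
  exact/measurable_EFinP.
move=> [z s]; rewrite lee_fin /density/= divr_ge0 ?(ltW (w_gt0 s))//.
by rewrite mulr_ge0// sqnorm_ge0.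
Qed.

(** By Tonelli's theorem the integral is at most [C] times that of [phi0 * w]. *)
Lemma integral_energy_fin : L2_controlled -> (\int[mu]_z energy z < +oo)%E.
Proof.
move=> [C C0 gC].
have d0 p : (0 <= (EFin \o density) p)%E.
  rewrite lee_fin /density/= divr_ge0 ?(ltW (w_gt0 _))//.
  by rewrite mulr_ge0// sqnorm_ge0.
have mdE : measurable_fun setT (EFin \o density) by exact/measurable_EFinP.
rewrite (_ : (\int[mu]_z energy z)%E =
    (\int[mu]_z fubini_F tau (EFin \o density) z)%E)//.
rewrite -(fubini_tonelli1 (m1 := mu) (m2 := tau) _ mdE d0).
rewrite (fubini_tonelli2 (m1 := mu) (m2 := tau) _ mdE d0).
apply: (@le_lt_trans _ _ (\int[tau]_s (C%:E * (phi0 s * w s)%:E))%E).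
  apply: ge0_le_integral => //.
  - by move=> s _; exact: integral_ge0.
  - exact: measurable_fun_fubini_tonelli_G.
  - apply: measurable_funeM; apply/measurable_EFinP; exact: measurable_funM.
  move=> s _; rewrite /fubini_G.
  rewrite (_ : (fun x : X => (EFin \o density) (x, s)) =
    (fun x => (phi0 s / w s)%:E * (sqnorm (g s x))%:E)%E); last first.
    by apply/funext => z; rewrite /= -EFinM /density/= mulrAC.
  have pw : 0 <= phi0 s / w s by rewrite divr_ge0// ltW.
  rewrite ge0_integralZl_EFin//; last 2 first.
  - by move=> z _; rewrite lee_fin sqnorm_ge0.
  - apply/measurable_EFinP; apply: measurable_sqnorm.
    apply: (Cmeasurable_comp (f := fun p : T * X => g p.1 p.2)
      (h := fun z => (s, z)) mg); exact: measurable_fun_pair.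
  have [->|ps] := eqVneq (phi0 s) 0; first by rewrite !mul0r mul0e mule0.
  apply: (@le_trans _ _ ((phi0 s / w s)%:E * (C * w s ^+ 2)%:E)%E).
    by rewrite lee_wpmul2l ?lee_fin// gC.
  rewrite -!EFinM lee_fin le_eqVlt; apply/orP; left; apply/eqP.
  by field; rewrite lt0r_neq0.
rewrite ge0_integralZl_EFin//.
- by rewrite lte_mul_pinfty// ?lee_fin.
- by move=> s _; rewrite lee_fin mulr_ge0 ?(ltW (w_gt0 s)).
- apply/measurable_EFinP; exact: measurable_funM.
Qed.

Let mgz z : measurable_fun setT (fun s => complex.Re (g s z)) /\
            measurable_fun setT (fun s => complex.Im (g s z)).
Proof.
apply: (Cmeasurable_comp (f := fun p : T * X => g p.1 p.2)
  (h := fun s => (s, z)) mg); exact: measurable_fun_pair.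
Qed.

Lemma energyE z : energy z =
  ((\int[tau]_s (phi0 s * complex.Re (g s z) ^+ 2 / w s)%:E) +
   (\int[tau]_s (phi0 s * complex.Im (g s z) ^+ 2 / w s)%:E))%E.
Proof.
have [m1 m2] := mgz z.
rewrite -ge0_integralD//; last 4 first.
- move=> s _; rewrite lee_fin divr_ge0 ?(ltW (w_gt0 s))// mulr_ge0 ?sqr_ge0//.
- by apply/measurable_EFinP; exact: measurable_energy_density.
- move=> s _; rewrite lee_fin divr_ge0 ?(ltW (w_gt0 s))// mulr_ge0 ?sqr_ge0//.
- by apply/measurable_EFinP; exact: measurable_energy_density.
by apply: eq_integral => s _; rewrite -EFinD /sqnorm mulrDr mulrDl.
Qed.

Lemma superpose_bound (phi : T -> R) (e : R) z :
  measurable_fun setT phi -> (forall s, 0 <= phi s <= phi0 s) -> 0 < e ->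
  (\int[tau]_s (phi s * w s)%:E <= e%:E)%E ->
  ((sqnorm (superpose phi g z))%:E <= e%:E * energy z)%E.
Proof.
move=> mphi phiP e0 phie.
have p0 s : 0 <= phi s by case/andP: (phiP s).
have ple s : phi s <= phi0 s by case/andP: (phiP s).
have [m1 m2] := mgz z.
rewrite /sqnorm EFinD energyE ge0_muleDr; last 2 first.
- by apply: integral_ge0 => s _; rewrite lee_fin divr_ge0 ?(ltW (w_gt0 s))// mulr_ge0 ?sqr_ge0.
- by apply: integral_ge0 => s _; rewrite lee_fin divr_ge0 ?(ltW (w_gt0 s))// mulr_ge0 ?sqr_ge0.
apply: leeD; rewrite /superpose /Cintegral/=.
- under eq_Rintegral do rewrite Re_realM.
  exact: weighted_cauchy_schwarz.
- under eq_Rintegral do rewrite Im_realM.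
  exact: weighted_cauchy_schwarz.
Qed.

Lemma Cmeasurable_superpose (phi : T -> R) : measurable_fun setT phi ->
  Cmeasurable (superpose phi g).
Proof.
move=> mphi; case: mg => m1 m2.
split; rewrite /superpose /Cintegral/=.
- apply: (@measurable_Rintegral_param (fun p => complex.Re ((phi p.1)%:C * g p.1 p.2))).
  under eq_fun do rewrite Re_realM.
  by apply: measurable_funM => //; exact: measurableT_comp.
- apply: (@measurable_Rintegral_param (fun p => complex.Im ((phi p.1)%:C * g p.1 p.2))).
  under eq_fun do rewrite Im_realM.
  by apply: measurable_funM => //; exact: measurableT_comp.
Qed.

(** Finite energy makes both integrals over the scale converge, whence the
truncation error is itself a superposition. *)
Lemma superposeB (phi : T -> R) z :
  measurable_fun setT phi -> (forall s, 0 <= phi s <= phi0 s) ->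
  (energy z < +oo)%E ->
  superpose phi g z - superpose phi0 g z = - superpose (fun s => phi0 s - phi s) g z.
Proof.
move=> mphi phiP; rewrite energyE => E.
have p0 s : 0 <= phi s by case/andP: (phiP s).
have ple s : phi s <= phi0 s by case/andP: (phiP s).
have [m1 m2] := mgz z.
have Efin (h : T -> R) : (0 <= \int[tau]_s (phi0 s * h s ^+ 2 / w s)%:E)%E.
  by apply: integral_ge0 => s _; rewrite lee_fin divr_ge0 ?(ltW (w_gt0 s))// mulr_ge0 ?sqr_ge0.
have E1 : (\int[tau]_s (phi0 s * complex.Re (g s z) ^+ 2 / w s)%:E < +oo)%E.
  by apply: le_lt_trans E; rewrite leeDl.
have E2 : (\int[tau]_s (phi0 s * complex.Im (g s z) ^+ 2 / w s)%:E < +oo)%E.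
  by apply: le_lt_trans E; rewrite leeDr.
have wphi : (\int[tau]_s (phi s * w s)%:E < +oo)%E.
  apply: le_lt_trans w_fin; apply: ge0_le_integral => //.
  - by move=> s _; rewrite lee_fin mulr_ge0 ?(ltW (w_gt0 s)).
  - by apply/measurable_EFinP; exact: measurable_funM.
  - by apply/measurable_EFinP; exact: measurable_funM.
  - by move=> s _; rewrite lee_fin ler_wpM2r ?(ltW (w_gt0 s)).
have aux (h : T -> R) : measurable_fun setT h ->
    (\int[tau]_s (phi0 s * h s ^+ 2 / w s)%:E < +oo)%E ->
    \int[tau]_s (phi s * h s) - \int[tau]_s (phi0 s * h s) =
    - \int[tau]_s ((phi0 s - phi s) * h s).
  move=> mh Eh; apply/eqP; rewrite -opprB eqr_opp eq_sym; apply/eqP.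
  under eq_Rintegral do rewrite mulrBl.
  by rewrite RintegralB//; apply: (@energy_integrable _ _ _ tau w _ phi0).
apply: Cext.
- rewrite ReB ReN !Re_Cintegral.
  have E3 (p : T -> R) : \int[tau]_s complex.Re ((p s)%:C * g s z) =
      \int[tau]_s (p s * complex.Re (g s z)).
    by apply: eq_Rintegral => s _; rewrite Re_realM.
  by rewrite !E3; exact: aux.
- rewrite ImB ImN !Im_Cintegral.
  have E3 (p : T -> R) : \int[tau]_s complex.Im ((p s)%:C * g s z) =
      \int[tau]_s (p s * complex.Im (g s z)).
    by apply: eq_Rintegral => s _; rewrite Im_realM.
  by rewrite !E3; exact: aux.
Qed.

End superposition.

(** * Integral transforms of superpositions *)

Section fourier_of_superposition.
Context d (T : measurableType d) d' (Y : measurableType d') (R : realType).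
Variable tau : {sigma_finite_measure set T -> \bar R}.
Variable nu : {sigma_finite_measure set Y -> \bar R}.

(** Fubini's theorem.  The bound [D] is asked for on the support of [phi] only: the
kernels considered below have a common majorant only at scales that stay away
from 0 and from infinity. *)
Lemma Rintegral_exchange (phi : T -> R) (D : Y -> R) (k : T * Y -> R) :
  measurable_fun setT k ->
  tau.-integrable setT (EFin \o phi) -> nu.-integrable setT (EFin \o D) ->
  (forall s, 0 <= phi s) ->
  (forall s y, phi s != 0 -> `|k (s, y)| <= D y) ->
  \int[nu]_y \int[tau]_s (phi s * k (s, y)) =
  \int[tau]_s (phi s * \int[nu]_y k (s, y)).
Proof.
move=> mk iphi iD phi0 kD.
have mphi : measurable_fun setT phi by apply/measurable_EFinP; exact: measurable_int iphi.
have mD : measurable_fun setT D by apply/measurable_EFinP; exact: measurable_int iD.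
have mks s : measurable_fun setT (fun y => k (s, y)).
  by apply: (measurableT_comp mk); exact: measurable_fun_pair.
have mky y : measurable_fun setT (fun s => k (s, y)).
  by apply: (measurableT_comp mk); exact: measurable_fun_pair.
pose f (p : T * Y) := (phi p.1 * k p)%:E.
have mf : measurable_fun setT f.
  by apply/measurable_EFinP/measurable_funM => //; exact: measurableT_comp.
have le1 s y : phi s * `|k (s, y)| <= phi s * `|D y|.
  have [->|ps] := eqVneq (phi s) 0; first by rewrite !mul0r.
  by rewrite ler_wpM2l// (le_trans (kD _ y ps))// ler_norm.
have iDn : nu.-integrable setT (EFin \o (fun y => `|D y|)) by exact: integrable_norm.
have if_ : (tau \x nu)%E.-integrable setT f.
  apply/(integrable12ltyP tau nu mf).
  apply: (@le_lt_trans _ _ (\int[tau]_s ((\int[nu]_y `|D y|)%:E * (phi s)%:E))%E).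
    apply: ge0_le_integral => //.
    - by move=> s _; exact: integral_ge0.
    - apply: (@measurable_fun_fubini_tonelli_F _ _ _ _ _ nu (abse \o f)); last first.
        by move=> p; exact: abse_ge0.
      exact: measurableT_comp.
    - by apply: measurable_funeM; apply/measurable_EFinP.
    move=> s _; rewrite muleC /Rintegral fineK; last first.
      exact: integrable_fin_num iDn.
    rewrite -ge0_integralZl_EFin//; last by case/integrableP: iDn.
    apply: ge0_le_integral => //.
    - apply: measurableT_comp => //; apply: (measurableT_comp mf).
      exact: measurable_fun_pair.
    - by apply: measurable_funeM; case/integrableP: iDn.
    by move=> y _; rewrite /f/= normrM (ger0_norm (phi0 s)) -EFinM lee_fin.
  have := integrableZl measurableT (\int[nu]_y `|D y|) iphi.
  move=> /integrableP[_]; apply: le_lt_trans.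
  by under [leRHS]eq_integral => s _ do rewrite gee0_abs ?mule_ge0 ?lee_fin ?Rintegral_ge0//.
have := Fubini if_.
have E1 s : (\int[nu]_y f (s, y) = (phi s * \int[nu]_y k (s, y))%:E)%E.
  have [p0|ps] := eqVneq (phi s) 0.
    under eq_integral do rewrite /f/= p0 mul0r.
    by rewrite integral0 p0 mul0r.
  have ik : nu.-integrable setT (EFin \o (fun y => k (s, y))).
    apply: (le_integrable _ _ _ iDn) => //; first exact/measurable_EFinP.
    by move=> y _ /=; rewrite lee_fin normr_id (le_trans (kD _ y ps))// ler_norm.
  rewrite /f/=; under eq_integral do rewrite EFinM.
  rewrite integralZl// EFinM /Rintegral fineK//.
  exact: integrable_fin_num ik.
have E2 y : (\int[tau]_s f (s, y) = (\int[tau]_s (phi s * k (s, y)))%:E)%E.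
  suff : tau.-integrable setT (fun s => f (s, y)).
    by move=> ify; rewrite /Rintegral fineK//; exact: integrable_fin_num ify.
  apply: (le_integrable _ _ _ (integrableZl measurableT `|D y| iphi)) => //.
    by apply/measurable_EFinP; exact: measurable_funM.
  move=> s _; rewrite /f/= lee_fin !normrM normr_id (ger0_norm (phi0 s)).
  by rewrite [leRHS]mulrC.
rewrite (eq_integral _ _ (fun s _ => E1 s)) (eq_integral _ _ (fun y _ => E2 y)).
by rewrite /Rintegral => <-.
Qed.

(** With [e] the phase of a partial Fourier transform, this is how the transform
passes under the integral over the scale.  A phase has modulus 1, hence does
not affect domination. *)
Lemma Cintegral_superpose (phi : T -> R) (D : Y -> R) (g : T -> Y -> R[i])
    (e : Y -> R[i]) :
  Cmeasurable (fun p : T * Y => g p.1 p.2) -> Cmeasurable e ->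
  tau.-integrable setT (EFin \o phi) -> nu.-integrable setT (EFin \o D) ->
  (forall s, 0 <= phi s) -> (forall y, 0 <= D y) ->
  (forall s y, phi s != 0 -> sqnorm (g s y) <= D y ^+ 2) ->
  (forall y, sqnorm (e y) = 1) ->
  Cintegral nu (fun y => superpose tau phi g y * e y) =
  Cintegral tau (fun s => (phi s)%:C * Cintegral nu (fun y => g s y * e y)).
Proof.
move=> mg me iphi iD phi0 D0 gD e1.
have mphi : measurable_fun setT phi by apply/measurable_EFinP; exact: measurable_int iphi.
pose k (p : T * Y) := g p.1 p.2 * e p.2.
have [mk1 mk2] : Cmeasurable k.
  apply: CmeasurableM => //.
  exact: (Cmeasurable_comp (h := snd) me).
have kD s y : phi s != 0 -> sqnorm (k (s, y)) <= D y ^+ 2.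
  move=> ps; rewrite -normc_sqr /k/= Normc.normcM exprMn !normc_sqr e1 mulr1.
  exact: gD.
have inner y : superpose tau phi g y * e y =
    Cintegral tau (fun s => (phi s)%:C * k (s, y)).
  rewrite -CintegralZ; first by apply: eq_Cintegral => s; rewrite /k/= mulrA.
  have mgy : Cmeasurable (fun s => g s y).
    by apply: (Cmeasurable_comp (h := fun s => (s, y)) mg); exact: measurable_fun_pair.
  apply: (@Cintegrable_dominated _ _ _ tau _ (fun s => D y * phi s)).
  - by apply: CmeasurableM => //; exact: Cmeasurable_real.
  - by rewrite /comp; under eq_fun do rewrite EFinM; exact: integrableZl.
  - move=> s; rewrite -normc_sqr Normc.normcM exprMn !normc_sqr exprMn mulrC.
    have [->|ps] := eqVneq (phi s) 0; first by rewrite /sqnorm/= expr0n/= !(mulr0,addr0).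
    by rewrite {2}/sqnorm/= expr0n/= addr0 ler_wpM2r ?sqr_ge0// gD.
  - by move=> s; rewrite mulr_ge0.
rewrite (eq_Cintegral _ inner); apply: Cext; rewrite ?Re_Cintegral ?Im_Cintegral.
- transitivity (\int[nu]_y \int[tau]_s (phi s * complex.Re (k (s, y)))).
    by apply: eq_Rintegral => y _; rewrite Re_Cintegral;
      apply: eq_Rintegral => s _; rewrite Re_realM.
  transitivity (\int[tau]_s (phi s * \int[nu]_y complex.Re (k (s, y)))).
    apply: (Rintegral_exchange (k := fun p => complex.Re (k p)) mk1 iphi iD phi0).
    by move=> s y ps; apply: Re_le_sqnorm => //; exact: kD.
  by apply: eq_Rintegral => s _; rewrite Re_realM Re_Cintegral.
- transitivity (\int[nu]_y \int[tau]_s (phi s * complex.Im (k (s, y)))).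
    by apply: eq_Rintegral => y _; rewrite Im_Cintegral;
      apply: eq_Rintegral => s _; rewrite Im_realM.
  transitivity (\int[tau]_s (phi s * \int[nu]_y complex.Im (k (s, y)))).
    apply: (Rintegral_exchange (k := fun p => complex.Im (k p)) mk2 iphi iD phi0).
    by move=> s y ps; apply: Im_le_sqnorm => //; exact: kD.
  by apply: eq_Rintegral => s _; rewrite Im_realM Im_Cintegral.
Qed.

End fourier_of_superposition.

Section L2_extension_superpose.
Context d (T : measurableType d) d' (X : measurableType d') (R : realType).
Variable tau : {sigma_finite_measure set T -> \bar R}.
Variable mu : {sigma_finite_measure set X -> \bar R}.
Variables (w phi0 : T -> R) (phi : (T -> R)^nat) (eps : R^nat).
Hypothesis mw : measurable_fun setT w.
Hypothesis w_gt0 : forall s, 0 < w s.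
Hypothesis mphi0 : measurable_fun setT phi0.
Hypothesis phi0_ge0 : forall s, 0 <= phi0 s.
Hypothesis w_fin : (\int[tau]_s (phi0 s * w s)%:E < +oo)%E.
Hypothesis mphi : forall n, measurable_fun setT (phi n).
Hypothesis phiP : forall n s, 0 <= phi n s <= phi0 s.
Hypothesis eps_gt0 : forall n, 0 < eps n.
Hypothesis eps_cvg : eps @ \oo --> 0.
Hypothesis phi_eps : forall n,
  (\int[tau]_s ((phi0 s - phi n s) * w s)%:E <= (eps n)%:E)%E.

(** The truncations serve as the approximating sequence that defines the
extension: they converge to the full superposition, and so do their images,
by the energy estimate for each of the two families. *)
Lemma superpose_L2_extension (A : (X -> R[i]) -> (X -> R[i]))
    (g h : T -> X -> R[i]) (F G : X -> R[i]) :
  Cmeasurable (fun p : T * X => g p.1 p.2) ->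
  Cmeasurable (fun p : T * X => h p.1 p.2) ->
  L2_controlled mu w phi0 g -> L2_controlled mu w phi0 h ->
  (forall n, CLfun mu 1 (superpose tau (phi n) g)) ->
  (forall n, A (superpose tau (phi n) g) = superpose tau (phi n) h) ->
  Cmeasurable F -> {ae mu, forall z, F z = superpose tau phi0 g z} ->
  Cmeasurable G -> {ae mu, forall z, G z = superpose tau phi0 h z} ->
  L2_extension mu A F G.
Proof.
move=> mg mh Lg Lh u1 Au mF FE mG GE.
pose e0 := fine (\int[tau]_s (phi0 s * w s)%:E)%E + 1.
have W0 : (0 <= \int[tau]_s (phi0 s * w s)%:E)%E.
  by apply: integral_ge0 => s _; rewrite lee_fin mulr_ge0 ?(ltW (w_gt0 s)).
have e00 : 0 < e0 by rewrite ltr_wpDl// fine_ge0.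
have We0 : (\int[tau]_s (phi0 s * w s)%:E <= e0%:E)%E.
  by rewrite /e0 EFinD fineK ?ge0_fin_numE// leeDl.
have Wn n : (\int[tau]_s (phi n s * w s)%:E <= e0%:E)%E.
  apply: le_trans We0; apply: ge0_le_integral => //.
  - by move=> s _; rewrite lee_fin mulr_ge0 ?(ltW (w_gt0 s))//; case/andP: (phiP n s).
  - by apply/measurable_EFinP; exact: measurable_funM.
  - by apply/measurable_EFinP; exact: measurable_funM.
  - by move=> s _; rewrite lee_fin ler_wpM2r ?(ltW (w_gt0 s))//; case/andP: (phiP n s).
have phi00 s : 0 <= phi0 s <= phi0 s by rewrite phi0_ge0 lexx.
have half (f : T -> X -> R[i]) (H : X -> R[i]) :
    Cmeasurable (fun p : T * X => f p.1 p.2) -> L2_controlled mu w phi0 f ->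
    Cmeasurable H -> {ae mu, forall z, H z = superpose tau phi0 f z} ->
  [/\ CLfun mu 2 H, forall n, CLfun mu 2 (superpose tau (phi n) f) &
      CLdist mu 2 (superpose tau (phi n) f) H @[n --> \oo] --> 0%E].
  move=> mf Lf mH HE.
  have mE := measurable_energy tau mw w_gt0 mphi0 phi0_ge0 mf.
  have E0 := energy_ge0 tau w_gt0 phi0_ge0 f.
  have Efin := integral_energy_fin mw w_gt0 mphi0 phi0_ge0 w_fin mf Lf.
  have bnd p e z := superpose_bound (tau := tau) mw w_gt0 mphi0 phi0_ge0 mf (phi := p) (e := e) z.
  split.
  - apply: (CLfun2_energy mE E0 Efin mH (ltW e00)).
    by apply: filterS HE => z ->; exact: bnd.
  - move=> n; apply: (CLfun2_energy mE E0 Efin _ (ltW e00)).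
      exact: Cmeasurable_superpose.
    by apply: aeW => z; exact: bnd.
  - apply: (@CLdist2_cvg0 _ _ _ mu _ mE E0 Efin _ _ eps) => //.
    + by move=> n; exact: Cmeasurable_superpose.
    + by move=> n; exact: ltW.
    apply: filterS HE => z -> n.
    have [Ey|] := eqVneq (energy tau w phi0 f z) +oo%E.
      by rewrite Ey gt0_muley ?lte_fin// leey.
    rewrite -ltey => Ez.
    rewrite (superposeB mw w_gt0 mphi0 phi0_ge0 w_fin mf)//.
    rewrite (_ : sqnorm (- _) = sqnorm (superpose tau (fun s => phi0 s - phi n s) f z)).
      apply: bnd => //; first exact: measurable_funB.
      by move=> s; case/andP: (phiP n s) => p1 p2; rewrite subr_ge0 p2 lerBlDr lerDl.
    by case: (superpose _ _ _ _) => a b; rewrite /sqnorm/= !sqrrN.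
have [F2 u2 uF] := half g F mg Lg mF FE.
have [G2 v2 vG] := half h G mh Lh mG GE.
split => //; exists (fun n => superpose tau (phi n) g).
split => //.
- by move=> n; rewrite Au.
- by rewrite (_ : (fun n => _) = (fun n => CLdist mu 2 (superpose tau (phi n) h) G))//;
    apply/funext => n; rewrite Au.
Qed.

Lemma superpose_CLfun1 (psi : T -> R) (D : X -> R) (g : T -> X -> R[i]) :
  Cmeasurable (fun p : T * X => g p.1 p.2) ->
  tau.-integrable setT (EFin \o psi) -> (forall s, 0 <= psi s) ->
  mu.-integrable setT (EFin \o D) -> (forall z, 0 <= D z) ->
  (forall s z, psi s != 0 -> sqnorm (g s z) <= D z ^+ 2) ->
  CLfun mu 1 (superpose tau psi g).
Proof.
move=> mg ipsi psi0 iD D0 gD.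
have mpsi : measurable_fun setT psi by apply/measurable_EFinP; exact: measurable_int ipsi.
have [m1 m2] := Cmeasurable_superpose tau mg mpsi.
pose P := \int[tau]_s psi s.
have P0 : 0 <= P by exact: Rintegral_ge0.
have iPD : mu.-integrable setT (fun z => P%:E * (D z)%:E)%E by exact: integrableZl.
have aux z (k : T -> R) : measurable_fun setT k ->
    (forall s, psi s != 0 -> `|k s| <= D z) ->
    `|\int[tau]_s (psi s * k s)| <= P * D z.
  move=> mk kD.
  have le s : `|psi s * k s| <= D z * psi s.
    rewrite normrM (ger0_norm (psi0 s)) mulrC.
    have [->|ps] := eqVneq (psi s) 0; first by rewrite !mulr0.
    by rewrite ler_wpM2r// kD.
  have iDp : tau.-integrable setT (EFin \o (fun s => D z * psi s)).
    by rewrite /comp; under eq_fun do rewrite EFinM; exact: integrableZl.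
  have ik : tau.-integrable setT (EFin \o (fun s => psi s * k s)).
    apply: (le_integrable _ _ _ iDp) => //.
      by apply/measurable_EFinP; exact: measurable_funM.
    by move=> s _ /=; rewrite lee_fin (ger0_norm (mulr_ge0 (D0 z) (psi0 s))).
  apply: (le_trans (le_normr_Rintegral _ ik)) => //.
  rewrite mulrC -RintegralZl//; apply: le_Rintegral => //.
  exact: integrable_norm.
have mgz z : Cmeasurable (fun s => g s z).
  by apply: (Cmeasurable_comp (h := fun s => (s, z)) mg); exact: measurable_fun_pair.
split; apply/Lfun1_integrable; apply: (le_integrable _ _ _ iPD) => //.
- exact/measurable_EFinP.
- move=> z _ /=; rewrite lee_fin (ger0_norm (mulr_ge0 P0 (D0 z))) /superpose/=.
  under eq_Rintegral do rewrite Re_realM.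
  apply: aux; first by case: (mgz z).
  by move=> s ps; apply: Re_le_sqnorm => //; exact: gD.
- exact/measurable_EFinP.
- move=> z _ /=; rewrite lee_fin (ger0_norm (mulr_ge0 P0 (D0 z))) /superpose/=.
  under eq_Rintegral do rewrite Im_realM.
  apply: aux; first by case: (mgz z).
  by move=> s ps; apply: Im_le_sqnorm => //; exact: gD.
Qed.

End L2_extension_superpose.

(** * Change of variables on the line *)

Section substitution.
Context {R : realType}.
Notation mu := (@lebesgue_measure R).
Variables (F F' G : R -> R) (I J : set R) (a b : R^nat).
Hypothesis oI : open I.
Hypothesis ab : forall n, a n <= b n.
Hypothesis a_ni : {homo a : n k / (n <= k)%N >-> k <= n}.
Hypothesis b_nd : {homo b : n k / (n <= k)%N >-> n <= k}.
Hypothesis abI : I = \bigcup_n `[a n, b n]%classic.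
Hypothesis abJ : J = \bigcup_n `[F (a n), F (b n)]%classic.
Hypothesis F_incr : {in I &, {homo F : x y / x < y}}.
Hypothesis dF : forall x, I x -> is_derive x 1 F (F' x).
Hypothesis cF' : forall x, I x -> {for x, continuous F'}.
Hypothesis cG : forall y, J y -> {for y, continuous G}.
Hypothesis G_ge0 : forall y, J y -> 0 <= G y.

Let F_nd x y : I x -> I y -> x <= y -> F x <= F y.
Proof.
move=> Ix Iy; rewrite le_eqVlt => /orP[/eqP ->//|xy].
by apply/ltW/F_incr => //; exact: mem_set.
Qed.

Let Iab n x : a n <= x <= b n -> I x.
Proof. by move=> xab; rewrite abI; exists n => //=; rewrite in_itv. Qed.

Let cdF x : I x -> {for x, continuous F^`()%classic}.
Proof.
have dFE y : I y -> F^`()%classic y = F' y.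
  by move=> Iy; rewrite derive1E; have [_ ->] := dF Iy.
move=> Ix; rewrite /prop_for /continuous_at dFE//.
apply: cvg_trans (cF' Ix); apply: near_eq_cvg.
have := open_nbhs_nbhs (conj oI Ix); apply: filterS => y Iy.
by rewrite dFE.
Qed.

Let cF x : I x -> {for x, continuous F}.
Proof.
move=> Ix; apply/differentiable_continuous/derivable1_diffP.
by have [] := dF Ix.
Qed.

Let subst_n n : (\int[mu]_(y in `[F (a n), F (b n)]) (G y)%:E =
  \int[mu]_(x in `[a n, b n]) (G (F x) * F' x)%:E)%E.
Proof.
have Ia : I (a n) by apply: (Iab (n := n)); rewrite lexx ab.
have Ib : I (b n) by apply: (Iab (n := n)); rewrite lexx ab.
rewrite (@integration_by_substitution_increasing _ F G (a n) (b n))//.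
- apply: eq_integral => x; rewrite inE/= in_itv/= => /Iab Ix.
  by rewrite /= !fctE derive1E; have [_ ->] := dF Ix.
- move=> x y; rewrite !in_itv/= => /Iab Ix /Iab Iy.
  by apply: F_incr; exact: mem_set.
- move=> x; rewrite in_itv/= => /andP[/ltW ax /ltW xb]; apply: cdF.
  by apply: (Iab (n := n)); rewrite ax xb.
- apply/cvg_ex; exists (F^`()%classic (a n)).
  by apply: cvg_at_right_filter; exact: cdF.
- apply/cvg_ex; exists (F^`()%classic (b n)).
  by apply: cvg_at_left_filter; exact: cdF.
- split.
  + move=> x; rewrite in_itv/= => /andP[/ltW ax /ltW xb].
    by have [] := dF (Iab (n := n) (x := x) _); rewrite ?ax ?xb.
  + by apply: cvg_at_right_filter; exact: cF.
  + by apply: cvg_at_left_filter; exact: cF.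
- apply: continuous_in_subspaceT => y; rewrite inE => /= yF.
  by apply: cG; rewrite abJ; exists n.
Qed.

(** On each segment this is the change of variables for continuous functions;
by positivity both sides pass to the monotone limit. *)
Lemma ge0_substitution_exhaustion :
  (\int[mu]_(y in J) (G y)%:E = \int[mu]_(x in I) (G (F x) * F' x)%:E)%E.
Proof.
have mGF n : measurable_fun `[F (a n), F (b n)] (EFin \o G).
  apply/measurable_EFinP; apply: subspace_continuous_measurable_fun => //.
  apply: continuous_in_subspaceT => y; rewrite inE => /= yF.
  by apply: cG; rewrite abJ; exists n.
have mG'F n : measurable_fun `[a n, b n] (fun x => (G (F x) * F' x)%:E).
  apply/measurable_EFinP; apply: subspace_continuous_measurable_fun => //.
  apply: continuous_in_subspaceT => x; rewrite inE/= in_itv/= => xab.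
  have Ix := Iab xab; apply: continuousM; last exact: cF'.
  apply: continuous_comp; first exact: cF.
  apply: cG; rewrite abJ; exists n => //=; rewrite in_itv/=.
  case/andP: xab => ax xb.
  by rewrite !F_nd//; apply: (Iab (n := n)); rewrite ?lexx ?ab.
have intI : interior I = I by exact: (interior_id I).1.
have F'0 x : I x -> 0 <= F' x.
  move=> Ix; have [dFx <-] := dF Ix; rewrite -derive1E.
  apply: (@incr_derive1_ge0 _ F I x).
  - by move=> y; rewrite intI inE => /dF[].
  - by move=> y z /[!inE] Iy Iz; apply: F_incr; exact: mem_set.
  - by rewrite intI.
have cJ : (\int[mu]_(y in `[F (a n), F (b n)]) (G y)%:E)%E @[n --> \oo] -->
    (\int[mu]_(y in J) (G y)%:E)%E.
  rewrite abJ; apply: ge0_nondecreasing_set_cvg_integral => //.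
  - move=> n k nk; apply/subsetPset => y /=; rewrite !in_itv/= => /andP[ya yb].
    apply/andP; split.
    + apply: le_trans ya; apply: F_nd; last exact: a_ni.
        by apply: (Iab (n := k)); rewrite lexx ab.
      by apply: (Iab (n := n)); rewrite lexx ab.
    + apply: (le_trans yb); apply: F_nd; last exact: b_nd.
        by apply: (Iab (n := n)); rewrite lexx ab.
      by apply: (Iab (n := k)); rewrite lexx ab.
  - by move=> n y yF; rewrite lee_fin; apply: G_ge0; rewrite abJ; exists n.
have cI : (\int[mu]_(x in `[a n, b n]) (G (F x) * F' x)%:E)%E @[n --> \oo] -->
    (\int[mu]_(x in I) (G (F x) * F' x)%:E)%E.
  rewrite [in X in _ --> X]abI; apply: ge0_nondecreasing_set_cvg_integral => //.
  - move=> n k nk; apply/subsetPset => y /=; rewrite !in_itv/= => /andP[ya yb].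
    by rewrite (le_trans _ ya) ?a_ni// (le_trans yb)// b_nd.
  - move=> n x /=; rewrite in_itv/= => xab; have Ix := Iab xab.
    rewrite lee_fin mulr_ge0 ?F'0//; apply: G_ge0.
    rewrite abJ; exists n => //=; rewrite in_itv/=; case/andP: xab => ax xb.
    by rewrite !F_nd//; apply: (Iab (n := n)); rewrite ?lexx ?ab.
rewrite -(cvg_lim _ cJ)// -(cvg_lim _ cI)//.
by congr (limn _); apply/funext => n; exact: subst_n.
Qed.

End substitution.

Section whole_line.
Context {R : realType}.
Notation mu := (@lebesgue_measure R).

Lemma ge0_integral_reflect (f : R -> R) : measurable_fun setT f ->
  (forall x, 0 <= f x) ->
  (\int[mu]_x (f x)%:E = \int[mu]_x (f (- x))%:E)%E.
Proof.
move=> mf f0.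
transitivity (\int[pushforward mu (-%R : _ -> measurableTypeR R)]_y (f y)%:E)%E.
  by apply: eq_measure_integral => A mA _; exact/esym/lebesgue_measureN.
rewrite ge0_integral_pushforward//.
- exact/measurable_EFinP.
- by move=> x _; rewrite lee_fin.
Qed.

(** The fundamental theorem of calculus on [[- n, n]], then dominated convergence. *)
Lemma integral_derivative_eq0 (F f : R -> R) :
  (forall x : R, is_derive x 1 F (f x)) -> continuous f ->
  mu.-integrable setT (EFin \o f) ->
  F x @[x --> +oo] --> 0 -> F x @[x --> -oo] --> 0 -> \int[mu]_x f x = 0.
Proof.
move=> dF cf if_ Fy FNy.
have mf : measurable_fun setT f by exact: continuous_measurable_fun.
pose J n := `[- n.+1%:R, n.+1%:R]%classic : set R.
have cF x : {for x, continuous F}.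
  by apply/differentiable_continuous/derivable1_diffP; have [] := dF x.
have FTC n : (\int[mu]_(x in J n) (f x)%:E = (F n.+1%:R - F (- n.+1%:R))%:E)%E.
  rewrite (@continuous_FTC2 _ f F)//.
  - by rewrite gtrN.
  - exact: continuous_subspaceT.
  - split.
    + by move=> x _; have [] := dF x.
    + by apply: cvg_at_right_filter; exact: cF.
    + by apply: cvg_at_left_filter; exact: cF.
  - by move=> x _; rewrite derive1E; have [_ ->] := dF x.
have m1 n : measurable_fun setT ((EFin \o f) \_ (J n)).
  have mJ : measurable (J n) by exact: measurable_itv.
  apply: (measurable_restrictT _ mJ).1.
  by apply/measurable_EFinP; exact: measurable_funS mf.
have m2 : measurable_fun setT (EFin \o f) by exact/measurable_EFinP.
have m3 : {ae mu, forall x, setT x ->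
    ((EFin \o f) \_ (J n)) x @[n --> \oo] --> (EFin \o f) x}.
  apply: aeW => x _; apply: cvg_near_cst.
  exists (Num.truncn `|x|) => // n /= xn; rewrite patchE mem_set//.
  rewrite /J/= in_itv/= -ler_norml.
  by rewrite (le_trans (ltW (truncnS_gt _)))// ler_nat ltnS.
have m4 : mu.-integrable setT (abse \o (EFin \o f)) by exact: integrable_abse.
have m5 : {ae mu, forall x n, setT x ->
    (`|((EFin \o f) \_ (J n)) x| <= (abse \o (EFin \o f)) x)%E}.
  apply: aeW => x n _; rewrite patchE; case: ifP => _ //=.
  by rewrite normr0 lee_fin.
have [_ _ H'] := @dominated_convergence _ (measurableTypeR R) R mu setT measurableT
  _ _ _ m1 m2 m3 m4 m5.
have H : (F n.+1%:R - F (- n.+1%:R))%:E @[n --> \oo] --> (\int[mu]_x (f x)%:E)%E.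
  apply: cvg_trans H'; apply: near_eq_cvg; apply: nearW => n /=.
  by rewrite -FTC [RHS]integral_mkcond.
have H0 : (F n.+1%:R - F (- n.+1%:R))%:E @[n --> \oo] --> (0 - 0)%:E.
  apply: cvg_EFin; first exact: nearW.
  have ny : (n.+1%:R : R) @[n --> \oo] --> +oo.
    apply: (@cvg_comp _ _ _ (fun n => n.+1) (fun n => n%:R : R) _ _ _ _ cvgr_idn).
    by move=> A [N _ NA]; exists N => // n /= Nn; apply: NA => /=; exact: leqW.
  apply: cvgB.
    exact: (cvg_comp _ _ ny Fy).
  have nNy : (- n.+1%:R : R) @[n --> \oo] --> -oo by apply/cvgNrNy.
  exact: (cvg_comp _ _ nNy FNy).
rewrite /Rintegral.
have := cvg_unique _ H H0 => ->//.
by rewrite subr0.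
Qed.

End whole_line.

(** * Gaussians in one variable *)

Lemma integrable_mul_bounded d (T : measurableType d) (R : realType)
    (mu : {measure set T -> \bar R}) (f h : T -> R) : measurable_fun setT h ->
  (forall x, `|h x| <= 1) -> mu.-integrable setT (EFin \o f) ->
  mu.-integrable setT (EFin \o (fun x => f x * h x)).
Proof.
move=> mh h1 if_; apply: (le_integrable _ _ _ if_) => //.
  apply/measurable_EFinP; apply: measurable_funM => //.
  by apply/measurable_EFinP; exact: measurable_int if_.
by move=> x _; rewrite /= lee_fin normrM ler_piMr.
Qed.

Section gaussian.
Context {R : realType}.
Notation mu := (@lebesgue_measure R).
Implicit Types a x eta theta : R.

Definition gaussian a x : R := expR (- (a * x) ^+ 2).

Lemma gaussian_ge0 a x : 0 <= gaussian a x.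
Proof. exact: expR_ge0. Qed.

Lemma continuous_gaussian a : continuous (gaussian a).
Proof.
move=> x; apply: (continuous_comp (f := fun x : R => - (a * x) ^+ 2) (g := expR)).
  apply: continuousN; apply: (continuous_comp (f := fun x => a * x) (g := fun y : R => y ^+ 2)).
    exact: mulrl_continuous.
  exact: exprn_continuous.
exact: continuous_expR.
Qed.

Lemma measurable_gaussian a : measurable_fun setT (gaussian a).
Proof. by apply: continuous_measurable_fun; exact: continuous_gaussian. Qed.

Lemma integral_gaussian a : 0 < a ->
  (\int[mu]_x (gaussian a x)%:E = (Num.sqrt pi / a)%:E)%E.
Proof.
move=> a0.
have := @increasing_ge0_integration_by_substitutionT R (fun x => a * x) gauss_fun.
have dE : (fun x => a * x)^`()%classic = cst a.
  apply/funext => x; rewrite derive1E.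
  rewrite (_ : (fun x => a * x) = a \*: id)//.
  by rewrite deriveZ// derive_id /GRing.scale/= mulr1.
rewrite dE integralT_gauss => H.
have {}H : ((Num.sqrt pi)%:E = \int[mu]_x (((gauss_fun \o (fun x => a * x)) * cst a) x)%:E)%E.
  apply: H.
  - by move=> x y xy; rewrite ltr_pM2l.
  - by move=> x; exact: cst_continuous.
  - exact: is_cvg_cst.
  - exact: is_cvg_cst.
  - by move=> x; apply: derivableM.
  - exact: gt0_cvgMrNy.
  - exact: gt0_cvgMry.
  - exact: continuous_gauss_fun.
  - exact: gauss_fun_ge0.
have : (\int[mu]_x (((gauss_fun \o (fun x => a * x)) * cst a) x)%:E =
        a%:E * \int[mu]_x (gaussian a x)%:E)%E.
  rewrite -ge0_integralZl_EFin//; last 3 first.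
  - by move=> x _; rewrite lee_fin gaussian_ge0.
  - by apply/measurable_EFinP; exact: measurable_gaussian.
  - exact: ltW.
  by apply: eq_integral => x _; rewrite -EFinM !fctE mulrC.
rewrite -H => H1.
have : (0 <= \int[mu]_x (gaussian a x)%:E)%E.
  by apply: integral_ge0 => x _; rewrite lee_fin gaussian_ge0.
move: H1; case: (\int[mu]_x _)%E => [r| |]//.
  rewrite -EFinM => -[->] _; congr EFin; rewrite mulrAC divff ?mul1r//.
  exact: lt0r_neq0.
by rewrite gt0_muley ?lte_fin.
Qed.

Lemma integrable_gaussian a : 0 < a ->
  mu.-integrable setT (EFin \o gaussian a).
Proof.
move=> a0; apply/integrableP; split.
  by apply/measurable_EFinP; exact: measurable_gaussian.
under eq_integral do rewrite /= ger0_norm ?gaussian_ge0//.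
by rewrite integral_gaussian// ltry.
Qed.

Lemma Rintegral_gaussian a : 0 < a -> \int[mu]_x gaussian a x = Num.sqrt pi / a.
Proof. by move=> a0; rewrite /Rintegral integral_gaussian. Qed.

(** In terms of [y = a * x] this is [|y| <= e^(3/4 y^2)], which follows from
[|y| <= 1 + 3/4 y^2]. *)
Lemma norm_gaussian_le a x : 0 < a ->
  `|x| * gaussian a x <= a^-1 * gaussian (a / 2) x.
Proof.
move=> a0; rewrite ler_pdivlMl// mulrA -[X in X * `|x|](ger0_norm (ltW a0)) -normrM.
set y := a * x; rewrite -ler_pdivlMr ?expR_gt0// /gaussian -expRN -expRD.
apply: (@le_trans _ _ (1 + (3 / 4) * `|y| ^+ 2)).
  by have := sqr_ge0 (3 / 2 * `|y| - 1); nra.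
rewrite (_ : - _ + - _ = 3 / 4 * `|y| ^+ 2); first exact: expR_ge1Dx.
by rewrite real_normK ?num_real// mulrAC -/y; field.
Qed.

Lemma integrable_moment_gaussian a : 0 < a ->
  mu.-integrable setT (EFin \o (fun x => x * gaussian a x)).
Proof.
move=> a0; have a20 : 0 < a / 2 by rewrite divr_gt0.
apply: (le_integrable _ _ _ (integrableZl measurableT a^-1 (integrable_gaussian a20))) => //.
  apply/measurable_EFinP; apply: measurable_funM => //.
  exact: measurable_gaussian.
move=> x _; rewrite /= lee_fin normrM (ger0_norm (gaussian_ge0 _ _)).
by rewrite (le_trans (norm_gaussian_le x a0))// ler_norm.
Qed.

Lemma cvg_gaussian_y a : 0 < a -> gaussian a x @[x --> +oo] --> 0.
Proof.
move=> a0; apply: (cvg_comp (fun x => a * x) (@gauss_fun R)).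
  exact: gt0_cvgMry.
exact: cvg_gauss_fun.
Qed.

Lemma cvg_gaussian_Ny a : 0 < a -> gaussian a x @[x --> -oo] --> 0.
Proof.
move=> a0; apply/cvgNy_compNP.
rewrite (_ : gaussian a \o -%R = gaussian a); first exact: cvg_gaussian_y.
by apply/funext => x; rewrite /gaussian/= mulrN sqrrN.
Qed.

Lemma continuous_phase_sin theta eta :
  continuous (fun x : R => sin (theta + 2 * pi * x * eta)).
Proof.
move=> x; apply/differentiable_continuous/derivable1_diffP.
exact: ex_derive.
Qed.

Lemma continuous_phase_cos theta eta :
  continuous (fun x : R => cos (theta + 2 * pi * x * eta)).
Proof.
move=> x; apply/differentiable_continuous/derivable1_diffP.
exact: ex_derive.
Qed.

Lemma integrable_gaussian_cos a theta eta : 0 < a ->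
  mu.-integrable setT (EFin \o (fun x => gaussian a x * cos (theta + 2 * pi * x * eta))).
Proof.
move=> a0; apply: integrable_mul_bounded; last exact: integrable_gaussian.
  by apply: continuous_measurable_fun; exact: continuous_phase_cos.
by move=> x; exact: cos_max.
Qed.

Lemma integrable_moment_gaussian_sin a theta eta : 0 < a ->
  mu.-integrable setT
    (EFin \o (fun x => x * gaussian a x * sin (theta + 2 * pi * x * eta))).
Proof.
move=> a0; apply: integrable_mul_bounded; last exact: integrable_moment_gaussian.
  by apply: continuous_measurable_fun; exact: continuous_phase_sin.
by move=> x; exact: sin_max.
Qed.

(** Integration by parts: the integral of the derivative of
[gaussian a x * sin (theta + 2 * pi * x * eta)] vanishes. *)
Lemma moment_gaussian_sin a theta eta : 0 < a ->
  \int[mu]_x (x * gaussian a x * sin (theta + 2 * pi * x * eta)) =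
  pi * eta / a ^+ 2 * \int[mu]_x (gaussian a x * cos (theta + 2 * pi * x * eta)).
Proof.
move=> a0; have an0 := lt0r_neq0 a0.
pose S x := x * gaussian a x * sin (theta + 2 * pi * x * eta).
pose C x := gaussian a x * cos (theta + 2 * pi * x * eta).
pose F x := gaussian a x * sin (theta + 2 * pi * x * eta).
pose f x := - (2 * a ^+ 2) * S x + 2 * pi * eta * C x.
have iS : mu.-integrable setT (EFin \o S) := integrable_moment_gaussian_sin theta eta a0.
have iC : mu.-integrable setT (EFin \o C) := integrable_gaussian_cos theta eta a0.
have dF x : is_derive x 1 F (f x).
  apply: is_derive_eq; rewrite /GRing.scale/= /f /S /C /gaussian; ring.
have cf : continuous f.
  move=> x; apply/differentiable_continuous/derivable1_diffP.
  by rewrite /f /S /C /gaussian; exact: ex_derive.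
have if_ : mu.-integrable setT (EFin \o f).
  rewrite (_ : _ \o _ = (fun x => (- (2 * a ^+ 2))%:E * (S x)%:E + (2 * pi * eta)%:E * (C x)%:E)%E)//.
  by apply: integrableD => //; exact: integrableZl.
have bnd x : `|F x| <= gaussian a x.
  by rewrite normrM (ger0_norm (gaussian_ge0 _ _)) ler_piMr ?gaussian_ge0// sin_max.
have F0 (G : set_system R) : Filter G -> gaussian a x @[x --> G] --> 0 -> F x @[x --> G] --> 0.
  move=> FG gG; apply: (@squeeze_cvgr _ _ _ _ (fun x => - gaussian a x) (gaussian a)) => //.
    by apply: nearW => x; rewrite -ler_norml.
  by rewrite -oppr0; exact: cvgN.
have : \int[mu]_x f x = 0.
  apply: (integral_derivative_eq0 dF cf if_); apply: F0.
    exact: cvg_gaussian_y.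
  exact: cvg_gaussian_Ny.
rewrite /f RintegralD//; last 2 first.
- by rewrite /comp; under eq_fun do rewrite EFinM; exact: integrableZl.
- by rewrite /comp; under eq_fun do rewrite EFinM; exact: integrableZl.
rewrite !RintegralZl// => H.
apply: (mulfI (_ : 2 * a ^+ 2 != 0)); first by rewrite mulf_neq0// expf_neq0.
have -> : 2 * a ^+ 2 * (pi * eta / a ^+ 2 * \int[mu]_x C x) = 2 * pi * eta * \int[mu]_x C x.
  by field.
by apply/eqP; rewrite -subr_eq0 -oppr_eq0 opprB addrC -mulNr H.
Qed.

(** The left-hand side [Phi eta] solves [Phi' = - (2 pi^2 eta / a^2) Phi], by
[moment_gaussian_sin].  The shift [theta] encodes the real and the imaginary part
of the Fourier transform at once. *)
Lemma fourier_gaussian a theta eta : 0 < a ->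
  \int[mu]_x (gaussian a x * cos (theta + 2 * pi * x * eta)) =
  Num.sqrt pi / a * expR (- (pi / a * eta) ^+ 2) * cos theta.
Proof.
move=> a0; have an0 := lt0r_neq0 a0.
pose f (eta x : R) := gaussian a x * cos (theta + 2 * pi * x * eta).
pose Phi eta := \int[mu]_x f eta x.
have df (y x : R) : is_derive y 1 (f ^~ x)
    (- (2 * pi) * (x * gaussian a x * sin (theta + 2 * pi * x * y))).
  by apply: is_derive_eq; rewrite /GRing.scale/=; ring.
have dfE (y x : R) : partial1of2 f y x =
    - (2 * pi) * (x * gaussian a x * sin (theta + 2 * pi * x * y)).
  by rewrite partial1of2E; have [_ ->] := df y x.
pose G (x : R) := 2 * pi * `|x * gaussian a x|.
have G0 x : 0 <= G x by rewrite !mulr_ge0// pi_ge0.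
have iG : mu.-integrable setT (EFin \o G).
  rewrite (_ : _ \o _ = (fun x => (2 * pi)%:E * `|x * gaussian a x|%:E)%E)//.
  by apply: integrableZl => //; exact: integrable_norm (integrable_moment_gaussian a0).
have fG (y x : R) : `|partial1of2 f y x| <= G x.
  rewrite dfE /G normrM normrN (ger0_norm (_ : 0 <= 2 * pi)) ?mulr_ge0 ?pi_ge0//.
  by rewrite ler_wpM2l ?mulr_ge0 ?pi_ge0// normrM ler_piMr// sin_max.
have intf (y : R) : mu.-integrable setT (EFin \o f y) by exact: integrable_gaussian_cos.
have dPhi (y : R) : is_derive y 1 Phi (- (2 * pi ^+ 2 / a ^+ 2 * y) * Phi y).
  have Iy : `]y - 1, y + 1[%classic y.
    by rewrite /= in_itv/= ltrBlDr !ltrDl !ltr01.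
  have derf1 (z x : R) : `]y - 1, y + 1[%classic z -> setT x -> derivable (f ^~ x) z 1.
    by move=> _ _; have [] := df z x.
  have D1 := @derivable_under_integral R _ _ mu f setT measurableT y _ _ Iy
    (fun z _ => intf z) derf1 G G0 iG (fun z x _ _ => fG z x).
  have D2 := @differentiation_under_integral R _ _ mu f setT measurableT y _ _ Iy
    (fun z _ => intf z) derf1 G G0 iG (fun z x _ _ => fG z x).
  apply: DeriveDef => //.
  rewrite -derive1E D2; under eq_Rintegral do rewrite dfE.
  rewrite RintegralZl//; last exact: integrable_moment_gaussian_sin.
  by rewrite moment_gaussian_sin// /Phi/f; field.
pose Psi y := Phi y * expR ((pi / a * y) ^+ 2).
have dPsi (y : R) : is_derive y 1 Psi 0.
  by apply: is_derive_eq; rewrite /GRing.scale/=; field.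
have := is_derive_0_is_cst eta 0 dPsi.
rewrite /Psi mulr0 expr0n/= expR0 mulr1 => H.
have -> : \int[mu]_x (gaussian a x * cos (theta + 2 * pi * x * eta)) = Phi eta by [].
have -> : Phi eta = Phi 0 * expR (- (pi / a * eta) ^+ 2).
  by rewrite -H -mulrA -expRD subrr expR0 mulr1.
rewrite -[RHS]mulrA [X in _ = _ * X]mulrC mulrA; congr (_ * _).
rewrite /Phi /f; under eq_Rintegral do rewrite mulr0 addr0 mulrC.
rewrite RintegralZl//; last exact: integrable_gaussian.
by rewrite Rintegral_gaussian// mulrC.
Qed.

Lemma fourier_moment_gaussian a theta eta : 0 < a ->
  \int[mu]_x (x * gaussian a x * cos (theta + 2 * pi * x * eta)) =
  pi * eta / a ^+ 2 * (Num.sqrt pi / a) * expR (- (pi / a * eta) ^+ 2) *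
  cos (theta + pi / 2).
Proof.
move=> a0.
under eq_Rintegral do rewrite -sinDpihalf addrAC.
by rewrite moment_gaussian_sin// fourier_gaussian// !mulrA.
Qed.

End gaussian.

(** * Products of functions of one variable *)

Section tensor.
Context d1 d2 (T1 : measurableType d1) (T2 : measurableType d2) (R : realType).
Variables (m1 : {sigma_finite_measure set T1 -> \bar R}).
Variables (m2 : {sigma_finite_measure set T2 -> \bar R}).
Variables (f : T1 -> R) (g : T2 -> R).

Let mtensor : measurable_fun setT f -> measurable_fun setT g ->
  measurable_fun setT (fun p : T1 * T2 => f p.1 * g p.2).
Proof. by move=> mf mg; apply: measurable_funM; exact: measurableT_comp. Qed.

Lemma ge0_integral_tensor : measurable_fun setT f -> measurable_fun setT g ->
  (forall x, 0 <= f x) -> (forall y, 0 <= g y) ->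
  (\int[m1 \x m2]_p (f p.1 * g p.2)%:E =
   (\int[m1]_x (f x)%:E) * (\int[m2]_y (g y)%:E))%E.
Proof.
move=> mf mg f0 g0.
rewrite (fubini_tonelli1 (m1 := m1) (m2 := m2)
  (fun p : T1 * T2 => (f p.1 * g p.2)%:E)); last 2 first.
- by apply/measurable_EFinP; exact: mtensor.
- by move=> p; rewrite lee_fin mulr_ge0.
under eq_integral => x _.
  rewrite /fubini_F; under eq_integral do rewrite /= EFinM.
  rewrite ge0_integralZl_EFin//; last 2 first.
  - by move=> y _; rewrite lee_fin.
  - exact/measurable_EFinP.
  rewrite muleC.
  over.
rewrite ge0_integralZl//; first by rewrite muleC.
- exact/measurable_EFinP.
- by move=> x _; rewrite lee_fin.
- by apply: integral_ge0 => y _; rewrite lee_fin.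
Qed.

End tensor.

Section tensor_integrable.
Context d1 d2 (T1 : measurableType d1) (T2 : measurableType d2) (R : realType).
Variables (m1 : {sigma_finite_measure set T1 -> \bar R}).
Variables (m2 : {sigma_finite_measure set T2 -> \bar R}).
Variables (f : T1 -> R) (g : T2 -> R).
Hypotheses (if_ : m1.-integrable setT (EFin \o f))
           (ig : m2.-integrable setT (EFin \o g)).

Lemma integrable_tensor :
  (m1 \x m2)%E.-integrable setT (fun p => (f p.1 * g p.2)%:E).
Proof.
case/integrableP: if_ => /measurable_EFinP mf ff.
case/integrableP: ig => /measurable_EFinP mg gg.
apply/integrableP; split.
  by apply/measurable_EFinP; apply: measurable_funM; exact: measurableT_comp.
under eq_integral do rewrite /= normrM.
rewrite (ge0_integral_tensor m1 m2 (f := fun x => `|f x|) (g := fun y => `|g y|))//.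
- by rewrite lte_mul_pinfty//; [exact: integral_ge0|rewrite ge0_fin_numE//; exact: integral_ge0].
- exact: measurableT_comp.
- exact: measurableT_comp.
Qed.

End tensor_integrable.

Section tuple_integration.
Context {R : realType}.
Notation mu := (@lebesgue_measure R).
Notation nu := (@lebesgue_measure_tuple R).

Lemma integrable_tuple_cons n (f : n.+1.-tuple R -> R) :
  (mu \x nu n)%E.-integrable setT (fun p => (f (cons_pair p))%:E) ->
  measurable_fun setT f ->
  (nu n.+1).-integrable setT (EFin \o f).
Proof.
move=> /integrableP[_ fin] mf; apply/integrableP; split; first exact/measurable_EFinP.
apply: le_lt_trans fin.
rewrite (@eq_measure_integral _ _ _ _
  (pushforward (mu \x nu n)%E (@cons_pair R n)));
  [exact: measurable_cons_pair|move=> mc|by []].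
rewrite ge0_integral_pushforward//.
by apply: measurableT_comp => //; exact/measurable_EFinP.
Qed.

Lemma Rintegral_tuple_cons n (f : n.+1.-tuple R -> R) :
  (mu \x nu n)%E.-integrable setT (fun p => (f (cons_pair p))%:E) ->
  (forall s, (nu n).-integrable setT (fun x => (f (cons_pair (s, x)))%:E)) ->
  measurable_fun setT f ->
  \int[nu n.+1]_x f x = \int[mu]_s \int[nu n]_x f (cons_pair (s, x)).
Proof.
move=> if_ ifs mf; rewrite {1}/Rintegral.
rewrite (@eq_measure_integral _ _ _ _
  (pushforward (mu \x nu n)%E (@cons_pair R n)));
  [exact: measurable_cons_pair|move=> mc|by []].
rewrite integral_pushforward//; last exact/measurable_EFinP.
rewrite preimage_setT -[X in fine X](integral12_prod_meas1 if_).
congr fine; apply: eq_integral => s _.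
by rewrite /fubini_F /Rintegral fineK//; exact: integrable_fin_num (ifs s).
Qed.

Lemma big_cons_pair (S : Type) (idx : S) (op : S -> S -> S) n
    (h : 'I_n.+1 -> R -> S) s (x : n.-tuple R) :
  \big[op/idx]_(i < n.+1) h i (tnth (cons_pair (s, x)) i) =
  op (h ord0 s) (\big[op/idx]_(i < n) h (lift ord0 i) (tnth x i)).
Proof.
rewrite big_ord_recl; congr (op (h _ _) _).
by apply: eq_bigr => i _; rewrite !(tnth_nth 0).
Qed.

Lemma measurable_prod_tuple n (f : 'I_n -> R -> R) :
  (forall i, measurable_fun setT (f i)) ->
  measurable_fun setT (fun x : n.-tuple R => \prod_(i < n) f i (tnth x i)).
Proof.
move=> mf; apply: measurable_prod => i _; apply: (measurableT_comp (mf i)).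
exact: measurable_tnth.
Qed.

Lemma measurable_sum_tuple n (f : 'I_n -> R -> R) :
  (forall i, measurable_fun setT (f i)) ->
  measurable_fun setT (fun x : n.-tuple R => \sum_(i < n) f i (tnth x i)).
Proof.
move=> mf; apply: measurable_sum => i; apply: (measurableT_comp (mf i)).
exact: measurable_tnth.
Qed.

Lemma integrable_prod_tuple n (f : 'I_n -> R -> R) :
  (forall i, mu.-integrable setT (EFin \o f i)) ->
  (nu n).-integrable setT (EFin \o (fun x => \prod_(i < n) f i (tnth x i))).
Proof.
elim: n f => [|n IH] f if_.
  apply: measurable_bounded_integrable => //=.
  - by rewrite diracT ltry.
  - under eq_fun do rewrite big_ord0; exact: measurable_cst.
  - by exists 1; split => // M M1 x _; rewrite /= big_ord0 normr1 ltW.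
apply: integrable_tuple_cons.
  rewrite (_ : (fun p => _) = (fun p => (f ord0 p.1 *
      \prod_(i < n) f (lift ord0 i) (tnth p.2 i))%:E)); last first.
    by apply/funext => -[s x]; rewrite big_cons_pair.
  exact: integrable_tensor (if_ ord0) (IH (fun i => f (lift ord0 i)) _).
apply: measurable_prod_tuple => i.
by apply/measurable_EFinP; exact: measurable_int (if_ i).
Qed.

Lemma measurable_phase_tuple n (eta : 'I_n -> R) theta :
  measurable_fun setT
    (fun x : n.-tuple R => cos (theta + 2 * pi * \sum_(i < n) tnth x i * eta i)).
Proof.
apply: measurableT_comp.
  by apply: continuous_measurable_fun; exact: continuous_cos.
apply: measurable_funD => //; apply: measurable_funM => //.
by apply: (measurable_sum_tuple (f := fun i s => s * eta i)) => i; exact: mulrr_measurable.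
Qed.

(** A cosine of a sum does not factor, but the hypothesis for every [theta] lets the
phase of the remaining variables be absorbed into [theta], one variable at a
time. *)
Lemma fourier_prod_tuple n (f : 'I_n -> R -> R) (eta r phi : 'I_n -> R) :
  (forall i, mu.-integrable setT (EFin \o f i)) ->
  (forall i theta, \int[mu]_s (f i s * cos (theta + 2 * pi * s * eta i)) =
     r i * cos (theta + phi i)) ->
  forall theta,
  \int[nu n]_x ((\prod_(i < n) f i (tnth x i)) *
     cos (theta + 2 * pi * \sum_(i < n) tnth x i * eta i)) =
  (\prod_(i < n) r i) * cos (theta + \sum_(i < n) phi i).
Proof.
elim: n f eta r phi => [|n IH] f eta r phi if_ fE theta.
  rewrite /Rintegral /= integral_dirac//; last first.
    under eq_fun do rewrite !big_ord0; exact: measurable_cst.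
  by rewrite diracT mul1e !big_ord0 mulr0.
have mf i : measurable_fun setT (f i).
  by apply/measurable_EFinP; exact: measurable_int (if_ i).
have mP : measurable_fun setT (fun x : n.+1.-tuple R =>
    (\prod_(i < n.+1) f i (tnth x i)) *
     cos (theta + 2 * pi * \sum_(i < n.+1) tnth x i * eta i)).
  by apply: measurable_funM; [exact: measurable_prod_tuple|exact: measurable_phase_tuple].
pose g (x : n.-tuple R) := \prod_(i < n) f (lift ord0 i) (tnth x i).
pose ph (x : n.-tuple R) := \sum_(i < n) tnth x i * eta (lift ord0 i).
have ig : (nu n).-integrable setT (EFin \o g).
  exact: (integrable_prod_tuple (f := fun i => f (lift ord0 i))).
have E s x : (\prod_(i < n.+1) f i (tnth (cons_pair (s, x)) i)) *
     cos (theta + 2 * pi * \sum_(i < n.+1) tnth (cons_pair (s, x)) i * eta i) =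
  f ord0 s * (g x * cos ((theta + 2 * pi * s * eta ord0) + 2 * pi * ph x)).
  rewrite big_cons_pair (big_cons_pair _ _ (fun i s => s * eta i)) -mulrA.
  by rewrite mulrDr !addrA !mulrA.
have mcp : measurable_fun setT (@cons_pair R n) by exact: measurable_cons_pair.
rewrite Rintegral_tuple_cons//; last 2 first.
- have it := integrable_tensor (if_ ord0) ig.
  have := @integrable_mul_bounded _ _ _ (mu \x nu n)%E
    (fun p => f ord0 p.1 * g p.2)
    (fun p => cos (theta + 2 * pi * \sum_(i < n.+1) tnth (cons_pair p) i * eta i)).
  move=> /(_ _ _ it) H; apply: eq_integrable (H _ _) => //.
  + by move=> [s x] _ /=; rewrite big_cons_pair.
  + exact: (measurableT_comp (@measurable_phase_tuple n.+1 eta theta) mcp).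
  + by move=> p; exact: cos_max.
- move=> s.
  have := @integrable_mul_bounded _ _ _ (nu n) (fun x => f ord0 s * g x)
    (fun x => cos ((theta + 2 * pi * s * eta ord0) + 2 * pi * ph x)).
  move=> H; apply: eq_integrable (H _ _ _) => //.
  + by move=> x _; rewrite /= E mulrA.
  + exact: measurable_phase_tuple.
  + by move=> x; exact: cos_max.
  + rewrite (_ : _ \o _ = (fun x => (f ord0 s)%:E * (g x)%:E)%E)//.
    exact: integrableZl.
under eq_Rintegral => s _.
  under eq_Rintegral do rewrite E.
  rewrite RintegralZl//; last first.
    apply: integrable_mul_bounded => //.
    - exact: measurable_phase_tuple.
    - by move=> x; exact: cos_max.
  rewrite (IH (fun i => f (lift ord0 i)) _ (fun i => r (lift ord0 i))
    (fun i => phi (lift ord0 i)))//.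
  rewrite mulrCA addrAC.
  over.
rewrite RintegralZl//; last first.
  apply: integrable_mul_bounded => //.
  - by apply: continuous_measurable_fun; exact: continuous_phase_cos.
  - by move=> x; exact: cos_max.
rewrite fE !big_ord_recl -addrA [X in theta + X]addrC.
by ring.
Qed.

End tuple_integration.

(** * Gaussians in several variables *)

Section fourier_value.
Context d (Y : measurableType d) (R : realType).
Variable nu : {measure set Y -> \bar R}.
Variables (p q : Y -> R) (r phi : R).
Hypothesis mq : measurable_fun setT q.
Hypothesis ip : nu.-integrable setT (EFin \o p).
Hypothesis pq : forall theta,
  \int[nu]_y (p y * cos (theta + q y)) = r * cos (theta + phi).

(** The real part is the hypothesis at [theta = 0], the imaginary part the one at
[theta = pi / 2]. *)
Lemma Cintegral_phase :
  Cintegral nu (fun y => (p y)%:C * expi (- q y)) = r%:C * expi (- phi).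
Proof.
apply: Cext; rewrite ?Re_Cintegral ?Im_Cintegral ?Re_realM ?Im_realM.
- under eq_Rintegral do rewrite Re_realM [complex.Re (expi _)]/= cosN -[q _]add0r.
  by rewrite pq add0r [complex.Re (expi _)]/= cosN.
- under eq_Rintegral do rewrite Im_realM [complex.Im (expi _)]/= sinN -cosDpihalf addrC.
  by rewrite pq addrC cosDpihalf [complex.Im (expi _)]/= sinN.
Qed.

Lemma Cmeasurable_expi : Cmeasurable (fun y => expi (- q y)).
Proof.
have mNq : measurable_fun setT (fun y => - q y) by exact: measurableT_comp.
split; apply: measurableT_comp => //; apply: continuous_measurable_fun.
- exact: continuous_cos.
- exact: continuous_sin.
Qed.

Lemma sqnorm_expi (a : R) : sqnorm (expi a) = 1.
Proof. exact: cos2Dsin2. Qed.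

Lemma Cintegrable_phase : Cintegrable nu (fun y => (p y)%:C * expi (- q y)).
Proof.
have [m1 m2] := Cmeasurable_expi.
split.
- rewrite (_ : _ \o _ = EFin \o (fun y => p y * cos (- q y))).
    by apply: integrable_mul_bounded => // y; exact: cos_max.
  by apply/funext => y; rewrite [LHS]/comp Re_realM.
- rewrite (_ : _ \o _ = EFin \o (fun y => p y * sin (- q y))).
    by apply: integrable_mul_bounded => // y; exact: sin_max.
  by apply/funext => y; rewrite [LHS]/comp Im_realM.
Qed.

End fourier_value.

Section gaussian_tuple.
Context {R : realType} (m : nat).
Notation mu := (@lebesgue_measure R).
Notation nu := (@lebesgue_measure_tuple R m).
Notation V := (m.-tuple R).
Implicit Types (a : R) (x eta : V).

Definition gaussian_tuple a x : R := \prod_(i < m) gaussian a (tnth x i).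

Lemma gaussian_tupleE a x : gaussian_tuple a x = expR (- (a ^+ 2 * normsq x)).
Proof.
rewrite /gaussian_tuple /gaussian -expR_sum; congr expR.
rewrite /normsq /dot mulr_sumr -sumrN; apply: eq_bigr => i _.
by rewrite exprMn expr2 [X in _ * X]expr2.
Qed.

Lemma gaussian_tuple_ge0 a x : 0 <= gaussian_tuple a x.
Proof. by rewrite gaussian_tupleE expR_ge0. Qed.

Lemma normsq_ge0 x : 0 <= normsq x.
Proof. by apply: sumr_ge0 => i _; rewrite -expr2 sqr_ge0. Qed.

Lemma measurable_gaussian_tuple a : measurable_fun setT (gaussian_tuple a).
Proof. by apply: (measurable_prod_tuple (f := fun=> gaussian a)) => i; exact: measurable_gaussian. Qed.

Lemma measurable_dot (y : V) : measurable_fun setT (fun x : V => dot x y).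
Proof.
by apply: (measurable_sum_tuple (f := fun i s => s * tnth y i)) => i; exact: mulrr_measurable.
Qed.

Lemma measurable_normsq : measurable_fun setT (@normsq R m).
Proof.
apply: (measurable_sum_tuple (f := fun i (s : R) => s * s)) => i.
exact: measurable_funM.
Qed.

Lemma integrable_gaussian_tuple a : 0 < a ->
  nu.-integrable setT (EFin \o gaussian_tuple a).
Proof.
move=> a0; apply: (integrable_prod_tuple (f := fun=> gaussian a)) => i.
exact: integrable_gaussian.
Qed.

Let rfactor a eta i := Num.sqrt pi / a * expR (- (pi / a * tnth eta i) ^+ 2).

Let prod_rfactor a eta : \prod_(i < m) rfactor a eta i =
  (Num.sqrt pi / a) ^+ m * gaussian_tuple (pi / a) eta.
Proof. by rewrite big_split/= prodr_const card_ord. Qed.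

Lemma fourier_gaussian_tuple a eta theta : 0 < a ->
  \int[nu]_x (gaussian_tuple a x * cos (theta + 2 * pi * dot x eta)) =
  (Num.sqrt pi / a) ^+ m * gaussian_tuple (pi / a) eta * cos (theta + 0).
Proof.
move=> a0.
rewrite (@fourier_prod_tuple R m (fun=> gaussian a) (fun i => tnth eta i)
  (rfactor a eta) (fun=> 0)).
- by rewrite prod_rfactor big1.
- by move=> i; exact: integrable_gaussian.
- by move=> i th; rewrite fourier_gaussian// addr0.
Qed.

(** The Fourier transform at the frequency 0. *)
Lemma integral_gaussian_tuple a : 0 < a ->
  (\int[nu]_x (gaussian_tuple a x)%:E = ((Num.sqrt pi / a) ^+ m)%:E)%E.
Proof.
move=> a0; have ig := integrable_gaussian_tuple a0.
have := fourier_gaussian_tuple [tuple of nseq m 0] 0 a0.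
rewrite addr0 cos0 mulr1 gaussian_tupleE (_ : normsq _ = 0); last first.
  by apply: big1 => i _; rewrite tnth_nseq mul0r.
rewrite mulr0 oppr0 expR0 mulr1 => <-.
rewrite /Rintegral fineK; last first.
  apply: integrable_fin_num => //; apply: integrable_mul_bounded => //.
    by apply: (@measurable_phase_tuple R m (tnth [tuple of nseq m 0])).
  by move=> x; exact: cos_max.
apply: eq_integral => x _; rewrite (_ : dot _ _ = 0) ?mulr0 ?addr0 ?cos0 ?mulr1//.
by apply: big1 => i _; rewrite tnth_nseq mulr0.
Qed.

(* Multiplying the j-th factor by its variable gives the moment in x_j. *)
Let mfactor a (j i : 'I_m) (s : R) := (if i == j then s else 1) * gaussian a s.

Let prod_mfactor a j x : \prod_(i < m) mfactor a j i (tnth x i) =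
  tnth x j * gaussian_tuple a x.
Proof.
by rewrite big_split/= -big_mkcond big_pred1_eq.
Qed.

Let integrable_mfactor a j i : 0 < a -> mu.-integrable setT (EFin \o mfactor a j i).
Proof.
move=> a0; rewrite /mfactor; case: eqP => _; first exact: integrable_moment_gaussian.
by under eq_fun do rewrite mul1r; exact: integrable_gaussian.
Qed.

Lemma integrable_moment_gaussian_tuple a j : 0 < a ->
  nu.-integrable setT (EFin \o (fun x => tnth x j * gaussian_tuple a x)).
Proof.
move=> a0; rewrite (_ : (fun x => _) = (fun x => \prod_(i < m) mfactor a j i (tnth x i))).
  by apply: integrable_prod_tuple => i; exact: integrable_mfactor.
by apply/funext => x; rewrite prod_mfactor.
Qed.

Lemma fourier_moment_gaussian_tuple a j eta theta : 0 < a ->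
  \int[nu]_x (tnth x j * gaussian_tuple a x * cos (theta + 2 * pi * dot x eta)) =
  pi * tnth eta j / a ^+ 2 *
    ((Num.sqrt pi / a) ^+ m * gaussian_tuple (pi / a) eta) * cos (theta + pi / 2).
Proof.
move=> a0.
under eq_Rintegral do rewrite -prod_mfactor.
rewrite (@fourier_prod_tuple R m (mfactor a j) (fun i => tnth eta i)
  (fun i => (if i == j then pi * tnth eta i / a ^+ 2 else 1) * rfactor a eta i)
  (fun i => if i == j then pi / 2 else 0)).
- rewrite big_split/= -!big_mkcond !big_pred1_eq prod_rfactor//.
- by move=> i; exact: integrable_mfactor.
- move=> i th; rewrite /mfactor; case: eqP => _.
    by rewrite fourier_moment_gaussian// /rfactor !mulrA.
  under eq_Rintegral do rewrite mul1r.
  by rewrite fourier_gaussian// addr0 mul1r.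
Qed.

Lemma expi0 : expi (- 0) = 1 :> R[i].
Proof. by rewrite /expi oppr0 cos0 sin0. Qed.

Lemma expiN_pihalf : expi (- (pi / 2)) = - 'i%C :> R[i].
Proof. by rewrite /expi cosN sinN cos_pihalf sin_pihalf; apply: Cext; rewrite /= ?oppr0. Qed.

End gaussian_tuple.

(** * Gaussian kernels with an affine factor *)

Section sigma_finite_product.
Context d1 d2 (T1 : measurableType d1) (T2 : measurableType d2) (R : realType).
Variable m1 : {sigma_finite_measure set T1 -> \bar R}.
Variable m2 : {sigma_finite_measure set T2 -> \bar R}.

(** The product measure under a name that carries its sigma-finiteness. *)
Definition sigma_product : set (T1 * T2) -> \bar R := (m1 \x m2)%E.

HB.instance Definition _ := Measure.copy sigma_product (m1 \x m2)%E.

HB.instance Definition _ := Measure_isSigmaFinite.Build _ _ _ sigma_product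
  (sigma_finite_prod m1 m2).

End sigma_finite_product.

Section lebesgue_sigma_finite.
Context {R : realType} (m : nat).
Notation V := (m.-tuple R).

Definition lebesgue_tx :
    {sigma_finite_measure set (measurableTypeR R * V)%type -> \bar R} :=
  sigma_product (@lebesgue_measure R) (@lebesgue_measure_tuple R m).

Definition lebesgue_txy :
    {sigma_finite_measure set (measurableTypeR R * V * V)%type -> \bar R} :=
  sigma_product lebesgue_tx (@lebesgue_measure_tuple R m).

Lemma lebesgue_txyE : lebesgueX m = lebesgue_txy.
Proof. by []. Qed.

End lebesgue_sigma_finite.

Section kernel.
Context {R : realType} (m : nat).
Notation V := (m.-tuple R).
Notation X := (measurableTypeR R * V * V)%type.
Notation mu := (@lebesgue_measure R).
Notation nu := (@lebesgue_measure_tuple R m).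
Variables (bs : R[i]) (b : 'I_m.+1 -> R[i]).

(** For [bs = 0], [tau = 2 * 'i] and [sig = 'i] this is the affine factor of h-; a
Fourier transform makes [tau] or [sig] real.  The case [b = 0] serves h+, where
the power of the inverse width [l] is smaller by one. *)
Definition affine (l : R) (tau sig : R[i]) (z : X) : R[i] :=
  let: (t, x, y) := z in
  bs * (l^-1)%:C + b ord0 * (1 - tau * t%:C) +
  \sum_(j < m) b (lift ord0 j) * ((tnth x j)%:C - sig * (tnth y j)%:C).

Definition exponent (l al ga : R) (z : X) : R :=
  let: (t, x, y) := z in
  l ^+ 2 * (1 + normsq x) + (al * t) ^+ 2 + ga ^+ 2 * normsq y.

Definition gauss_kernel (kap l al ga : R) (tau sig : R[i]) (z : X) : R[i] :=
  (kap * expR (- exponent l al ga z))%:C * affine l tau sig z.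

Definition coef_norm : R :=
  Normc.normc bs + Normc.normc (b ord0) + \sum_(j < m) Normc.normc (b (lift ord0 j)).

Lemma normc_ge0 (c : R[i]) : 0 <= Normc.normc c.
Proof. by case: c => ? ?; exact: sqrtr_ge0. Qed.

Lemma coef_norm_ge0 : 0 <= coef_norm.
Proof. by rewrite !addr_ge0 ?normc_ge0// sumr_ge0// => j _; exact: normc_ge0. Qed.

Lemma le_normc_sum (I : Type) (r : seq I) (F : I -> R[i]) :
  Normc.normc (\sum_(i <- r) F i) <= \sum_(i <- r) Normc.normc (F i).
Proof.
elim: r => [|i r IH]; first by rewrite !big_nil Normc.normc0.
by rewrite !big_cons (le_trans (le_normcD _ _))// lerD2l.
Qed.

Lemma exponent_ge0 l al ga z : 0 <= exponent l al ga z.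
Proof.
case: z => [[t x] y]; rewrite /exponent !addr_ge0 ?sqr_ge0//.
- by rewrite mulr_ge0 ?sqr_ge0// addr_ge0// normsq_ge0.
- by rewrite mulr_ge0 ?sqr_ge0// normsq_ge0.
Qed.

Lemma normc_real (a : R) : Normc.normc a%:C = `|a|.
Proof. by rewrite /= expr0n/= addr0 sqrtr_sqr. Qed.

Lemma sqr_tnth_le (x : V) j : tnth x j ^+ 2 <= normsq x.
Proof.
rewrite /normsq /dot (bigD1 j)//= -expr2 lerDl sumr_ge0// => i _.
by rewrite -expr2 sqr_ge0.
Qed.

Lemma normc_subr_le (u v : R[i]) (E : R) : 0 <= E ->
  sqnorm u <= E ^+ 2 -> sqnorm v <= E ^+ 2 -> Normc.normc (u - v) <= 2 * E.
Proof.
move=> E0 uE vE; rewrite mulr2n mulrDl mul1r.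
apply: (le_trans (le_normcD _ _)); rewrite normcN; apply: lerD.
- by rewrite -ler_sqr ?nnegrE ?normc_ge0// normc_sqr.
- by rewrite -ler_sqr ?nnegrE ?normc_ge0// normc_sqr.
Qed.

Lemma sqnormM (u v : R[i]) : sqnorm (u * v) = sqnorm u * sqnorm v.
Proof. by rewrite -!normc_sqr Normc.normcM exprMn. Qed.

Lemma sqnorm_real (a : R) : sqnorm a%:C = a ^+ 2.
Proof. by rewrite /sqnorm/= expr0n/= addr0. Qed.

(** The relations between the coefficients and the inverse widths make each
coordinate in the affine factor at most [sqrt (1 + exponent) / l]. *)
Lemma sqnorm_affine_le l al ga tau sig z : 0 < l ->
  sqnorm tau = (al / l) ^+ 2 -> sqnorm sig = (ga / l) ^+ 2 ->
  sqnorm (affine l tau sig z) <=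
    (2 * coef_norm / l) ^+ 2 * (1 + exponent l al ga z).
Proof.
move=> l0 tauE sigE; have ln0 := lt0r_neq0 l0.
have lV0 : 0 <= l^-1 by rewrite invr_ge0 ltW.
have := exponent_ge0 l al ga z.
case: z => [[t x] y] /=; set Q := (X in 0 <= X) => Q0.
pose E := Num.sqrt (1 + Q) / l.
have Q1 : 0 <= 1 + Q by rewrite addr_ge0.
have E0 : 0 <= E by rewrite divr_ge0 ?sqrtr_ge0 ?ltW.
have EE : E ^+ 2 = (1 + Q) / l ^+ 2 by rewrite exprMn sqr_sqrtr// exprVn.
have l20 : 0 < l ^+ 2 by rewrite exprn_gt0.
have leE (a : R) : l ^+ 2 * a <= 1 + Q -> a <= E ^+ 2.
  by move=> H; rewrite EE ler_pdivlMr// mulrC.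
have nx := normsq_ge0 x; have ny := normsq_ge0 y.
have ny2 : 0 <= ga ^+ 2 * normsq y by rewrite mulr_ge0 ?sqr_ge0.
have nt := sqr_ge0 (al * t).
have nlx : 0 <= l ^+ 2 * normsq x by rewrite mulr_ge0 ?sqr_ge0.
have B1 : Normc.normc (bs * (l^-1)%:C) <= Normc.normc bs * (2 * E).
  rewrite Normc.normcM ler_wpM2l ?normc_ge0// normc_real gtr0_norm ?invr_gt0//.
  apply: (@le_trans _ _ E); last by rewrite ler_peMl// ler1n.
  rewrite -ler_sqr ?nnegrE ?invr_ge0 ?(ltW l0)//; apply: leE.
  by rewrite exprVn divff ?lerDl// expf_neq0.
have B2 : Normc.normc (b ord0 * (1 - tau * t%:C)) <= Normc.normc (b ord0) * (2 * E).
  rewrite Normc.normcM ler_wpM2l ?normc_ge0//; apply: normc_subr_le => //.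
  - by rewrite sqnorm_real; apply: leE; rewrite /Q; nra.
  - rewrite sqnormM sqnorm_real tauE; apply: leE.
    rewrite (_ : l ^+ 2 * _ = (al * t) ^+ 2); first by rewrite /Q; nra.
    by field.
have B3 j : Normc.normc (b (lift ord0 j) * ((tnth x j)%:C - sig * (tnth y j)%:C)) <=
    Normc.normc (b (lift ord0 j)) * (2 * E).
  rewrite Normc.normcM ler_wpM2l ?normc_ge0//; apply: normc_subr_le => //.
  - rewrite sqnorm_real; apply: leE.
    have := ler_wpM2l (ltW l20) (sqr_tnth_le x j); rewrite /Q; nra.
  - rewrite sqnormM sqnorm_real sigE; apply: leE.
    rewrite (_ : l ^+ 2 * _ = ga ^+ 2 * tnth y j ^+ 2); last by field.
    have := ler_wpM2l (sqr_ge0 ga) (sqr_tnth_le y j); rewrite /Q; nra.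
rewrite -normc_sqr (_ : _ * (1 + Q) = (coef_norm * (2 * E)) ^+ 2); last first.
  rewrite (_ : (coef_norm * (2 * E)) ^+ 2 = (2 * coef_norm) ^+ 2 * E ^+ 2); last by ring.
  by rewrite EE; field.
rewrite ler_sqr ?nnegrE ?normc_ge0 ?mulr_ge0 ?coef_norm_ge0//.
apply: (le_trans (le_normcD _ _)); rewrite /coef_norm mulrDl; apply: lerD.
  by rewrite mulrDl; apply: (le_trans (le_normcD _ _)); apply: lerD.
rewrite mulr_suml; apply: (le_trans (le_normc_sum _ _)).
by apply: ler_sum.
Qed.

(** One of the two exponentials in the square absorbs [1 + exponent]. *)
Lemma sqnorm_gauss_kernel_le kap l al ga tau sig z : 0 < l ->
  sqnorm tau = (al / l) ^+ 2 -> sqnorm sig = (ga / l) ^+ 2 ->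
  sqnorm (gauss_kernel kap l al ga tau sig z) <=
    (2 * coef_norm * kap / l) ^+ 2 * expR (- exponent l al ga z).
Proof.
move=> l0 tauE sigE; rewrite sqnormM sqnorm_real.
set Q := exponent l al ga z.
apply: (@le_trans _ _ ((kap * expR (- Q)) ^+ 2 * ((2 * coef_norm / l) ^+ 2 * (1 + Q)))).
  by rewrite ler_wpM2l ?sqr_ge0// sqnorm_affine_le.
have -> : (kap * expR (- Q)) ^+ 2 * ((2 * coef_norm / l) ^+ 2 * (1 + Q)) =
    (2 * coef_norm * kap / l) ^+ 2 * (expR (- Q) * (expR (- Q) * (1 + Q))) by ring.
rewrite ler_wpM2l ?sqr_ge0// ler_piMr ?expR_ge0//.
by rewrite expRN mulrC ler_pdivrMr ?expR_gt0// mul1r expR_ge1Dx.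
Qed.

Lemma expR_exponent l al ga t x y :
  expR (- exponent l al ga (t, x, y)) =
  expR (- l ^+ 2) * (gaussian al t * gaussian_tuple l x * gaussian_tuple ga y).
Proof.
rewrite !gaussian_tupleE /gaussian -!expRD; congr expR; rewrite /exponent; ring.
Qed.

Lemma integral_expR_exponent l al ga : 0 < l -> 0 < al -> 0 < ga ->
  (\int[lebesgue_txy m]_z (expR (- exponent l al ga z))%:E =
   (expR (- l ^+ 2) * ((Num.sqrt pi / al) * (Num.sqrt pi / l) ^+ m *
      (Num.sqrt pi / ga) ^+ m))%:E)%E.
Proof.
move=> l0 al0 ga0.
transitivity (\int[lebesgue_txy m]_z ((expR (- l ^+ 2))%:E *
    ((gaussian al z.1.1 * gaussian_tuple l z.1.2) * gaussian_tuple ga z.2)%:E))%E.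
  by apply: eq_integral => -[[t x] y] _; rewrite expR_exponent EFinM.
have m1 : measurable_fun setT (fun p : measurableTypeR R * V => gaussian al p.1 * gaussian_tuple l p.2).
  apply: measurable_funM; first exact: (measurableT_comp (measurable_gaussian al)).
  exact: (measurableT_comp (measurable_gaussian_tuple l)).
have g0 (p : measurableTypeR R * V) : 0 <= gaussian al p.1 * gaussian_tuple l p.2.
  by rewrite mulr_ge0 ?gaussian_ge0 ?gaussian_tuple_ge0.
rewrite ge0_integralZl_EFin ?expR_ge0//; last 2 first.
- by move=> z _; rewrite lee_fin mulr_ge0// gaussian_tuple_ge0.
- apply/measurable_EFinP; apply: measurable_funM; first exact: (measurableT_comp m1).
  exact: (measurableT_comp (measurable_gaussian_tuple ga)).
have H1 := ge0_integral_tensor (lebesgue_tx m) nu m1 (measurable_gaussian_tuple ga) g0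
  (gaussian_tuple_ge0 ga).
have H2 := ge0_integral_tensor mu nu (measurable_gaussian al) (measurable_gaussian_tuple l)
  (gaussian_ge0 al) (gaussian_tuple_ge0 l).
transitivity ((expR (- l ^+ 2))%:E * (\int[lebesgue_tx m]_p (gaussian al p.1 * gaussian_tuple l p.2)%:E *
  \int[nu]_y (gaussian_tuple ga y)%:E))%E.
  by congr (_ * _)%E; exact: H1.
rewrite H2.
by rewrite integral_gaussian// !integral_gaussian_tuple// -!EFinM.
Qed.

End kernel.

(** * Partial Fourier transforms of the kernels *)

Section kernel_fourier.
Context {R : realType} (m : nat).
Notation mu := (@lebesgue_measure R).
Notation nu := (@lebesgue_measure_tuple R m).
Notation V := (m.-tuple R).
Notation X := (measurableTypeR R * V * V)%type.
Variables (bs : R[i]) (b : 'I_m.+1 -> R[i]).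

(** The inverse width [l] in [xi] becomes [pi / l] in [eta], and a factor [xi_j]
becomes [- 'i * (pi / l ^+ 2) * eta_j], so that ['i * xi_j] is replaced by
[(pi / l ^+ 2) * eta_j]. *)
Lemma fourier_xi_kernel kap l al tau (z : X) : 0 < l ->
  fourier_xi_integral (gauss_kernel bs b kap l al l tau 'i%C) z =
  gauss_kernel bs b (kap * (Num.sqrt pi / l) ^+ m) l al (pi / l) tau (pi / l ^+ 2)%:C z.
Proof.
case: z => [[t x] eta] l0; have ln0 := lt0r_neq0 l0.
pose K := kap * expR (- (l ^+ 2 * (1 + normsq x) + (al * t) ^+ 2)).
pose P := bs * (l^-1)%:C + b ord0 * (1 - tau * t%:C) +
  \sum_(j < m) b (lift ord0 j) * (tnth x j)%:C.
pose q (xi : V) := 2 * pi * dot xi eta.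
pose W := (Num.sqrt pi / l) ^+ m * gaussian_tuple (pi / l) eta.
have KW : kap * (Num.sqrt pi / l) ^+ m * expR (- (l ^+ 2 * (1 + normsq x) +
    (al * t) ^+ 2 + (pi / l) ^+ 2 * normsq eta)) = K * W.
  by rewrite /W gaussian_tupleE /K !opprD !expRD; ring.
have Kxi (xi : V) : kap * expR (- (l ^+ 2 * (1 + normsq x) + (al * t) ^+ 2 +
    l ^+ 2 * normsq xi)) = K * gaussian_tuple l xi.
  by rewrite gaussian_tupleE /K -[RHS]mulrA -expRD; congr (_ * expR _); ring.
have mq : measurable_fun setT q by apply: measurable_funM => //; exact: measurable_dot.
pose e0 (xi : V) := (gaussian_tuple l xi)%:C * expi (- q xi).
pose e1 j (xi : V) := (tnth xi j * gaussian_tuple l xi)%:C * expi (- q xi).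
have E0 : Cintegral nu e0 = W%:C.
  have H th := fourier_gaussian_tuple eta th l0.
  by rewrite /e0 (Cintegral_phase H) expi0 mulr1.
have I0 : Cintegrable nu e0.
  exact: (Cintegrable_phase mq (integrable_gaussian_tuple m l0)).
have E1 j : Cintegral nu (e1 j) = (pi * tnth eta j / l ^+ 2 * W)%:C * - 'i%C.
  have H th := fourier_moment_gaussian_tuple j eta th l0.
  by rewrite /e1 (Cintegral_phase H) expiN_pihalf.
have I1 j : Cintegrable nu (e1 j).
  exact: (Cintegrable_phase mq (integrable_moment_gaussian_tuple j l0)).
clearbody K W.
have split_kernel xi : gauss_kernel bs b kap l al l tau 'i%C (t, x, xi) *
    expi (- (2 * pi * dot xi eta)) =
  e0 xi * (K%:C * P) +
  \sum_(j < m) e1 j xi * (- (K%:C * 'i%C * b (lift ord0 j))).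
  rewrite /gauss_kernel /affine /exponent -/(q xi).
  rewrite Kxi.
  have -> : \sum_(j < m) b (lift ord0 j) * ((tnth x j)%:C - 'i%C * (tnth xi j)%:C) =
      \sum_(j < m) b (lift ord0 j) * (tnth x j)%:C -
      'i%C * \sum_(j < m) b (lift ord0 j) * (tnth xi j)%:C.
    by rewrite mulr_sumr -sumrB; apply: eq_bigr => j _; ring.
  have -> : \sum_(j < m) e1 j xi * - (K%:C * 'i%C * b (lift ord0 j)) =
      - (K%:C * 'i%C * e0 xi) * \sum_(j < m) b (lift ord0 j) * (tnth xi j)%:C.
    rewrite mulr_sumr; apply: eq_bigr => j _; rewrite /e1 /e0 rmorphM/=; ring.
  rewrite rmorphM /= /e0 /P; ring.
rewrite /fourier_xi_integral (eq_Cintegral _ split_kernel).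
rewrite CintegralD; last 2 first.
- exact: CintegrableZ.
- by apply: Cintegrable_sum => j; exact: CintegrableZ.
rewrite CintegralZ// E0 Cintegral_sum; last by move=> j; exact: CintegrableZ.
under eq_bigr do rewrite CintegralZ// E1.
rewrite /gauss_kernel /affine /exponent.
rewrite KW.
have -> : \sum_(j < m) b (lift ord0 j) * ((tnth x j)%:C - (pi / l ^+ 2)%:C * (tnth eta j)%:C) =
    \sum_(j < m) b (lift ord0 j) * (tnth x j)%:C -
    (pi / l ^+ 2)%:C * \sum_(j < m) b (lift ord0 j) * (tnth eta j)%:C.
  by rewrite mulr_sumr -sumrB; apply: eq_bigr => j _; ring.
have -> : \sum_(i < m) (pi * tnth eta i / l ^+ 2 * W)%:C * - 'i%C *
     - (K%:C * 'i%C * b (lift ord0 i)) =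
   - (K%:C * W%:C * (pi / l ^+ 2)%:C * \sum_(j < m) b (lift ord0 j) * (tnth eta j)%:C).
  rewrite mulr_sumr -sumrN; apply: eq_bigr => j _.
  rewrite (_ : pi * tnth eta j / l ^+ 2 * W = W * (pi / l ^+ 2) * tnth eta j); last by ring.
  rewrite !rmorphM/=.
  transitivity ('i%C ^+ 2 * (W%:C * (pi%:C * (l ^- 2)%:C) * (tnth eta j)%:C * K%:C * b (lift ord0 j))).
    by ring.
  by rewrite sqr_i; ring.
by rewrite rmorphM/= /P; ring.
Qed.

(** The same computation as for [xi], with a single variable of inverse width
[2 * l]. *)
Lemma fourier_t_kernel kap l ga sig (z : X) : 0 < l ->
  fourier_t_integral (gauss_kernel bs b kap l (2 * l) ga (2 * 'i%C) sig) z =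
  gauss_kernel bs b (kap * (Num.sqrt pi / (2 * l))) l (pi / (2 * l)) ga
    (pi / (2 * l ^+ 2))%:C sig z.
Proof.
case: z => [[rho x] y] l0; have ln0 := lt0r_neq0 l0.
have l20 : 0 < 2 * l by rewrite mulr_gt0.
pose K := kap * expR (- (l ^+ 2 * (1 + normsq x) + ga ^+ 2 * normsq y)).
pose P := bs * (l^-1)%:C + b ord0 +
  \sum_(j < m) b (lift ord0 j) * ((tnth x j)%:C - sig * (tnth y j)%:C).
pose q (t : measurableTypeR R) : R := 2 * pi * t * rho.
pose W := Num.sqrt pi / (2 * l) * expR (- (pi / (2 * l) * rho) ^+ 2).
have KW : kap * (Num.sqrt pi / (2 * l)) * expR (- (l ^+ 2 * (1 + normsq x) +
    (pi / (2 * l) * rho) ^+ 2 + ga ^+ 2 * normsq y)) = K * W.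
  by rewrite /W /K !opprD !expRD; ring.
have Kt (t : R) : kap * expR (- (l ^+ 2 * (1 + normsq x) + (2 * l * t) ^+ 2 +
    ga ^+ 2 * normsq y)) = K * gaussian (2 * l) t.
  by rewrite /gaussian /K -[RHS]mulrA -expRD; congr (_ * expR _); ring.
have mq : measurable_fun setT q by do 2 apply: measurable_funM => //.
pose e0 (t : measurableTypeR R) := (gaussian (2 * l) t)%:C * expi (- q t).
pose e1 (t : measurableTypeR R) := (t * gaussian (2 * l) t)%:C * expi (- q t).
have E0 : Cintegral mu e0 = W%:C.
  have H th : \int[mu]_t (gaussian (2 * l) t * cos (th + q t)) = W * cos (th + 0).
    by rewrite addr0; exact: fourier_gaussian.
  by rewrite /e0 (Cintegral_phase H) expi0 mulr1.
have I0 : Cintegrable mu e0.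
  exact: (Cintegrable_phase mq (integrable_gaussian l20)).
have E1 : Cintegral mu e1 = (pi * rho / (2 * l) ^+ 2 * W)%:C * - 'i%C.
  have H th : \int[mu]_t (t * gaussian (2 * l) t * cos (th + q t)) =
      pi * rho / (2 * l) ^+ 2 * W * cos (th + pi / 2).
    by rewrite fourier_moment_gaussian// /W !mulrA.
  by rewrite /e1 (Cintegral_phase H) expiN_pihalf.
have I1 : Cintegrable mu e1.
  exact: (Cintegrable_phase mq (integrable_moment_gaussian l20)).
clearbody K W.
have split_kernel t : gauss_kernel bs b kap l (2 * l) ga (2 * 'i%C) sig (t, x, y) *
    expi (- (2 * pi * t * rho)) =
  e0 t * (K%:C * P) + e1 t * (- (K%:C * (2 * 'i%C) * b ord0)).
  rewrite /gauss_kernel /affine /exponent -/(q t).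
  rewrite Kt.
  by rewrite /e0 /e1 /P !rmorphM /=; ring.
rewrite /fourier_t_integral (eq_Cintegral _ split_kernel).
rewrite CintegralD; [|exact: CintegrableZ..].
rewrite !CintegralZ// E0 E1 /gauss_kernel /affine /exponent.
rewrite KW.
rewrite (_ : pi * rho / (2 * l) ^+ 2 * W = (2^-1 * (pi / (2 * l ^+ 2))) * rho * W); last by field.
rewrite /P !(rmorphM (real_complex R))/=.
set p := (pi)%:C; set h := (2^-1)%:C; set ll := ((2 * l ^+ 2)^-1)%:C.
have h2 : 2 * h = 1.
  by rewrite /h -[2](rmorph_nat (real_complex R)) -rmorphM/= mulfV.
transitivity (W%:C * K%:C * (bs * (l^-1)%:C + b ord0 +
  \sum_(j < m) b (lift ord0 j) * ((tnth x j)%:C - sig * (tnth y j)%:C)) +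
  'i%C ^+ 2 * (2 * h) * (p * ll * rho%:C * W%:C * K%:C * b ord0)).
  by ring.
by rewrite sqr_i h2; ring.
Qed.

End kernel_fourier.

(** * Kernels depending on a scale *)

Section family.
Context {R : realType} (m : nat).
Notation mu := (@lebesgue_measure R).
Notation nu := (@lebesgue_measure_tuple R m).
Notation V := (m.-tuple R).
Notation X := (measurableTypeR R * V * V)%type.
Variables (bs : R[i]) (b : 'I_m.+1 -> R[i]).
Variables (kap al ga : R -> R) (tau sig : R -> R[i]).

Definition gauss_family (s : R) (z : X) : R[i] :=
  gauss_kernel bs b (kap s) (s ^+ 2) (al s) (ga s) (tau s) (sig s) z.

Hypotheses (mkap : measurable_fun setT kap) (mal : measurable_fun setT al)
  (mga : measurable_fun setT ga) (mtau : Cmeasurable tau) (msig : Cmeasurable sig).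

Lemma Cmeasurable_gauss_family :
  Cmeasurable (fun p : measurableTypeR R * X => gauss_family p.1 p.2).
Proof.
have mt : measurable_fun setT (fun p : measurableTypeR R * X => p.2.1.1).
  by do 2 apply: (measurableT_comp measurable_fst); exact: measurable_snd.
have mx : measurable_fun setT (fun p : measurableTypeR R * X => p.2.1.2).
  by apply: (measurableT_comp measurable_snd); apply: (measurableT_comp measurable_fst).
have my : measurable_fun setT (fun p : measurableTypeR R * X => p.2.2).
  by apply: (measurableT_comp measurable_snd).
have mfst (f : R -> R) : measurable_fun setT f ->
    measurable_fun setT (fun p : measurableTypeR R * X => f p.1).
  by move=> mf; exact: (measurableT_comp mf).
have Cfst (f : R -> R[i]) : Cmeasurable f ->
    Cmeasurable (fun p : measurableTypeR R * X => f p.1).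
  by move=> mf; exact: (Cmeasurable_comp (h := fst) mf).
have mN (f : measurableTypeR R * X -> R) : measurable_fun setT f ->
    measurable_fun setT (fun p : measurableTypeR R * X => - f p).
  by move=> mf; exact: measurableT_comp.
rewrite (_ : (fun p => _) = (fun p : measurableTypeR R * X =>
  (kap p.1 * expR (- ((p.1 ^+ 2) ^+ 2 * (1 + normsq p.2.1.2) +
     (al p.1 * p.2.1.1) ^+ 2 + (ga p.1) ^+ 2 * normsq p.2.2)))%:C *
  (bs * ((p.1 ^+ 2)^-1)%:C + b ord0 * (1 - tau p.1 * (p.2.1.1)%:C) +
  \sum_(j < m) b (lift ord0 j) *
     ((tnth p.2.1.2 j)%:C - sig p.1 * (tnth p.2.2 j)%:C)))); last first.
  by apply/funext => -[s [[t x] y]].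
apply: CmeasurableM.
  apply: Cmeasurable_real; apply: measurable_funM; first exact: mfst.
  apply: measurableT_comp => //; apply: mN.
  apply: measurable_funD; first apply: measurable_funD.
  - apply: measurable_funM; first by apply: (mfst (fun s => (s ^+ 2) ^+ 2)); exact: measurable_funX.
    by apply: measurable_funD => //; exact: (measurableT_comp (@measurable_normsq R m) mx).
  - by apply: measurable_funX; apply: measurable_funM => //; exact: mfst.
  - apply: measurable_funM; first by apply: measurable_funX; exact: mfst.
    exact: (measurableT_comp (@measurable_normsq R m) my).
apply: CmeasurableD; first apply: CmeasurableD.
- apply: CmeasurableM; first exact: Cmeasurable_cst.
  by apply: Cmeasurable_real; exact: (mfst (fun s => (s ^+ 2)^-1) measurable_sqrV).
- apply: CmeasurableM; first exact: Cmeasurable_cst.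
  apply: CmeasurableB; first exact: Cmeasurable_cst.
  by apply: CmeasurableM; [exact: Cfst|exact: Cmeasurable_real].
- apply: Cmeasurable_sum => j.
  apply: CmeasurableM; first exact: Cmeasurable_cst.
  apply: CmeasurableB.
    by apply: Cmeasurable_real; exact: (measurableT_comp (measurable_tnth j) mx).
  apply: CmeasurableM; first exact: Cfst.
  by apply: Cmeasurable_real; exact: (measurableT_comp (measurable_tnth j) my).
Qed.

Hypotheses (al_gt0 : forall s, 0 < s -> 0 < al s) (ga_gt0 : forall s, 0 < s -> 0 < ga s)
  (tauE : forall s, 0 < s -> sqnorm (tau s) = (al s / s ^+ 2) ^+ 2)
  (sigE : forall s, 0 < s -> sqnorm (sig s) = (ga s / s ^+ 2) ^+ 2).

(** The hypothesis on [kap] says that, up to a constant, [kap ^+ 2] is [l ^+ 2]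
divided by the volume of the Gaussian, where [l = s ^+ 2]; there remains
[e^(- s^4)], at most [e * e^(- 2 s^2)]. *)
Lemma gauss_family_L2_controlled :
  (forall s, 0 < s -> kap s ^+ 2 = 8 * s ^+ 4 * ((s ^+ 2) ^+ m * al s * ga s ^+ m)) ->
  L2_controlled (lebesgue_txy m) (gaussian 1) (\1_`]0, +oo[%classic) gauss_family.
Proof.
move=> kapE.
exists (32 * coef_norm bs b ^+ 2 * Num.sqrt pi ^+ (m + m).+1 * expR 1).
  by rewrite !mulr_ge0 ?ler0n ?exprn_ge0 ?sqrtr_ge0 ?expR_ge0 ?coef_norm_ge0.
move=> s; rewrite indicE; have [|_] := boolP (s \in `]0%R, +oo[%classic); last by rewrite eqxx.
rewrite inE/= in_itv/= andbT => s0 _.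
have s20 : 0 < s ^+ 2 by rewrite exprn_gt0.
have mfam : measurable_fun setT (fun z => sqnorm (gauss_family s z)).
  apply: measurable_sqnorm.
  apply: (Cmeasurable_comp (h := fun z : X => (s, z)) Cmeasurable_gauss_family).
  exact: measurable_fun_pair.
have mexp : measurable_fun setT (fun z : X => expR (- exponent (s ^+ 2) (al s) (ga s) z)).
  rewrite (_ : (fun z => _) = (fun z : X => expR (- (s ^+ 2) ^+ 2) *
     (gaussian (al s) z.1.1 * gaussian_tuple (s ^+ 2) z.1.2 * gaussian_tuple (ga s) z.2))).
    apply: measurable_funM => //; apply: measurable_funM; first apply: measurable_funM.
    - apply: (measurableT_comp (measurable_gaussian _)).
      exact: (measurableT_comp measurable_fst measurable_fst).
    - apply: (measurableT_comp (measurable_gaussian_tuple _)).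
      exact: (measurableT_comp measurable_snd measurable_fst).
    - exact: (measurableT_comp (measurable_gaussian_tuple _)).
  by apply/funext => -[[t x] y]; rewrite expR_exponent.
pose c := (2 * coef_norm bs b * kap s / s ^+ 2) ^+ 2.
apply: (@le_trans _ _ (\int[lebesgue_txy m]_z
   (c%:E * (expR (- exponent (s ^+ 2) (al s) (ga s) z))%:E))%E).
  apply: ge0_le_integral => //.
  - by move=> z _; rewrite lee_fin sqnorm_ge0.
  - exact/measurable_EFinP.
  - by apply: measurable_funeM; exact/measurable_EFinP.
  - move=> z _; rewrite -EFinM lee_fin.
    by apply: sqnorm_gauss_kernel_le => //; [exact: tauE|exact: sigE].
rewrite ge0_integralZl_EFin ?sqr_ge0//; last exact/measurable_EFinP.
rewrite integral_expR_exponent ?al_gt0 ?ga_gt0// -EFinM lee_fin.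
have an0 := lt0r_neq0 (al_gt0 s0); have gn0 := lt0r_neq0 (ga_gt0 s0).
have sn0 := lt0r_neq0 s0.
have -> : c * (expR (- (s ^+ 2) ^+ 2) * (Num.sqrt pi / al s *
     (Num.sqrt pi / s ^+ 2) ^+ m * (Num.sqrt pi / ga s) ^+ m)) =
   32 * coef_norm bs b ^+ 2 * Num.sqrt pi ^+ (m + m).+1 * expR (- (s ^+ 2) ^+ 2).
  rewrite /c (_ : (2 * coef_norm bs b * kap s / s ^+ 2) ^+ 2 =
    (2 * coef_norm bs b / s ^+ 2) ^+ 2 * kap s ^+ 2); last by field.
  have pE : Num.sqrt pi ^+ (m + m).+1 = Num.sqrt pi * Num.sqrt pi ^+ m * Num.sqrt pi ^+ m :> R.
    by rewrite exprS exprD mulrA.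
  rewrite kapE// pE !expr_div_n; field.
  by rewrite an0 sn0/= !expf_neq0.
rewrite -[leRHS]mulrA ler_wpM2l//.
  by rewrite !mulr_ge0 ?ler0n ?exprn_ge0 ?sqrtr_ge0 ?coef_norm_ge0.
rewrite /gaussian [X in _ * X]expr2 -!expRD ler_expR mul1r.
have := sqr_ge0 (s ^+ 2 - 1); lra.
Qed.

(** A majorant of all the kernels whose inverse widths are at least [c].  Its
square, a Gaussian of inverse width [c / sqrt 2], dominates the squared modulus
of the kernels, bounded by a Gaussian of inverse width [c]. *)
Definition gauss_bound (K c : R) (z : X) : R := K *
  (gaussian (c / 2) z.1.1 * gaussian_tuple (c / 2) z.1.2 * gaussian_tuple (c / 2) z.2).

Lemma gauss_bound_ge0 K c z : 0 <= K -> 0 <= gauss_bound K c z.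
Proof.
by move=> K0; rewrite !mulr_ge0 ?gaussian_ge0 ?gaussian_tuple_ge0.
Qed.

Lemma gauss_family_dominated K c s z : 0 < s -> 0 < c -> c <= s ^+ 2 ->
  c <= al s -> c <= ga s -> `|kap s| / s ^+ 2 <= K ->
  sqnorm (gauss_family s z) <= gauss_bound (2 * coef_norm bs b * K) c z ^+ 2.
Proof.
move=> s0 c0 cs ca cg kK.
have s20 : 0 < s ^+ 2 by rewrite exprn_gt0.
have B0 := coef_norm_ge0 bs b.
apply: (le_trans (sqnorm_gauss_kernel_le bs b (kap s) z s20 (tauE s0) (sigE s0))).
rewrite /gauss_bound [leRHS]exprMn; apply: ler_pM; rewrite ?sqr_ge0 ?expR_ge0//.
  rewrite -real_normK ?num_real// ler_sqr ?nnegrE ?mulr_ge0//; last first.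
    by apply: le_trans kK; rewrite divr_ge0// ltW.
  rewrite -mulrA normrM (ger0_norm (_ : 0 <= 2 * _)) ?mulr_ge0//.
  by rewrite ler_wpM2l ?mulr_ge0// normrM normfV (gtr0_norm s20).
case: z => [[t x] y] /=; rewrite !gaussian_tupleE /gaussian -!expRD [leRHS]expr2 -expRD ler_expR.
have sq (u v : R) : 0 < u -> u <= v -> u ^+ 2 <= v ^+ 2.
  by move=> u0 uv; rewrite ler_sqr ?nnegrE ?(ltW u0)// (le_trans (ltW u0)).
have q1 := sq _ _ c0 cs; have q2 := sq _ _ c0 ca; have q3 := sq _ _ c0 cg.
have h1 := ler_wpM2r (normsq_ge0 x) q1.
have h2 := ler_wpM2r (sqr_ge0 t) q2.
have h3 := ler_wpM2r (normsq_ge0 y) q3.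
have p1 := sqr_ge0 (s ^+ 2).
have p2 := mulr_ge0 (sqr_ge0 c) (normsq_ge0 x).
have p3 := mulr_ge0 (sqr_ge0 c) (sqr_ge0 t).
have p4 := mulr_ge0 (sqr_ge0 c) (normsq_ge0 y).
rewrite /exponent !exprMn !exprVn.
move: h1 h2 h3 p1 p2 p3 p4.
by rewrite !expr2; lra.
Qed.

Lemma integrable_gauss_bound K c : 0 < c ->
  (lebesgue_txy m).-integrable setT (EFin \o gauss_bound K c).
Proof.
move=> c0; have c20 : 0 < c / 2 by rewrite divr_gt0.
rewrite (_ : _ \o _ = (fun z : X => K%:E * (gaussian (c / 2) z.1.1 *
  gaussian_tuple (c / 2) z.1.2 * gaussian_tuple (c / 2) z.2)%:E)%E)//.
apply: integrableZl => //.
have H1 : (lebesgue_tx m).-integrable setT (EFin \o (fun p : measurableTypeR R * V =>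
    gaussian (c / 2) p.1 * gaussian_tuple (c / 2) p.2)).
  exact: (integrable_tensor (integrable_gaussian c20) (integrable_gaussian_tuple m c20)).
exact: (integrable_tensor H1 (integrable_gaussian_tuple m c20)).
Qed.

Lemma integrable_gauss_bound_xi K c t x : 0 < c ->
  nu.-integrable setT (EFin \o (fun y => gauss_bound K c (t, x, y))).
Proof.
move=> c0; have c20 : 0 < c / 2 by rewrite divr_gt0.
rewrite (_ : _ \o _ = (fun y => (K * (gaussian (c / 2) t * gaussian_tuple (c / 2) x))%:E *
   (gaussian_tuple (c / 2) y)%:E)%E).
  by apply: integrableZl => //; exact: integrable_gaussian_tuple.
by apply/funext => y; rewrite /gauss_bound/= -EFinM; congr EFin; ring.
Qed.

Lemma integrable_gauss_bound_t K c x y : 0 < c ->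
  mu.-integrable setT (EFin \o (fun t => gauss_bound K c (t, x, y))).
Proof.
move=> c0; have c20 : 0 < c / 2 by rewrite divr_gt0.
rewrite (_ : _ \o _ = (fun t => (K * (gaussian_tuple (c / 2) x * gaussian_tuple (c / 2) y))%:E *
   (gaussian (c / 2) t)%:E)%E).
  by apply: integrableZl => //; exact: integrable_gaussian.
by apply/funext => t; rewrite /gauss_bound/= -EFinM; congr EFin; ring.
Qed.

End family.

(** * Cutting off the scale *)

Section cutoff.
Context {R : realType}.
Notation mu := (@lebesgue_measure R).

Definition half_line : R -> R := \1_`]0, +oo[%classic.
Definition window (n : nat) : R -> R := \1_`[n.+1%:R^-1, n.+1%:R]%classic.

Lemma half_lineE s : half_line s = (0 < s)%R%:R.
Proof.
rewrite /half_line indicE; congr (nat_of_bool _)%:R.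
by apply/idP/idP; rewrite inE/= in_itv/= andbT.
Qed.

Lemma windowE n s : window n s = (n.+1%:R^-1 <= s <= n.+1%:R)%R%:R.
Proof.
rewrite /window indicE; congr (nat_of_bool _)%:R.
by apply/idP/idP; rewrite inE/= in_itv.
Qed.

Lemma measurable_half_line : measurable_fun setT half_line.
Proof. exact: measurable_indic. Qed.

Lemma measurable_window n : measurable_fun setT (window n).
Proof. exact: measurable_indic. Qed.

Lemma window_gt0 n s : window n s != 0 -> n.+1%:R^-1 <= s <= n.+1%:R.
Proof. by rewrite windowE; case: (_ <= s <= _) => //; rewrite eqxx. Qed.

Lemma window_le n s : 0 <= window n s <= half_line s.
Proof.
rewrite windowE half_lineE; case: (boolP (_ <= s <= _)) => [/andP[s0 _]|_].
  by rewrite (lt_le_trans _ s0) ?invr_gt0// lexx ler01.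
by rewrite lexx ler0n.
Qed.

Lemma integrable_window n : mu.-integrable setT (EFin \o window n).
Proof. by have := integrable_indic_itv n.+1%:R^-1 n.+1%:R true false. Qed.

Let w : R -> R := gaussian 1.

Let weight n s := (half_line s - window n s) * w s.

Let weight_ge0 n s : 0 <= weight n s.
Proof.
by rewrite mulr_ge0 ?gaussian_ge0// subr_ge0; case/andP: (window_le n s).
Qed.

Let weight_le n s : weight n s <= w s.
Proof.
rewrite ler_piMl ?gaussian_ge0//; case/andP: (window_le n s) => h _.
by rewrite half_lineE lerBlDr ler_wpDr//; case: (0 < s); rewrite ?ler01.
Qed.

Let mweight n : measurable_fun setT (weight n).
Proof.
apply: measurable_funM; last exact: measurable_gaussian.
by apply: measurable_funB; [exact: measurable_half_line|exact: measurable_window].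
Qed.

Let iw : mu.-integrable setT (EFin \o w).
Proof. by apply: integrable_gaussian. Qed.

Definition tail_weight n := (\int[mu]_s (weight n s)%:E)%E.

Lemma half_line_weight_fin : (\int[mu]_s (half_line s * w s)%:E < +oo)%E.
Proof.
apply: (@le_lt_trans _ _ (\int[mu]_s (w s)%:E)%E); last first.
  by rewrite integral_gaussian// ltry.
apply: ge0_le_integral => //.
- by move=> s _; rewrite lee_fin mulr_ge0 ?gaussian_ge0// half_lineE ler0n.
- apply/measurable_EFinP; apply: measurable_funM; last exact: measurable_gaussian.
  exact: measurable_half_line.
- by apply/measurable_EFinP; exact: measurable_gaussian.
- move=> s _; rewrite lee_fin ler_piMl ?gaussian_ge0// half_lineE.
  by case: (0 < s); rewrite ?ler01.
Qed.

Lemma tail_weight_cvg : tail_weight n @[n --> \oo] --> 0%E.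
Proof.
have m1 n : measurable_fun setT (EFin \o weight n) by exact/measurable_EFinP.
have m2 : measurable_fun setT (cst 0 : R -> \bar R) by exact: measurable_cst.
have m3 : {ae mu, forall s, setT s ->
    (EFin \o weight n) s @[n --> \oo] --> (cst 0 : R -> \bar R) s}.
  apply: aeW => s _; apply: cvg_near_cst.
  have [s0|s0] := ltP 0 s; last first.
    apply: nearW => n; rewrite /= /weight half_lineE windowE ltNge s0/=.
    by rewrite leNgt (le_lt_trans s0) ?invr_gt0//= subrr mul0r.
  exists (Num.truncn (s + s^-1)) => // n /= Hn.
  have ss : s + s^-1 <= n.+1%:R.
    by rewrite (le_trans (ltW (truncnS_gt _)))// ler_nat ltnS.
  have sV : 0 < s^-1 by rewrite invr_gt0.
  rewrite /weight half_lineE windowE s0 (_ : _ <= s <= _) ?subrr ?mul0r//.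
  apply/andP; split; last by apply: le_trans ss; rewrite lerDl ltW.
  rewrite -[leRHS]invrK lef_pV2 ?posrE//.
  by apply: le_trans ss; rewrite lerDr ltW.
have m5 : {ae mu, forall s n, setT s ->
    (`|(EFin \o weight n) s| <= (EFin \o w) s)%E}.
  by apply: aeW => s n _; rewrite /= lee_fin ger0_norm.
have [_ _] := @dominated_convergence _ (measurableTypeR R) R mu setT measurableT
  _ _ _ m1 m2 m3 iw m5.
by rewrite integral0.
Qed.

(** The added [n.+1%:R^-1] makes the rate positive. *)
Definition tail_bound n : R := fine (tail_weight n) + n.+1%:R^-1.

Let tail_weight_ge0 n : (0 <= tail_weight n)%E.
Proof. by apply: integral_ge0 => s _; rewrite lee_fin. Qed.

Lemma tail_bound_gt0 n : 0 < tail_bound n.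
Proof. by rewrite ltr_wpDl ?fine_ge0// invr_gt0. Qed.

Lemma tail_weight_le n : (tail_weight n <= (tail_bound n)%:E)%E.
Proof.
rewrite /tail_bound EFinD fineK; first by rewrite leeDl// lee_fin invr_ge0.
rewrite ge0_fin_numE//; apply: (@le_lt_trans _ _ (\int[mu]_s (w s)%:E)%E).
  apply: ge0_le_integral => //.
  - by move=> s _; rewrite lee_fin.
  - by apply/measurable_EFinP; exact: mweight.
  - by apply/measurable_EFinP; exact: measurable_gaussian.
  - by move=> s _; rewrite lee_fin.
by rewrite integral_gaussian// ltry.
Qed.

Lemma tail_bound_cvg : tail_bound n @[n --> \oo] --> (0 : R).
Proof.
rewrite -[X in _ --> X]addr0; apply: cvgD; last exact: cvg_harmonic.
by apply: fine_cvg; exact: tail_weight_cvg.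
Qed.

End cutoff.

(** * Fourier transforms of the superpositions *)

Section transforms.
Context {R : realType} (m : nat).
Notation mu := (@lebesgue_measure R).
Notation nu := (@lebesgue_measure_tuple R m).
Notation V := (m.-tuple R).
Notation X := (measurableTypeR R * V * V)%type.
Variables (bs : R[i]) (b : 'I_m.+1 -> R[i]).

(** Up to the weight [4 s^3 ds = dlambda], these are the normalisations of the
kernels in [(t, x, xi)], in [(t, x, eta)] and in [(rho, x, eta)], starting from
[lambda^(m/2)]. *)
Definition kap0 (s : R) : R := 4 * s ^+ 3 * (s ^+ 2) ^+ m.
Definition kap1 (s : R) : R := kap0 s * (Num.sqrt pi / s ^+ 2) ^+ m.
Definition kap2 (s : R) : R := kap1 s * (Num.sqrt pi / (2 * s ^+ 2)).

Definition family0 : R -> X -> R[i] := gauss_family bs b kap0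
  (fun s => 2 * s ^+ 2) (fun s => s ^+ 2) (fun=> 2 * 'i%C) (fun=> 'i%C).
Definition family1 : R -> X -> R[i] := gauss_family bs b kap1
  (fun s => 2 * s ^+ 2) (fun s => pi / s ^+ 2) (fun=> 2 * 'i%C)
  (fun s => (pi / (s ^+ 2) ^+ 2)%:C).
Definition family2 : R -> X -> R[i] := gauss_family bs b kap2
  (fun s => pi / (2 * s ^+ 2)) (fun s => pi / s ^+ 2)
  (fun s => (pi / (2 * (s ^+ 2) ^+ 2))%:C) (fun s => (pi / (s ^+ 2) ^+ 2)%:C).

Let msqr : measurable_fun setT (fun s : R => s ^+ 2).
Proof. exact: measurable_funX. Qed.

Let msqrV : measurable_fun setT (fun s : R => (s ^+ 2)^-1).
Proof. exact: measurable_sqrV. Qed.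

Let mkap0 : measurable_fun setT kap0.
Proof.
by apply: measurable_funM; [apply: measurable_funM => //|]; exact: measurable_funX.
Qed.

Let mkap1 : measurable_fun setT kap1.
Proof.
by apply: measurable_funM => //; apply: measurable_funX; exact: measurable_funM.
Qed.

Let m2V : measurable_fun setT (fun s : R => (2 * s ^+ 2)^-1).
Proof. by under eq_fun do rewrite invfM; exact: measurable_funM. Qed.

Let mkap2 : measurable_fun setT kap2.
Proof. by apply: measurable_funM => //; exact: measurable_funM. Qed.

Let msig1 : Cmeasurable (fun s : R => (pi / (s ^+ 2) ^+ 2)%:C).
Proof.
apply: Cmeasurable_real; apply: measurable_funM => //.
by under eq_fun do rewrite -exprVn; exact: measurable_funX.
Qed.

Let mtau2 : Cmeasurable (fun s : R => (pi / (2 * (s ^+ 2) ^+ 2))%:C).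
Proof.
apply: Cmeasurable_real; apply: measurable_funM => //.
under eq_fun do rewrite invfM -exprVn; apply: measurable_funM => //.
exact: measurable_funX.
Qed.

Let sqrt_pi2 : Num.sqrt pi * Num.sqrt pi = pi :> R.
Proof. by rewrite -expr2 sqr_sqrtr// pi_ge0. Qed.

Let sqnorm_i : sqnorm 'i%C = 1 :> R.
Proof. by rewrite /sqnorm/= expr0n expr1n add0r. Qed.

Let sqnorm_2i : sqnorm (2 * 'i%C) = 4 :> R.
Proof.
rewrite sqnormM sqnorm_i mulr1 (_ : 2 = 2%:C) ?sqnorm_real; first by ring.
by rewrite rmorph_nat.
Qed.

Let pi0 : 0 < pi :> R. Proof. exact: pi_gt0. Qed.

Let tauE s : 0 < s -> sqnorm (2 * 'i%C) = (2 * s ^+ 2 / s ^+ 2) ^+ 2 :> R.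
Proof. by move=> s0; rewrite sqnorm_2i; field; exact: lt0r_neq0. Qed.

Let sigE0 s : 0 < s -> sqnorm 'i%C = (s ^+ 2 / s ^+ 2) ^+ 2 :> R.
Proof. by move=> s0; rewrite sqnorm_i; field; exact: lt0r_neq0. Qed.

Let sigE1 s : 0 < s ->
  sqnorm (pi / (s ^+ 2) ^+ 2)%:C = (pi / s ^+ 2 / s ^+ 2) ^+ 2 :> R.
Proof. by move=> s0; rewrite sqnorm_real; field; exact: lt0r_neq0. Qed.

Lemma controlled0 : L2_controlled (lebesgue_txy m) (gaussian 1) half_line family0.
Proof.
apply: gauss_family_L2_controlled => //.
- exact: measurable_funM.
- by move=> s s0; rewrite mulr_gt0// exprn_gt0.
- by move=> s s0; rewrite exprn_gt0.
- by move=> s s0; rewrite /kap0; ring.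
Qed.

Lemma controlled1 : L2_controlled (lebesgue_txy m) (gaussian 1) half_line family1.
Proof.
apply: gauss_family_L2_controlled => //.
- exact: measurable_funM.
- exact: measurable_funM.
- by move=> s s0; rewrite mulr_gt0// exprn_gt0.
- by move=> s s0; rewrite divr_gt0// exprn_gt0.
- move=> s s0; rewrite /kap1 /kap0; move: sqrt_pi2.
  set p := Num.sqrt pi; clearbody p => <-; rewrite !expr_div_n !exprMn; field.
  by rewrite expf_neq0// lt0r_neq0.
Qed.

Lemma controlled2 : L2_controlled (lebesgue_txy m) (gaussian 1) half_line family2.
Proof.
apply: gauss_family_L2_controlled => //.
- exact: measurable_funM.
- exact: measurable_funM.
- by move=> s s0; rewrite divr_gt0// mulr_gt0// exprn_gt0.
- by move=> s s0; rewrite divr_gt0// exprn_gt0.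
- move=> s s0; rewrite sqnorm_real; field; exact: lt0r_neq0.
- move=> s s0; rewrite /kap2 /kap1 /kap0; move: sqrt_pi2.
  set p := Num.sqrt pi; clearbody p => <-; rewrite !expr_div_n !exprMn; field.
  by rewrite expf_neq0//= ?expf_neq0// lt0r_neq0.
Qed.

Let cut (n : nat) : R := (n.+1%:R ^+ 2)^-1.

Let cut_gt0 n : 0 < cut n.
Proof. by rewrite invr_gt0 exprn_gt0. Qed.

Let cut_le n s : window n s != 0 ->
  [/\ 0 < s <= n.+1%:R, cut n <= s ^+ 2, cut n <= 2 * s ^+ 2 &
     cut n <= pi / s ^+ 2].
Proof.
move=> /window_gt0/andP[s1 s2].
have s0 : 0 < s by apply: lt_le_trans s1; rewrite invr_gt0.
have c1 : cut n <= s ^+ 2.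
  by rewrite /cut -exprVn lerXn2r ?nnegrE ?invr_ge0// ltW.
have c2 : s ^+ 2 <= n.+1%:R ^+ 2 by rewrite lerXn2r ?nnegrE// ltW.
split=> //; first by rewrite s0.
- by apply: (le_trans c1); rewrite ler_peMl ?sqr_ge0// ler1n.
- apply: (@le_trans _ _ (s ^+ 2)^-1).
    by rewrite lef_pV2 ?posrE ?exprn_gt0.
  by rewrite ler_peMl ?invr_ge0 ?sqr_ge0// (le_trans _ (pi_ge2 _))// ler1n.
Qed.

Let bnd0 n : R := 4 * n.+1%:R * (n.+1%:R ^+ 2) ^+ m.
Let bnd1 n : R := 4 * n.+1%:R * Num.sqrt pi ^+ m.

Let dominated0 n s z : window n s != 0 ->
  sqnorm (family0 s z) <= gauss_bound (2 * coef_norm bs b * bnd0 n) (cut n) z ^+ 2.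
Proof.
move=> /cut_le[/andP[s0 sn] c1 c2 c3].
apply: gauss_family_dominated => //.
have -> : `|kap0 s| / s ^+ 2 = 4 * s * (s ^+ 2) ^+ m.
  rewrite ger0_norm /kap0 ?mulr_ge0 ?exprn_ge0 ?sqr_ge0 ?ltW//.
  by field; rewrite lt0r_neq0.
have s1 := ltW s0.
rewrite /bnd0; apply: ler_pM; rewrite ?mulr_ge0 ?exprn_ge0//.
  by rewrite ler_pM2l.
by rewrite !lerXn2r ?nnegrE ?sqr_ge0.
Qed.

Let dominated1 n s z : window n s != 0 ->
  sqnorm (family1 s z) <= gauss_bound (2 * coef_norm bs b * bnd1 n) (cut n) z ^+ 2.
Proof.
move=> /cut_le[/andP[s0 sn] c1 c2 c3].
apply: gauss_family_dominated => //.
have -> : `|kap1 s| / s ^+ 2 = 4 * s * Num.sqrt pi ^+ m.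
  have q0 := sqrtr_ge0 (pi : R).
  rewrite ger0_norm /kap1 /kap0; last first.
    have s1 := ltW s0.
    apply: mulr_ge0; last by rewrite exprn_ge0// divr_ge0// sqr_ge0.
    by apply: mulr_ge0; [apply: mulr_ge0|]; rewrite ?exprn_ge0.
  by rewrite expr_div_n; field; rewrite ?expf_neq0 ?lt0r_neq0.
by rewrite /bnd1 ler_pM2r ?exprn_gt0 ?sqrtr_gt0// ler_pM2l.
Qed.

Lemma Cmeasurable_family0 :
  Cmeasurable (fun p : measurableTypeR R * X => family0 p.1 p.2).
Proof. by apply: Cmeasurable_gauss_family => //; exact: measurable_funM. Qed.

Lemma Cmeasurable_family1 :
  Cmeasurable (fun p : measurableTypeR R * X => family1 p.1 p.2).
Proof. by apply: Cmeasurable_gauss_family => //; exact: measurable_funM. Qed.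

Lemma Cmeasurable_family2 :
  Cmeasurable (fun p : measurableTypeR R * X => family2 p.1 p.2).
Proof. by apply: Cmeasurable_gauss_family => //; exact: measurable_funM. Qed.

Let window_ge0 n s : 0 <= window n s :> R.
Proof. by case/andP: (window_le n s). Qed.

Let bnd_ge0 (K : R) : 0 <= K -> 0 <= 2 * coef_norm bs b * K.
Proof. by move=> K0; rewrite mulr_ge0// mulr_ge0// coef_norm_ge0. Qed.

Let bnd0_ge0 n : 0 <= bnd0 n.
Proof. by rewrite !mulr_ge0 ?exprn_ge0. Qed.

Let bnd1_ge0 n : 0 <= bnd1 n.
Proof. by rewrite !mulr_ge0 ?exprn_ge0// sqrtr_ge0. Qed.

Let CLfun1_0 n : CLfun (lebesgue_txy m) 1 (superpose mu (window n) family0).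
Proof.
apply: (superpose_CLfun1
  (D := gauss_bound (2 * coef_norm bs b * bnd0 n) (cut n)) Cmeasurable_family0).
- exact: integrable_window.
- exact: window_ge0.
- exact: integrable_gauss_bound.
- by move=> z; apply/gauss_bound_ge0/bnd_ge0.
- by move=> s z; exact: dominated0.
Qed.

Let CLfun1_1 n : CLfun (lebesgue_txy m) 1 (superpose mu (window n) family1).
Proof.
apply: (superpose_CLfun1
  (D := gauss_bound (2 * coef_norm bs b * bnd1 n) (cut n)) Cmeasurable_family1).
- exact: integrable_window.
- exact: window_ge0.
- exact: integrable_gauss_bound.
- by move=> z; apply/gauss_bound_ge0/bnd_ge0.
- by move=> s z; exact: dominated1.
Qed.

Let Cmeasurable_slice d (Y : measurableType d) (f : R -> X -> R[i]) (h : Y -> X) :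
  Cmeasurable (fun p : measurableTypeR R * X => f p.1 p.2) ->
  measurable_fun setT h ->
  Cmeasurable (fun p : measurableTypeR R * Y => f p.1 (h p.2)).
Proof.
move=> mf mh; apply: (Cmeasurable_comp (h := fun p => (p.1, h p.2)) mf).
by apply: measurable_fun_pair => //; exact: measurableT_comp.
Qed.

Lemma fourier_xi_superpose n :
  fourier_xi_integral (superpose mu (window n) family0) =
  superpose mu (window n) family1.
Proof.
apply/funext => -[[t x] eta]; rewrite /fourier_xi_integral.
have mh : measurable_fun setT (fun y : V => (t, x, y) : X).
  by apply: measurable_fun_pair.
have me : Cmeasurable (fun y : V => expi (- (2 * pi * dot y eta))).
  apply: Cmeasurable_expi; apply: measurable_funM => //.
  exact: measurable_dot.
rewrite (Cintegral_superpose (tau := mu) (phi := window n)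
  (D := fun y => gauss_bound (2 * coef_norm bs b * bnd0 n) (cut n) (t, x, y))
  (g := fun s y => family0 s (t, x, y))
  (Cmeasurable_slice Cmeasurable_family0 mh) me (integrable_window n)).
- apply: eq_Cintegral => s; have [->|ws] := eqVneq (window n s) 0.
    by rewrite !mul0r.
  have [/andP[s0 _] _ _ _] := cut_le ws.
  congr (_ * _); have l0 : 0 < s ^+ 2 by rewrite exprn_gt0.
  by rewrite /family1 /gauss_family /kap1
    -(fourier_xi_kernel bs b (kap0 s) (2 * s ^+ 2) (2 * 'i%C) (t, x, eta) l0).
- exact: integrable_gauss_bound_xi.
- exact: window_ge0.
- by move=> y; apply/gauss_bound_ge0/bnd_ge0.
- by move=> s y; exact: dominated0.
- by move=> y; exact: sqnorm_expi.
Qed.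

Lemma fourier_t_superpose n :
  fourier_t_integral (superpose mu (window n) family1) =
  superpose mu (window n) family2.
Proof.
apply/funext => -[[rho x] eta]; rewrite /fourier_t_integral.
have mh : measurable_fun setT (fun t : R => (t, x, eta) : X).
  by apply: measurable_fun_pair => //; exact: measurable_fun_pair.
have me : Cmeasurable (fun t : R => expi (- (2 * pi * t * rho))).
  by apply: Cmeasurable_expi; apply: measurable_funM => //; exact: measurable_funM.
rewrite (Cintegral_superpose (tau := mu) (phi := window n)
  (D := fun t => gauss_bound (2 * coef_norm bs b * bnd1 n) (cut n) (t, x, eta))
  (g := fun s t => family1 s (t, x, eta))
  (Cmeasurable_slice Cmeasurable_family1 mh) me (integrable_window n)).
- apply: eq_Cintegral => s; have [->|ws] := eqVneq (window n s) 0.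
    by rewrite !mul0r.
  have [/andP[s0 _] _ _ _] := cut_le ws.
  congr (_ * _); have l0 : 0 < s ^+ 2 by rewrite exprn_gt0.
  by rewrite /family2 /gauss_family /kap2
    -(fourier_t_kernel bs b (kap1 s) (pi / s ^+ 2)
        (pi / (s ^+ 2) ^+ 2)%:C (rho, x, eta) l0).
- exact: integrable_gauss_bound_t.
- exact: window_ge0.
- by move=> y; apply/gauss_bound_ge0/bnd_ge0.
- by move=> s y; exact: dominated1.
- by move=> y; exact: sqnorm_expi.
Qed.

(** Only the two ends of the chain of transforms have to be computed; the
superposition in between is left as it is. *)
Lemma fourier_t_xi_superpose (F G : X -> R[i]) :
  Cmeasurable F ->
  {ae lebesgueX m, forall z, F z = superpose mu half_line family0 z} ->
  Cmeasurable G ->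
  {ae lebesgueX m, forall z, G z = superpose mu half_line family2 z} ->
  fourier_t_xi F G.
Proof.
rewrite lebesgue_txyE => mF FE mG GE.
have wP : forall s : R, 0 < gaussian 1 s by move=> s; exact: expR_gt0.
have hP : forall s : R, 0 <= half_line s by move=> s; rewrite half_lineE ler0n.
have step := superpose_L2_extension (tau := mu) (mu := lebesgue_txy m) (measurable_gaussian 1)
  wP measurable_half_line hP half_line_weight_fin measurable_window window_le
  tail_bound_gt0 tail_bound_cvg tail_weight_le.
have mH : Cmeasurable (superpose mu half_line family1).
  exact: (Cmeasurable_superpose mu Cmeasurable_family1 measurable_half_line).
exists (superpose mu half_line family1); rewrite /fourier_xi /fourier_t lebesgue_txyE.
- apply: (step _ _ _ _ _ Cmeasurable_family0 Cmeasurable_family1 controlled0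
    controlled1 CLfun1_0 fourier_xi_superpose mF FE mH).
  exact: aeW.
- apply: (step _ _ _ _ _ Cmeasurable_family1 Cmeasurable_family2 controlled1
    controlled2 CLfun1_1 fourier_t_superpose mH _ mG GE).
  exact: aeW.
Qed.

End transforms.

(** * Gamma integrals *)

Section gamma.
Context {R : realType}.
Notation mu := (@lebesgue_measure R).

Lemma Rintegral_half_line (f : R -> R) :
  \int[mu]_s (half_line s * f s) = \int[mu]_(s in `]0, +oo[) f s.
Proof.
rewrite [RHS]Rintegral_mkcond; apply: eq_Rintegral => s _.
by rewrite patchE /half_line indicE; case: ifP; rewrite ?mul1r ?mul0r.
Qed.

Let power_exhausts (q : R) (k : nat) : 0 < q ->
  `]0, +oo[%classic = \bigcup_n `[q * n.+1%:R^-1 ^+ k.+1, q * n.+1%:R ^+ k.+1]%classic.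
Proof.
move=> q0; apply/seteqP; split => [y|y [n _]]/=; rewrite in_itv/= ?andbT.
- move=> y0; have [yq qy] : 0 < y / q /\ 0 < q / y by rewrite !divr_gt0.
  pose N := Num.truncn (y / q + q / y); exists N => //=; rewrite in_itv/=.
  have NE : y / q + q / y <= N.+1%:R by exact/ltW/truncnS_gt.
  have N1 : 1 <= N.+1%:R :> R by rewrite ler1n.
  have pw : N.+1%:R <= N.+1%:R ^+ k.+1 :> R by rewrite ler_eXnr.
  apply/andP; split.
  + rewrite mulrC -ler_pdivlMr// exprVn -[leRHS]invrK lef_pV2 ?posrE ?invr_gt0 ?divr_gt0 ?exprn_gt0//.
    by rewrite invf_div (le_trans _ pw)// (le_trans _ NE)// lerDr ltW.
  + rewrite mulrC -ler_pdivrMr//.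
    by rewrite (le_trans _ pw)// (le_trans _ NE)// lerDl ltW.
- rewrite in_itv/= andbT => /andP[+ _]; apply: lt_le_trans; rewrite mulr_gt0// exprn_gt0// invr_gt0.
Qed.

(** The integrand of Euler's integral in the variable [s], for
[Gamma (j.+1%:R / 2)] and with the factor [q ^ (j.+1%:R / 2)] left out. *)
Definition quartic_moment (j : nat) (q s : R) : R :=
  4 * s * (s ^+ 2) ^+ j * expR (- (q * s ^+ 4)).

Lemma measurable_quartic_moment j q : measurable_fun setT (quartic_moment j q).
Proof.
apply: measurable_funM.
  apply: measurable_funM; first exact: measurable_funM.
  by apply: measurable_funX; exact: measurable_funX.
apply: measurableT_comp => //; apply: measurableT_comp => //.
by apply: measurable_funM => //; exact: measurable_funX.
Qed.

Lemma quartic_moment_ge0 j q s : 0 < s -> 0 <= quartic_moment j q s.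
Proof.
by move=> s0; rewrite !mulr_ge0 ?expR_ge0 ?exprn_ge0 ?sqr_ge0 ?ltW.
Qed.

Lemma integral_quartic_moment (j : nat) (q : R) : 0 < q ->
  (\int[mu]_(u in `]0%R, +oo[) (u `^ (j.+1%:R / 2 - 1) * expR (- u))%:E =
   (q `^ (j.+1%:R / 2))%:E *
   \int[mu]_(s in `]0%R, +oo[) (quartic_moment j q s)%:E)%E.
Proof.
move=> q0; pose r : R := j.+1%:R / 2.
transitivity (\int[mu]_(s in `]0%R, +oo[)
    ((q * s ^+ 4) `^ (r - 1) * expR (- (q * s ^+ 4)) * (4 * q * s ^+ 3))%:E)%E.
apply: (@ge0_substitution_exhaustion R (fun s => q * s ^+ 4)
  (fun s => 4 * q * s ^+ 3) (fun u => u `^ (r - 1) * expR (- u)) `]0, +oo[%classic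
  `]0, +oo[%classic (fun n => n.+1%:R^-1) (fun n => n.+1%:R)).
- exact: interval_open.
- by move=> n; rewrite (@le_trans _ _ 1)// ?invf_le1 ?ler1n.
- by move=> n k nk; rewrite lef_pV2 ?posrE// ler_nat.
- by move=> n k nk; rewrite ler_nat.
- rewrite (power_exhausts 0 ltr01); apply: eq_bigcupr => n _.
  by rewrite !expr1 !mul1r.
- exact: power_exhausts.
- move=> x y; rewrite !inE/= !in_itv/= !andbT => x0 y0 xy.
  by rewrite ltr_pM2l// ltrXn2r ?nnegrE ?ltW.
- by move=> x _; apply: is_derive_eq; rewrite /GRing.scale/=; ring.
- move=> x _; apply/differentiable_continuous/derivable1_diffP; exact: ex_derive.
- move=> y; rewrite /= in_itv/= andbT => y0.
  have dy := is_derive1_powR (r - 1) y0.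
  apply/differentiable_continuous/derivable1_diffP; exact: ex_derive.
- by move=> y _; rewrite mulr_ge0 ?powR_ge0 ?expR_ge0.
rewrite -ge0_integralZl_EFin ?powR_ge0//; last first.
  by apply/measurable_EFinP/measurable_funTS; exact: measurable_quartic_moment.
- by move=> s; rewrite /= in_itv/= andbT => s0; rewrite lee_fin quartic_moment_ge0.
apply: eq_integral => s; rewrite inE/= in_itv/= andbT => s0.
rewrite -EFinM /quartic_moment; congr EFin.
have -> : (q * s ^+ 4) `^ (r - 1) = q `^ r * (s ^+ 2) ^+ j / (q * s ^+ 2).
  rewrite powRB; last by apply/implyP => _; rewrite mulf_neq0 ?expf_neq0 ?lt0r_neq0.
  rewrite powRr1 ?mulr_ge0 ?exprn_ge0 ?ltW// powRM ?exprn_ge0 ?ltW//.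
  have -> : (s ^+ 4) `^ r = (s ^+ 2) ^+ j.+1.
    rewrite -[4%N]/(2 * 2)%N exprM -powR_mulrn ?sqr_ge0// -powRrM.
    by rewrite /r mulrCA divff// mulr1 powR_mulrn// sqr_ge0.
  by rewrite exprS; field; rewrite !lt0r_neq0.
by field; rewrite !lt0r_neq0.
Qed.

(* s^(2j+1) is O(e^(s^2)) by the power series, and e^(- s^4) <= e * e^(- 2 s^2). *)
Let quartic_moment_le j s : 0 < s ->
  quartic_moment j 1 s <= 4 * (j`!%:R + j.+1`!%:R) * expR 1 * gaussian 1 s.
Proof.
move=> s0; have fact_le n : (s ^+ 2) ^+ n <= n`!%:R * expR (s ^+ 2).
  case: n => [|n]; first by rewrite expr0 mul1r -expR0 ler_expR sqr_ge0.
  have h := expR_ge1Dxn n (sqr_ge0 s).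
  by rewrite mulrC -ler_pdivrMr ?ltr0n ?fact_gt0// (le_trans _ h)// lerDr.
rewrite /quartic_moment mul1r -!mulrA ler_pM2l// mulrA.
have h1 : s * (s ^+ 2) ^+ j <= (j`!%:R + j.+1`!%:R) * expR (s ^+ 2).
  apply: (@le_trans _ _ ((1 + s ^+ 2) * (s ^+ 2) ^+ j)).
    by rewrite ler_wpM2r ?exprn_ge0 ?sqr_ge0//; nra.
  by rewrite mulrDl mul1r -exprS mulrDl; apply: lerD; exact: fact_le.
have h2 : expR (- s ^+ 4) <= expR 1 * (gaussian 1 s * expR (- s ^+ 2)).
  by rewrite /gaussian mul1r -!expRD ler_expR; have := sqr_ge0 (s ^+ 2 - 1); nra.
apply: (le_trans (ler_pM _ (expR_ge0 _) h1 h2)).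
  by rewrite mulr_ge0 ?exprn_ge0 ?sqr_ge0// ltW.
rewrite le_eqVlt; apply/orP; left; apply/eqP.
have e : expR (s ^+ 2) * expR (- s ^+ 2) = 1 by rewrite expRxMexpNx_1.
by rewrite -[RHS]mulr1 -e; ring.
Qed.

(** A divergent integral counts as 0, so that positivity includes the convergence
of Euler's integral. *)
Lemma Gamma_half_gt0 (j : nat) : 0 < Gamma (j.+1%:R / 2 : R).
Proof.
rewrite /Gamma /Rintegral (integral_quartic_moment j ltr01) powR1 mul1e.
have mf (D : set R) : measurable_fun D (EFin \o quartic_moment j 1).
  by apply/measurable_EFinP/measurable_funTS; exact: measurable_quartic_moment.
apply: fine_gt0; apply/andP; split.
- apply: (@lt_le_trans _ _ (\int[mu]_(s in `[1%R, 2%R]) (4 * expR (- 16))%:E)%E).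
    rewrite integral_cst//= lebesgue_measure_itv/= lte_fin ltr1n/= -EFinB -EFinM.
    by rewrite lte_fin !mulr_gt0 ?expR_gt0//; lra.
  apply: (@le_trans _ _ (\int[mu]_(s in `[1%R, 2%R]) (quartic_moment j 1 s)%:E)%E).
    apply: ge0_le_integral => //.
    + exact: mf.
    move=> s; rewrite /= in_itv/= => /andP[s1 s2].
    rewrite lee_fin /quartic_moment mul1r; apply: ler_pM.
    + by [].
    + exact: expR_ge0.
    + have : 1 <= (s ^+ 2) ^+ j by rewrite exprn_ege1// exprn_ege1.
      by nra.
    + rewrite ler_expR lerN2 (_ : 16 = 2 ^+ 4); last by ring.
      by rewrite lerXn2r ?nnegrE// (le_trans _ s1).
  apply: ge0_subset_integral => //; first exact: mf.
  + by move=> s; rewrite /= in_itv/= andbT => s0; rewrite lee_fin quartic_moment_ge0.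
  + by move=> s; rewrite /= !in_itv/= andbT => /andP[+ _]; apply: lt_le_trans.
- pose C : R := 4 * (j`!%:R + j.+1`!%:R) * expR 1.
  have C0 : 0 <= C by rewrite !mulr_ge0 ?expR_ge0// addr_ge0.
  apply: (@le_lt_trans _ _ (\int[mu]_(s in `]0%R, +oo[) (C * gaussian 1 s)%:E)%E).
    apply: ge0_le_integral => //.
    + by move=> s; rewrite /= in_itv/= andbT => s0; rewrite lee_fin quartic_moment_ge0.
    + exact: mf.
    + apply/measurable_EFinP/measurable_funTS/measurable_funM => //.
      exact: measurable_gaussian.
    by move=> s; rewrite /= in_itv/= andbT => s0; rewrite lee_fin quartic_moment_le.
  apply: (@le_lt_trans _ _ (\int[mu]_s (C * gaussian 1 s)%:E)%E).
    apply: ge0_subset_integral => //.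
    + apply/measurable_EFinP/measurable_funM => //; exact: measurable_gaussian.
    + by move=> s _; rewrite lee_fin mulr_ge0 ?gaussian_ge0.
  under eq_integral do rewrite EFinM.
  rewrite ge0_integralZl_EFin//.
  + by rewrite integral_gaussian// -EFinM ltry.
  + by move=> s _; rewrite lee_fin gaussian_ge0.
  + by apply/measurable_EFinP; exact: measurable_gaussian.
Qed.

Lemma Rintegral_quartic_moment (j : nat) (q : R) : 0 < q ->
  \int[mu]_s (half_line s * quartic_moment j q s) =
  Gamma (j.+1%:R / 2) * q `^ (- (j.+1%:R / 2)).
Proof.
move=> q0; rewrite Rintegral_half_line powRN /Gamma {2}/Rintegral.
rewrite (integral_quartic_moment j q0).
have p0 : 0 < q `^ (j.+1%:R / 2) by exact: powR_gt0.
rewrite /Rintegral; case: (integral _ _ _) => [x| |] /=.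
- by rewrite mulrC mulKf// lt0r_neq0.
- by rewrite gt0_muley ?lte_fin//= mul0r.
- by rewrite gt0_muleNy ?lte_fin//= mul0r.
Qed.

End gamma.

(** * Bessel integrals *)

Section bessel.
Context {R : realType}.
Notation mu := (@lebesgue_measure R).

Let bigcup_symmetric : [set: R] = \bigcup_n `[- n%:R, n%:R]%classic.
Proof.
apply/esym/seteqP; split => // x _.
exists (Num.truncn `|x|).+1 => //=; rewrite in_itv/= -ler_norml.
exact/ltW/truncnS_gt.
Qed.

(** The shift [v] is free; it will make the exponent symmetric in [u]. *)
Lemma ge0_integral_expR4 (v : R) (g : R -> R) :
  (forall s, 0 < s -> {for s, continuous g}) -> (forall s, 0 < s -> 0 <= g s) ->
  (\int[mu]_(s in `]0%R, +oo[) (g s)%:E =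
   \int[mu]_u (g (expR ((u + v) / 4)) * (expR ((u + v) / 4) / 4))%:E)%E.
Proof.
move=> cg g0.
apply: (@ge0_substitution_exhaustion R (fun u => expR ((u + v) / 4))
  (fun u => expR ((u + v) / 4) / 4) g setT
  `]0, +oo[%classic (fun n => - n%:R) (fun n => n%:R)).
- exact: openT.
- by move=> n; rewrite (@le_trans _ _ 0)// oppr_le0.
- by move=> n k nk; rewrite lerN2 ler_nat.
- by move=> n k nk; rewrite ler_nat.
- exact: bigcup_symmetric.
- apply/seteqP; split => [y|y [n _]]/=; rewrite !in_itv/= andbT; last first.
    by case/andP => + _; apply: lt_le_trans; exact: expR_gt0.
  move=> y0; have : [set: R] (4 * ln y - v) by [].
  rewrite bigcup_symmetric => -[n _]/=; rewrite in_itv/= => /andP[n1 n2].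
  exists n => //=; rewrite in_itv/= -[y]lnK ?posrE// !ler_expR.
  by apply/andP; split; lra.
- by move=> x y _ _ xy; rewrite ltr_expR; lra.
- by move=> x _; apply: is_derive_eq; rewrite /GRing.scale/=; field.
- move=> x _; apply/differentiable_continuous/derivable1_diffP; exact: ex_derive.
- by move=> y; rewrite /= in_itv/= andbT; exact: cg.
- by move=> y; rewrite /= in_itv/= andbT; exact: g0.
Qed.

Definition bessel_weight (z u : R) : R := expR (- z * cosh u).

Lemma continuous_bessel_weight z : continuous (bessel_weight z).
Proof.
move=> u; rewrite /bessel_weight /cosh.
apply/differentiable_continuous/derivable1_diffP; exact: ex_derive.
Qed.

(** The integrand is even. *)
Lemma integral_BesselK0 (z : R) :
  fine (\int[mu]_u (bessel_weight z u)%:E)%E = 2 * BesselK 0 z.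
Proof.
have cf := continuous_bessel_weight (z := z).
rewrite ge0_symfun_integralT//; last 2 first.
- by move=> u; exact: expR_ge0.
- by move=> u; rewrite /bessel_weight /cosh/= opprK addrC.
rewrite (_ : [set x : R | 0 <= x] = `[0, +oo[%classic); last first.
  by apply/seteqP; split => x /=; rewrite in_itv/= andbT.
rewrite -integral_itv_obnd_cbnd; last first.
  by apply/measurable_EFinP/measurable_funTS; exact: continuous_measurable_fun.
rewrite /BesselK; under [in RHS]eq_Rintegral do
  rewrite mul0r [cosh 0]/cosh oppr0 expR0 divff// mulr1.
rewrite /Rintegral -[in RHS]/(bessel_weight z).
case: (integral _ _ _) => [x| |] //=; first by rewrite gt0_muley ?lte_fin//= mulr0.
by rewrite gt0_muleNy ?lte_fin//= mulr0.
Qed.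

(** The two integrals are exchanged by [u |-> - u], and their sum is a Gaussian
integral in [y = sinh (u / 2)], since [cosh u = 1 + 2 y^2]. *)
Lemma integral_expR_half_weight (z : R) : 0 < z ->
  (\int[mu]_u (expR (u / 2) * bessel_weight z u)%:E =
   (2 * expR (- z) * (Num.sqrt pi / Num.sqrt (2 * z)))%:E)%E /\
  (\int[mu]_u (expR (- (u / 2)) * bessel_weight z u)%:E =
   (2 * expR (- z) * (Num.sqrt pi / Num.sqrt (2 * z)))%:E)%E.
Proof.
move=> z0.
pose h (e u : R) := expR (e * (u / 2)) * bessel_weight z u.
have ch e : continuous (h e).
  move=> u; rewrite /h /bessel_weight /cosh.
  apply/differentiable_continuous/derivable1_diffP; exact: ex_derive.
have h0 e u : 0 <= h e u by rewrite mulr_ge0 ?expR_ge0.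
have mh e : measurable_fun setT (h e) by exact: continuous_measurable_fun.
have mhE e : measurable_fun setT (fun u : R => (h e u)%:E).
  by apply/measurable_EFinP; exact: mh.
have hE0 e (u : R) : [set: R] u -> (0%:E <= (h e u)%:E)%E by rewrite lee_fin.
set c := _ * _ * _.
have h1E : (\int[mu]_u (expR (u / 2) * bessel_weight z u)%:E =
            \int[mu]_u (h 1 u)%:E)%E.
  by apply: eq_integral => u _; rewrite /h mul1r.
have hNE : (\int[mu]_u (expR (- (u / 2)) * bessel_weight z u)%:E =
            \int[mu]_u (h (-1) u)%:E)%E.
  by apply: eq_integral => u _; rewrite /h mulN1r.
have sym : (\int[mu]_u (h 1 u)%:E = \int[mu]_u (h (-1) u)%:E)%E.
  rewrite (ge0_integral_reflect (mh 1) (h0 1)); apply: eq_integral => u _.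
  by rewrite /h /bessel_weight /cosh opprK [expR (- u) + _]addrC mul1r mulN1r mulNr.
rewrite h1E hNE -sym; suff -> : (\int[mu]_u (h 1 u)%:E = c%:E)%E by split.
pose F u : R := (expR (u / 2) - expR (- (u / 2))) / 2.
have q0 : 0 < Num.sqrt (2 * z) by rewrite sqrtr_gt0 mulr_gt0.
have FE u : F u * F u * 2 = cosh u - 1.
  have e1 : expR (u / 2) * expR (u / 2) = expR u by rewrite -expRD -splitr.
  have e2 : expR (- (u / 2)) * expR (- (u / 2)) = expR (- u).
    by rewrite -expRD -opprD -splitr.
  have e3 : expR (u / 2) * expR (- (u / 2)) = 1 by exact: expRxMexpNx_1.
  rewrite /F /cosh -e1 -e2.
  move: e3; set x := expR (u / 2); set y := expR (- (u / 2)) => xy.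
  by transitivity ((x * x + y * y) / 2 - x * y); [field|rewrite xy].
have S : ((Num.sqrt pi / Num.sqrt (2 * z))%:E =
    (expR z / 4)%:E * (\int[mu]_u (h 1 u)%:E + \int[mu]_u (h (-1) u)%:E))%E.
  move=> {h1E hNE sym}; rewrite -(integral_gaussian q0).
  transitivity (\int[mu]_u (gaussian (Num.sqrt (2 * z)) (F u) *
      ((expR (u / 2) + expR (- (u / 2))) / 4))%:E)%E; last first.
    rewrite -(ge0_integralD mu measurableT (hE0 1) (mhE 1) (hE0 (-1)) (mhE (-1))).
    rewrite -(ge0_integralZl_EFin mu measurableT); last 3 first.
    - by move=> u _; exact: (adde_ge0 (hE0 1 u I) (hE0 (-1) u I)).
    - exact: (emeasurable_funD (mhE 1) (mhE (-1))).
    - by rewrite divr_ge0 ?expR_ge0.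
    apply: eq_integral => u _; rewrite -EFinD -EFinM; congr EFin.
    rewrite /h /bessel_weight mul1r mulN1r /gaussian exprMn sqr_sqrtr; last first.
      by rewrite mulr_ge0// ltW.
    have -> : 2 * z * F u ^+ 2 = z * cosh u - z.
      by rewrite -[X in _ = _ - X]mulr1 -mulrBr -FE; ring.
    by rewrite opprB expRD mulNr; field.
  apply: (@ge0_substitution_exhaustion R F
    (fun u => (expR (u / 2) + expR (- (u / 2))) / 4) (gaussian (Num.sqrt (2 * z)))
    setT setT (fun n => - n%:R) (fun n => n%:R)).
  - exact: openT.
  - by move=> n; rewrite (@le_trans _ _ 0)// oppr_le0.
  - by move=> n k nk; rewrite lerN2 ler_nat.
  - by move=> n k nk; rewrite ler_nat.
  - exact: bigcup_symmetric.
  - apply/esym/seteqP; split => // y _.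
    have : [set: R] (2 * y) by [].
    rewrite bigcup_symmetric => -[n _]/=; rewrite in_itv/= => /andP[n1 n2].
    exists (n + n)%N => //=; rewrite in_itv/= /F.
    have e : (n + n)%:R / 2 = n%:R :> R by rewrite natrD; field.
    have lo : 1 + n%:R <= expR (n%:R : R) by exact: expR_ge1Dx.
    have hi : expR (- n%:R : R) <= 1 by rewrite -expR0 ler_expR oppr_le0.
    by rewrite mulNr e opprK; apply/andP; split; lra.
  - move=> x y _ _ xy; rewrite /F ltr_pM2r//; apply: ltrB.
      by rewrite ltr_expR; lra.
    by rewrite ltr_expR; lra.
  - by move=> x _; apply: is_derive_eq; rewrite /GRing.scale/=; field.
  - move=> x _; apply/differentiable_continuous/derivable1_diffP; exact: ex_derive.
  - by move=> y _; exact: continuous_gaussian.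
  - by move=> y _; exact: gaussian_ge0.
move: S; rewrite -sym => {h1E hNE sym FE mhE hE0 mh ch h0}; case: (integral _ _ _) => [x| |] //=.
- rewrite -EFinD -EFinM => -[S]; congr EFin.
  by rewrite /c S expRN; field; rewrite lt0r_neq0// expR_gt0.
- by rewrite gt0_muley ?lte_fin// divr_gt0 ?expR_gt0.
- by rewrite gt0_muleNy ?lte_fin// divr_gt0 ?expR_gt0.
Qed.

End bessel.

(** * The scale integrals at a fixed frequency *)

Section decay_integrals.
Context {R : realType}.
Notation mu := (@lebesgue_measure R).
Variables A B : R.
Hypotheses (A0 : 0 < A) (B0 : 0 < B).

(** The exponential factor of the kernels in frequency space, as a function of the
scale. *)
Definition decay (s : R) : R :=
  expR (- ((A * s ^+ 2) ^+ 2 + (pi * B / s ^+ 2) ^+ 2)).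

Let z : R := 2 * (pi * (A * B)).
(* With this shift, A^2 s^4 = pi A B e^u and pi^2 B^2 / s^4 = pi A B e^(- u). *)
Let v : R := ln (pi * B / A).
Let c : R := expR (v / 2).

Let pi0 : 0 < pi :> R. Proof. exact: pi_gt0. Qed.

Let c0 : 0 < c. Proof. exact: expR_gt0. Qed.

Let cE : c ^+ 2 = pi * B / A.
Proof.
by rewrite /c expr2 -expRD -splitr lnK// posrE divr_gt0// mulr_gt0.
Qed.

Let z0 : 0 < z. Proof. by rewrite !mulr_gt0. Qed.

Let sqrt_z : Num.sqrt (2 * z) = 2 * A * c.
Proof.
rewrite (_ : 2 * z = (2 * A * c) ^+ 2); last first.
  by rewrite exprMn cE /z; field; rewrite lt0r_neq0.
by rewrite sqrtr_sqr ger0_norm// !mulr_ge0// ltW.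
Qed.

Let subst (u : R) : R := expR ((u + v) / 4).

Let subst2 u : subst u ^+ 2 = expR (u / 2) * c.
Proof. by rewrite /subst expr2 -!expRD; congr expR; field. Qed.

Let decayE u : decay (subst u) = bessel_weight z u.
Proof.
rewrite /decay subst2 /bessel_weight /cosh /z; congr expR.
have e1 : expR u = expR (u / 2) * expR (u / 2) by rewrite -expRD -splitr.
rewrite expRN e1; move: (expR_gt0 (u / 2)); set x := expR (u / 2) => x0.
rewrite expr_div_n !exprMn cE; move: (pi : R) pi0 => p p0; field.
by rewrite !lt0r_neq0.
Qed.

Lemma continuous_decay s : 0 < s -> {for s, continuous decay}.
Proof.
move=> s0; apply/differentiable_continuous/derivable1_diffP.
have s2 : s ^+ 2 != 0 by rewrite expf_neq0// lt0r_neq0.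
rewrite /decay; exact: ex_derive.
Qed.

Lemma decay_ge0 s : 0 <= decay s. Proof. exact: expR_ge0. Qed.

Let integral_decay (p w : R -> R) (k : R) :
  (forall s, 0 < s -> {for s, continuous p}) -> (forall s, 0 < s -> 0 <= p s) ->
  0 <= k -> measurable_fun setT w -> (forall u, 0 <= w u) ->
  (forall u, p (subst u) * (subst u / 4) = k * w u) ->
  (\int[mu]_(s in `]0%R, +oo[) (p s * decay s)%:E =
   k%:E * \int[mu]_u (w u * bessel_weight z u)%:E)%E.
Proof.
move=> cp p0 k0 mw w0 pE.
have mb : measurable_fun setT (bessel_weight z).
  by apply: continuous_measurable_fun; exact: continuous_bessel_weight.
rewrite -ge0_integralZl_EFin//; last 2 first.
- by move=> u _; rewrite lee_fin mulr_ge0// expR_ge0.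
- by apply/measurable_EFinP; exact: measurable_funM.
rewrite (@ge0_integral_expR4 _ v (fun s => p s * decay s)).
- apply: eq_integral => u _; rewrite decayE -EFinM; congr EFin.
  by rewrite mulrAC pE mulrA.
- by move=> s s0; apply: continuousM; [exact: cp|exact: continuous_decay].
- by move=> s s0; rewrite mulr_ge0 ?decay_ge0 ?p0.
Qed.

Let subst_gt0 u : 0 < subst u. Proof. exact: expR_gt0. Qed.

Lemma integral_decay_V :
  fine (\int[mu]_(s in `]0%R, +oo[) (2 / s * decay s)%:E)%E = BesselK 0 z.
Proof.
rewrite (@integral_decay (fun s => 2 / s) (fun=> 1) 2^-1)//.
- under eq_integral do rewrite mul1r.
  have := integral_BesselK0 z; case: (integral _ _ _) => [x| |] /= E.
  + by rewrite E mulKf.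
  + by rewrite gt0_muley ?lte_fin//=; lra.
  + by rewrite gt0_muleNy ?lte_fin//=; lra.
- move=> s s0; apply: cvgM; first exact: cvg_cst.
  by apply: cvgV; [rewrite lt0r_neq0|exact: cvg_id].
- by move=> s s0; rewrite divr_ge0// ltW.
- by move=> u; field; rewrite lt0r_neq0.
Qed.

Lemma integral_decay_1 : (\int[mu]_(s in `]0%R, +oo[) (2 * s * decay s)%:E)%E =
  (Num.sqrt pi / (2 * A) * expR (- z))%:E.
Proof.
have [E _] := integral_expR_half_weight z0.
rewrite (@integral_decay (fun s => 2 * s) (fun u => expR (u / 2)) (c / 2))//.
- rewrite E -EFinM sqrt_z; congr EFin.
  by field; rewrite !lt0r_neq0.
- move=> s s0; apply/differentiable_continuous/derivable1_diffP; exact: ex_derive.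
- by move=> s s0; rewrite mulr_ge0// ltW.
- by rewrite divr_ge0// ltW.
- by apply: measurableT_comp => //; exact: measurable_funM.
- move=> u; transitivity (2^-1 * subst u ^+ 2); first by field.
  by rewrite subst2; ring.
Qed.

Lemma integral_decay_V3 :
  (\int[mu]_(s in `]0%R, +oo[) (2 / s ^+ 3 * decay s)%:E)%E =
  (Num.sqrt pi / (2 * pi * B) * expR (- z))%:E.
Proof.
have [_ E] := integral_expR_half_weight z0.
rewrite (@integral_decay (fun s => 2 / s ^+ 3) (fun u => expR (- (u / 2)))
  (2 * c)^-1)//.
- rewrite E -EFinM sqrt_z; congr EFin.
  have -> : 2 * pi * B = 2 * A * c ^+ 2 by rewrite cE; field; rewrite lt0r_neq0.
  by field; rewrite !lt0r_neq0.
- move=> s s0; apply/differentiable_continuous/derivable1_diffP.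
  have s2 : s ^+ 3 != 0 by rewrite expf_neq0// lt0r_neq0.
  exact: ex_derive.
- by move=> s s0; rewrite divr_ge0// exprn_ge0// ltW.
- by rewrite invr_ge0 mulr_ge0// ltW.
- by do 2 apply: measurableT_comp => //; exact: measurable_funM.
- move=> u; transitivity (2^-1 / subst u ^+ 2); first by field; rewrite lt0r_neq0.
  rewrite subst2 expRN; field.
  by rewrite !lt0r_neq0// expR_gt0.
Qed.

End decay_integrals.

(** * Superpositions in closed form *)

Section real_integrals.
Context d (T : measurableType d) (R : realType) (mu : {measure set T -> \bar R}).
Implicit Types f : T -> R.

Lemma Cintegral_real f : Cintegral mu (fun s => (f s)%:C) = (\int[mu]_s f s)%:C.
Proof. by apply: Cext => //=; rewrite /Rintegral integral0. Qed.

Lemma Cintegral_realM f (c : R[i]) : mu.-integrable setT (EFin \o f) ->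
  Cintegral mu (fun s => (f s)%:C * c) = (\int[mu]_s f s)%:C * c.
Proof.
move=> fi; rewrite CintegralZ ?Cintegral_real//.
by split => //; exact: integrable0.
Qed.

(** If the integral of [f] diverges, both sides are 0. *)
Lemma ge0_RintegralZl f (k : R) : measurable_fun setT f -> (forall s, 0 <= f s) ->
  0 <= k -> \int[mu]_s (k * f s) = k * \int[mu]_s f s.
Proof.
move=> mf f0 k0; rewrite /Rintegral.
under eq_integral do rewrite EFinM.
rewrite ge0_integralZl_EFin//; last 2 first.
- by move=> s _; rewrite lee_fin.
- exact/measurable_EFinP.
have : (0 <= \int[mu]_s (f s)%:E)%E by apply: integral_ge0 => s _; rewrite lee_fin.
case: (integral _ _ _) => [x| |]//= _.
move: k0; rewrite le_eqVlt => /orP[/eqP <-|k0]; first by rewrite mul0e mul0r.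
by rewrite gt0_muley ?lte_fin//= mulr0.
Qed.

(** A divergent integral of a nonnegative function counts as 0. *)
Lemma Rintegral_neq0_integrable f : measurable_fun setT f -> (forall s, 0 <= f s) ->
  \int[mu]_s f s != 0 -> mu.-integrable setT (EFin \o f).
Proof.
move=> mf f0 If; apply/integrableP; split; first exact/measurable_EFinP.
under eq_integral do rewrite /= ger0_norm//.
by move: If; rewrite /Rintegral ltey; case: (integral _ _ _) => //=; rewrite eqxx.
Qed.

End real_integrals.

Section subordination.
Context {R : realType} (m : nat).
Notation mu := (@lebesgue_measure R).
Notation V := (m.-tuple R).
Notation X := (measurableTypeR R * V * V)%type.
Implicit Types (b : 'I_m.+1 -> R[i]) (z : X).

Lemma eq_half_line (f g : R -> R) : (forall s, 0 < s -> f s = g s) ->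
  forall s, half_line s * f s = half_line s * g s.
Proof.
move=> fg s; have [s0|s0] := ltP 0 s; first by rewrite fg.
by rewrite half_lineE ltNge s0/= !mul0r.
Qed.

Lemma quad_ge1 z : 1 <= quad z.
Proof.
case: z => -[t x] y; rewrite /quad -!addrA lerDl.
by rewrite !addr_ge0 ?normsq_ge0// mulr_ge0// sqr_ge0.
Qed.

Let quad_gt0 z : 0 < quad z. Proof. exact: lt_le_trans (quad_ge1 z). Qed.

Let exponent0 (s : R) z :
  exponent (s ^+ 2) (2 * s ^+ 2) (s ^+ 2) z = quad z * s ^+ 4.
Proof. by case: z => -[t x] y; rewrite /exponent /quad; ring. Qed.

Lemma affineM (bs g : R[i]) b (l : R) (tau sig : R[i]) z :
  affine (bs * g) (fun j => b j * g) l tau sig z = affine bs b l tau sig z * g.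
Proof.
case: z => -[t x] y; rewrite /affine !mulrDl mulr_suml; congr (_ + _ + _).
- by rewrite mulrAC.
- by rewrite mulrAC.
- by apply: eq_bigr => j _; rewrite mulrAC.
Qed.

Lemma affine_cst (bs : R[i]) (l : R) (tau sig : R[i]) z :
  affine bs (fun=> 0) l tau sig z = bs * (l^-1)%:C.
Proof.
case: z => -[t x] y; rewrite /affine mul0r addr0 big1 ?addr0// => j _.
by rewrite mul0r.
Qed.

Let measurable_hq j q : measurable_fun setT (fun s : R => half_line s * quartic_moment j q s).
Proof.
by apply: measurable_funM; [exact: measurable_half_line|exact: measurable_quartic_moment].
Qed.

Let hq_ge0 j q (s : R) : 0 <= half_line s * quartic_moment j q s.
Proof.
rewrite half_lineE; have [s0|] := ltP 0 s; last by rewrite mul0r.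
by rewrite mul1r quartic_moment_ge0.
Qed.

(** Euler's integral at [q = quad z]. *)
Lemma hplus_subordination z :
  hplus z = superpose mu half_line
    (family0 ((Gamma (m.+1%:R / 2))^-1)%:C (fun=> 0)) z.
Proof.
have G0 := Gamma_half_gt0 (R := R) m.
rewrite /superpose.
transitivity (Cintegral mu (fun s =>
    ((Gamma (m.+1%:R / 2))^-1 * (half_line s * quartic_moment m (quad z) s))%:C)).
  rewrite Cintegral_real ge0_RintegralZl ?invr_ge0 ?(ltW G0)//.
  - by rewrite Rintegral_quartic_moment// mulKf ?lt0r_neq0//; case: z => -[t x] y.
  - exact: measurable_hq.
apply: eq_Cintegral => s; rewrite /family0 /gauss_family /gauss_kernel exponent0.
rewrite affine_cst -!rmorphM /=; congr (_%:C).
rewrite mulrCA; move: s; apply: eq_half_line => s s0.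
by rewrite /quartic_moment /kap0; field; rewrite !lt0r_neq0.
Qed.

Lemma hminus_subordination b z :
  hminus b z = superpose mu half_line
    (family0 0 (fun j => b j * ((Gamma (m.+2%:R / 2))^-1)%:C)) z.
Proof.
have G0 := Gamma_half_gt0 (R := R) m.+1.
rewrite /superpose.
transitivity (Cintegral mu (fun s => (half_line s * quartic_moment m.+1 (quad z) s)%:C *
    (affine 0 b 1 (2 * 'i%C) 'i%C z * ((Gamma (m.+2%:R / 2))^-1)%:C))).
  rewrite Cintegral_realM; last first.
    apply: Rintegral_neq0_integrable.
    - exact: measurable_hq.
    - by move=> s; exact: hq_ge0.
    by rewrite Rintegral_quartic_moment// mulf_neq0 ?lt0r_neq0// powR_gt0.
  rewrite Rintegral_quartic_moment//.
  rewrite mulrC -mulrA -rmorphM/= mulrA mulVf ?lt0r_neq0// mul1r mulrC.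
  case: z => -[t x] y; rewrite /hminus; congr (_ * _); rewrite /affine mul0r add0r.
  congr (_ + _).
    by congr (_ * _); apply: Cext; simpc.
  apply: eq_bigr => j _.
  by congr (_ * _); apply: Cext; simpc.
apply: eq_Cintegral => s; rewrite /family0 /gauss_family /gauss_kernel exponent0.
rewrite -[in RHS](mul0r ((Gamma (m.+2%:R / 2))^-1)%:C) affineM.
have -> : affine 0 b (s ^+ 2) (2 * 'i%C) 'i%C z = affine 0 b 1 (2 * 'i%C) 'i%C z.
  by case: z => -[t x] y; rewrite /affine !mul0r.
rewrite [RHS]mulrA -rmorphM/=; congr (_%:C * _); move: s; apply: eq_half_line => s s0.
by rewrite /quartic_moment /kap0 [(s ^+ 2) ^+ m.+1]exprS; ring.
Qed.

Let pi0 : 0 < pi :> R. Proof. exact: pi_gt0. Qed.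

Let powR_pi n : pi `^ (n%:R / 2) = Num.sqrt pi ^+ n :> R.
Proof.
by rewrite mulrC powRrM powR12_sqrt ?(ltW pi0)// powR_mulrn// sqrtr_ge0.
Qed.

Let kap2E (s : R) : 0 < s -> kap2 m s = Num.sqrt pi ^+ m.+1 * (2 * s).
Proof.
move=> s0; rewrite /kap2 /kap1 /kap0 expr_div_n [Num.sqrt pi ^+ m.+1]exprS.
by field; rewrite ?expf_neq0 ?lt0r_neq0.
Qed.

Definition spacenorm (x : V) : R := Num.sqrt (1 + normsq x).

Let spacenorm_gt0 x : 0 < spacenorm x.
Proof. by rewrite sqrtr_gt0 ltr_wpDr ?normsq_ge0. Qed.

Let decayE (s rho : R) (x eta : V) :
  expR (- exponent (s ^+ 2) (pi / (2 * s ^+ 2)) (pi / s ^+ 2) (rho, x, eta)) =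
  decay (spacenorm x) (freqnorm rho eta) s.
Proof.
rewrite /exponent /decay /spacenorm; congr (expR (- _)).
have e1 : Num.sqrt (1 + normsq x) ^+ 2 = 1 + normsq x.
  by rewrite sqr_sqrtr// addr_ge0// normsq_ge0.
have e2 : freqnorm rho eta ^+ 2 = rho ^+ 2 / 4 + normsq eta.
  by rewrite sqr_sqrtr// addr_ge0 ?normsq_ge0// divr_ge0 ?sqr_ge0.
rewrite invfM; set i := (s ^+ 2)^-1; set q := s ^+ 2; clearbody i q.
rewrite [(_ * q) ^+ 2]exprMn e1.
rewrite (_ : (pi * freqnorm rho eta * i) ^+ 2 =
  pi ^+ 2 * i ^+ 2 * freqnorm rho eta ^+ 2); last by ring.
by rewrite e2; field.
Qed.

Let measurable_hd (p : R -> R) A B : measurable_fun setT p ->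
  measurable_fun setT (fun s => half_line s * (p s * decay A B s)).
Proof.
move=> mp; apply: measurable_funM; first exact: measurable_half_line.
apply: measurable_funM => //.
apply: measurableT_comp => //; apply: measurableT_comp => //; apply: measurable_funD.
  by apply: measurable_funX; apply: measurable_funM => //; exact: measurable_funX.
by apply: measurable_funX; apply: measurable_funM => //; exact: measurable_sqrV.
Qed.

Let measurable_V (p : R -> R) : measurable_fun setT p ->
  measurable_fun setT (fun s : R => p s / s).
Proof.
move=> mp; apply: measurable_funM => //; exact: measurable_inv.
Qed.

Let psiE rho (x eta : V) :
  2 * (pi * (spacenorm x * freqnorm rho eta)) = 2 * pi * psi ((rho, x, eta) : X).
Proof. by rewrite /psi mulrA. Qed.

Lemma superpose_family2_K0 (g rho : R) (x eta : V) :
  0 <= g -> 0 < freqnorm rho eta ->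
  superpose mu half_line (family2 g%:C (fun=> 0)) (rho, x, eta) =
  (pi `^ (m.+1%:R / 2) * g * BesselK 0 (2 * pi * psi ((rho, x, eta) : X)))%:C.
Proof.
move=> g0 B0; rewrite /superpose powR_pi.
pose f s := half_line s * (2 / s * decay (spacenorm x) (freqnorm rho eta) s).
transitivity (Cintegral mu (fun s => (Num.sqrt pi ^+ m.+1 * g * f s)%:C)).
  apply: eq_Cintegral => s; rewrite /family2 /gauss_family /gauss_kernel decayE.
  rewrite affine_cst -!rmorphM /=; congr (_%:C).
  rewrite /f [RHS]mulrCA; move: s; apply: eq_half_line => s s0.
  by rewrite kap2E//; field; rewrite !lt0r_neq0.
rewrite Cintegral_real ge0_RintegralZl.
- congr (_ * _)%:C; rewrite /f Rintegral_half_line /Rintegral -psiE.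
  exact: integral_decay_V.
- by rewrite /f; apply: measurable_hd; exact: measurable_V.
- move=> s; rewrite /f half_lineE; have [s0|] := ltP 0 s; last by rewrite mul0r.
  by rewrite mul1r mulr_ge0 ?decay_ge0// divr_ge0// ltW.
- by rewrite mulr_ge0// exprn_ge0// sqrtr_ge0.
Qed.

Let finite_hd (p : R -> R) A B (k : R) : measurable_fun setT p ->
  (forall s, 0 < s -> 0 <= p s) -> k != 0 ->
  (\int[mu]_(s in `]0%R, +oo[) (p s * decay A B s)%:E)%E = k%:E ->
  mu.-integrable setT (EFin \o (fun s => half_line s * (p s * decay A B s))) /\
  \int[mu]_s (half_line s * (p s * decay A B s)) = k.
Proof.
move=> mp p0 k0 E.
have I : \int[mu]_s (half_line s * (p s * decay A B s)) = k.
  by rewrite Rintegral_half_line /Rintegral E.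
split => //; apply: Rintegral_neq0_integrable; last by rewrite I.
- exact: measurable_hd.
- move=> s; rewrite half_lineE; have [s0|] := ltP 0 s; last by rewrite mul0r.
  by rewrite mul1r mulr_ge0 ?decay_ge0// p0.
Qed.

(** The affine factor is [P - (pi / s^4) Q]; the integrals of its two terms are
[sqrt pi / (2 A)] and [sqrt pi / (2 B)], up to the common factors, and they
combine into [(B P - A Q) / (A B)]. *)
Lemma superpose_family2_phi b (rho : R) (x eta : V) : 0 < freqnorm rho eta ->
  superpose mu half_line (family2 0 b) (rho, x, eta) =
  (pi `^ (m.+2%:R / 2) / 2)%:C *
  (phi b ((rho, x, eta) : X) / (psi ((rho, x, eta) : X))%:C) *
  (expR (- (2 * pi * psi ((rho, x, eta) : X))))%:C.
Proof.
move=> B0; set z : X := (rho, x, eta); rewrite /superpose powR_pi.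
pose A := spacenorm x; pose B := freqnorm rho eta.
have A0 : 0 < A := spacenorm_gt0 x.
pose E := expR (- (2 * pi * psi z)).
have E0 : 0 < E by exact: expR_gt0.
have q0 : 0 < Num.sqrt pi :> R by rewrite sqrtr_gt0.
pose P := b ord0 * 1 + \sum_(j < m) b (lift ord0 j) * (tnth x j)%:C.
pose Q := b ord0 * (rho / 2)%:C + \sum_(j < m) b (lift ord0 j) * (tnth eta j)%:C.
have [||||i1 I1] := @finite_hd (fun s => 2 * s) A B (Num.sqrt pi / (2 * A) * E).
- exact: measurable_funM.
- by move=> s s0; rewrite mulr_ge0// ltW.
- by rewrite lt0r_neq0// mulr_gt0// divr_gt0// mulr_gt0.
- by rewrite /E -psiE; exact: integral_decay_1.
have [||||i2 I2] := @finite_hd (fun s => 2 / s ^+ 3) A B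
  (Num.sqrt pi / (2 * pi * B) * E).
- under eq_fun do rewrite -exprVn.
  by apply: measurable_funM => //; apply: measurable_funX; exact: measurable_inv.
- by move=> s s0; rewrite divr_ge0// exprn_ge0// ltW.
- by rewrite lt0r_neq0// mulr_gt0// divr_gt0// !mulr_gt0.
- by rewrite /E -psiE; exact: integral_decay_V3.
pose f1 s := half_line s * (2 * s * decay A B s).
pose f2 s := half_line s * (2 / s ^+ 3 * decay A B s).
pose c := Num.sqrt pi ^+ m.+1 : R.
transitivity (Cintegral mu (fun s =>
    (f1 s)%:C * (c%:C * P) + (f2 s)%:C * (- (c * pi)%:C * Q))).
  apply: eq_Cintegral => s; rewrite /family2 /gauss_family /gauss_kernel decayE.
  have [s0|s0] := ltP 0 s; last first.
    by rewrite /f1 /f2 half_lineE ltNge s0 !mul0r addr0.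
  have -> : affine 0 b (s ^+ 2) (pi / (2 * (s ^+ 2) ^+ 2))%:C
      (pi / (s ^+ 2) ^+ 2)%:C z = P - (pi / (s ^+ 2) ^+ 2)%:C * Q.
    rewrite /z /affine mul0r add0r /P /Q [X in _ = _ - X]mulrDr opprD addrACA; congr (_ + _).
      rewrite mulrBr; congr (_ - _); rewrite [RHS]mulrCA -!rmorphM/=.
      by congr (_ * _%:C); field; rewrite lt0r_neq0.
    rewrite mulr_sumr -sumrB; apply: eq_bigr => j _.
    by rewrite mulrBr mulrCA.
  rewrite /f1 /f2 half_lineE s0 !mul1r kap2E//.
  rewrite -/A -/B -/c.
  by field; rewrite fmorph_eq0 lt0r_neq0.
have ci1 : Cintegrable mu (fun s => (f1 s)%:C) by split => //; exact: integrable0.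
have ci2 : Cintegrable mu (fun s => (f2 s)%:C) by split => //; exact: integrable0.
rewrite CintegralD; [|exact: CintegrableZ|exact: CintegrableZ].
rewrite !Cintegral_realM// I1 I2.
have ps : psi z = A * B by [].
have -> : phi b z = B%:C * P - A%:C * Q by [].
rewrite -/E ps [Num.sqrt pi ^+ m.+2]exprS -/c -(sqr_sqrtr (ltW pi0)).
by field; rewrite !fmorph_eq0 !lt0r_neq0.
Qed.

End subordination.

(** * Measurability and exceptional frequencies *)

Section measurability.
Context {R : realType} (m : nat).
Notation mu := (@lebesgue_measure R).
Notation V := (m.-tuple R).
Notation X := (measurableTypeR R * V * V)%type.

Lemma measurable_sqrt : measurable_fun setT (fun a : R => Num.sqrt a).
Proof. by apply: continuous_measurable_fun; exact: sqrt_continuous. Qed.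

Lemma measurable_freqnorm : measurable_fun setT (fun z : X => freqnorm z.1.1 z.2).
Proof.
have m1 : measurable_fun setT (fun z : X => z.1.1).
  by apply: (measurableT_comp measurable_fst); exact: measurable_fst.
apply: (measurableT_comp measurable_sqrt).
apply: measurable_funD.
  by apply: measurable_funM => //; exact: measurable_funX.
exact: (measurableT_comp (@measurable_normsq R m)).
Qed.

Lemma measurable_spacenorm : measurable_fun setT (fun z : X => spacenorm z.1.2).
Proof.
apply: (measurableT_comp measurable_sqrt); apply: measurable_funD => //.
by apply: (measurableT_comp (@measurable_normsq R m)); exact: measurableT_comp.
Qed.

Lemma measurable_psi : measurable_fun setT (@psi R m).
Proof.
rewrite (_ : @psi R m = fun z : X =>
    spacenorm z.1.2 * freqnorm z.1.1 z.2); last by apply/funext => -[[]].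
exact: (measurable_funM measurable_spacenorm measurable_freqnorm).
Qed.

Lemma measurable_BesselK0 : measurable_fun setT (@BesselK R 0).
Proof.
rewrite (_ : @BesselK R 0 = fun z => \int[mu]_u (half_line u * bessel_weight z u)).
  apply: (@measurable_Rintegral_param _ _ _ _ _ mu
    (fun p => half_line p.1 * bessel_weight p.2 p.1)).
  apply: measurable_funM.
    by apply: measurableT_comp => //; exact: measurable_half_line.
  apply: measurableT_comp => //; apply: measurable_funM.
    by apply: measurableT_comp => //; exact: measurable_snd.
  apply: (measurableT_comp (f := @cosh R)) => //; apply: continuous_measurable_fun.
  move=> u; rewrite /cosh.
  apply/differentiable_continuous/derivable1_diffP; exact: ex_derive.
apply/funext => z; rewrite Rintegral_half_line; apply: eq_Rintegral => u _.
by rewrite mul0r [cosh 0]/cosh oppr0 expR0 divff// mulr1.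
Qed.

Lemma Cmeasurable_phi (b : 'I_m.+1 -> R[i]) : Cmeasurable (phi b).
Proof.
have m1 : measurable_fun setT (fun z : X => z.1.1).
  by apply: (measurableT_comp measurable_fst); exact: measurable_fst.
have m2 : measurable_fun setT (fun z : X => z.1.2).
  by apply: (measurableT_comp measurable_snd); exact: measurable_fst.
have lin (y : X -> V) (u : X -> R) : measurable_fun setT y -> measurable_fun setT u ->
    Cmeasurable (fun z => b ord0 * (u z)%:C +
      \sum_(j < m) b (lift ord0 j) * (tnth (y z) j)%:C).
  move=> my mu; apply: CmeasurableD.
    by apply: CmeasurableM; [exact: Cmeasurable_cst|exact: Cmeasurable_real].
  apply: Cmeasurable_sum => j; apply: CmeasurableM; first exact: Cmeasurable_cst.
  by apply: Cmeasurable_real; exact: (measurableT_comp (measurable_tnth j) my).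
rewrite (_ : phi b = fun z : X => (freqnorm z.1.1 z.2)%:C *
    (b ord0 * 1%:C + \sum_(j < m) b (lift ord0 j) * (tnth z.1.2 j)%:C) -
    (spacenorm z.1.2)%:C *
    (b ord0 * (z.1.1 / 2)%:C + \sum_(j < m) b (lift ord0 j) * (tnth z.2 j)%:C));
  last by apply/funext => -[[]].
apply: CmeasurableB; apply: CmeasurableM.
- by apply: Cmeasurable_real; exact: measurable_freqnorm.
- exact: lin.
- by apply: Cmeasurable_real; exact: measurable_spacenorm.
- by apply: lin => //; exact: measurable_funM.
Qed.

Lemma phiM (b : 'I_m.+1 -> R[i]) (g : R[i]) (z : X) :
  phi (fun j => b j * g) z = phi b z * g.
Proof.
have lin (y : V) (u : R[i]) : b ord0 * g * u + \sum_(j < m) b (lift ord0 j) * g *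
    (tnth y j)%:C = (b ord0 * u + \sum_(j < m) b (lift ord0 j) * (tnth y j)%:C) * g.
  rewrite mulrDl mulrAC mulr_suml; congr (_ + _); apply: eq_bigr => j _.
  by rewrite mulrAC.
by case: z => -[rho x] eta; rewrite /phi !lin /omega/= !mulrA mulrBl.
Qed.

(** Where the frequency vanishes the integrals over the scale diverge; this happens
only on the hyperplane [rho = 0]. *)
Lemma freqnorm_gt0_ae : {ae lebesgue_txy m, forall z : X, 0 < freqnorm z.1.1 z.2}.
Proof.
exists (([set 0] `*` setT) `*` setT); have m0 : measurable ([set 0] `*` setT : set (measurableTypeR R * V)).
  exact: measurableX.
split.
- exact: measurableX.
- rewrite [LHS](product_measure1E (lebesgue_tx m) _ m0)//.
  rewrite [X in (X * _)%E](product_measure1E mu)//.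
  by rewrite [X in (X * _ * _)%E](lebesgue_measure_set1 (0 : R)) !mul0e.
- move=> [[rho x] eta] /= H; split => //=; split => //=.
  apply: contrapT => rho0; apply: H.
  rewrite /freqnorm sqrtr_gt0 ltr_wpDr ?normsq_ge0// divr_gt0//.
  by rewrite exprn_even_gt0//=; apply/eqP.
Qed.

End measurability.

(* In the first formula the power of pi is (m+1)/2, which is the correct
   constant; the source prints (m+2)/2, off by a factor sqrt pi. *)
Theorem proposition7p1 (R : realType) (m : nat) (b : 'I_m.+1 -> R[i]) :
  fourier_t_xi (@hplus R m)
    (fun z => (pi `^ (m.+1%:R / 2) / Gamma (m.+1%:R / 2)
               * BesselK 0 (2 * pi * psi z))%:C)
  /\
  fourier_t_xi (hminus b)
    (fun z => (pi `^ (m.+2%:R / 2) / (2 * Gamma (m.+2%:R / 2)))%:C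
              * (phi b z / (psi z)%:C)
              * (expR (- (2 * pi * psi z)))%:C).
Proof.
have Gp j := Gamma_half_gt0 (R := R) j.
have mpsi : measurable_fun setT (fun z => 2 * pi * @psi R m z).
  by apply: measurable_funM => //; exact: measurable_psi.
split.
- apply: (fourier_t_xi_superpose (bs := ((Gamma (m.+1%:R / 2))^-1)%:C) (b := fun=> 0)).
  + rewrite (funext (@hplus_subordination R m)).
    apply: Cmeasurable_superpose.
      exact: Cmeasurable_family0.
    exact: measurable_half_line.
  + by apply: aeW => z; exact: hplus_subordination.
  + apply: Cmeasurable_real; apply: measurable_funM => //.
    exact: (measurableT_comp measurable_BesselK0).
  + rewrite lebesgue_txyE; apply: filterS (freqnorm_gt0_ae m) => -[[rho x] eta] /= B0.
    by rewrite superpose_family2_K0// invr_ge0 ltW.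
- apply: (fourier_t_xi_superpose (bs := 0)
    (b := fun j => b j * ((Gamma (m.+2%:R / 2))^-1)%:C)).
  + rewrite (funext (@hminus_subordination R m b)).
    apply: Cmeasurable_superpose.
      exact: Cmeasurable_family0.
    exact: measurable_half_line.
  + by apply: aeW => z; exact: hminus_subordination.
  + apply: CmeasurableM.
      apply: CmeasurableM; first exact: Cmeasurable_cst.
      apply: CmeasurableM; first exact: Cmeasurable_phi.
      have -> : (fun z => ((psi z)%:C)^-1) = (fun z => ((@psi R m z)^-1)%:C).
        by apply/funext => z; rewrite fmorphV.
      by apply: Cmeasurable_real; exact: (measurableT_comp measurable_inv (@measurable_psi R m)).
    apply: Cmeasurable_real; apply: measurableT_comp => //; exact: measurableT_comp.
  + rewrite lebesgue_txyE; apply: filterS (freqnorm_gt0_ae m) => -[[rho x] eta] B0.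
    rewrite superpose_family2_phi// phiM; congr (_ * _).
    rewrite [phi _ _ * _ / _]mulrAC [RHS]mulrCA -rmorphM/= mulrC.
    by congr (_ * _%:C); rewrite invfM mulrA.
Qed.
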